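(* Let $\mathsf S$ be a full-dimensional simple polytope with the origin in the interior, and let $\mathrm B$ be a building set of faces of $\mathsf S$. Let $\mathsf P_{\mathrm B}$ be a $\mathrm B$-truncation of $\mathsf S$. Then: (1) For $\epsilon>0$ small enough, the set $\{\operatorname{Tr}_\epsilon[\mathsf S,\mathsf F] : \mathsf F\in\mathrm B\}$ of shallow $\epsilon$-truncations along the faces in $\mathrm B$ is a polytopal basis for the deformation space of $\mathsf P_{\mathrm B}$. (2) The collection $\{\operatorname{DTr}[\mathsf S,\mathsf F] : \mathsf F\in\mathrm B\}\cup\{\mathsf S\}$ of deep truncations together with the seed polytope is a polytopal generating set for the deformation space of $\mathsf P_{\mathrm B}$. (3) If $\mathsf S$ is a Delzant polytope, then $\{\operatorname{Tr}_1[\mathsf S,\mathsf F] : \mathsf F\in\mathrm B\}\cup\{\mathsf S\}$ is an integral polytopal generating set for the deformation space of $\mathsf P_{\mathrm B}$. (4) If $\mathsf S$ is a primitive Delzant polytope, then $\{\operatorname{DTr}[\mathsf S,\mathsf F] : \mathsf F\in\mathrm B\}=\{\operatorname{Tr}_1[\mathsf S,\mathsf F] : \mathsf F\in\mathrm B\}$ is a flat (all its elements are flat truncations), not necessarily integral, polytopal basis for the deformation space of $\mathsf P_{\mathrm B}$.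
   Context: Conventions. Let $\Lambda$ be a lattice (by default $\mathbb Z^n\subset\mathbb R^n$) and $V=\Lambda\otimes\mathbb R$. Polytopes live in $V$; normal vectors live in $V^*$, which contains the dual lattice $\Lambda^*$ (for $\mathbb R^n$ everything is identified via the dot product). All polytopes are assumed to have rational facet normals. $h(\mathsf P,u)=\min_{x\in\mathsf P}u\cdot x$. For a nonempty face $\mathsf F$ of $\mathsf P$, its normal cone is $\{u : u\cdot x=h(\mathsf P,u)\ \forall x\in\mathsf F\}$; the normal fan $\Sigma(\mathsf P)$ is the collection of normal cones of nonempty faces. A fan coarsens another if each of its cones is a union of cones of the other. Face normals. For a facet $\mathsf G$ of $\mathsf S$, $u_{\mathsf G}\in\Lambda^*$ is its primitive inner normal; for a nonempty proper face $\mathsf F$, $u_{\mathsf F}=\sum_{\mathsf G\supseteq\mathsf F}u_{\mathsf G}$ over the facets containing $\mathsf F$. Truncations. For a nonempty proper face $\mathsf F$ and $\epsilon>0$, $\operatorname{Tr}_\epsilon[\mathsf S,\mathsf F]=\{x\in\mathsf S : u_{\mathsf F}\cdot x\ge h(\mathsf S,u_{\mathsf F})+\epsilon\}$. A vertex $y\notin\mathsf F$ is a neighbor of $\mathsf F$ if it is joined by an edge to a vertex of $\mathsf F$; $\delta_{\mathsf F}=\min\{u_{\mathsf F}\cdot y-h(\mathsf S,u_{\mathsf F}) : y\text{ a neighbor of }\mathsf F\}$. The truncation is shallow if $0<\epsilon<\delta_{\mathsf F}$; the deep truncation is $\operatorname{DTr}[\mathsf S,\mathsf F]=\operatorname{Tr}_{\delta_{\mathsf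 F}}[\mathsf S,\mathsf F]$; it is flat if it equals the convex hull of the vertices of $\mathsf S$ not in $\mathsf F$. Building sets. A set $\mathrm B$ of nonempty proper faces of a simple polytope $\mathsf S$ is a building set for $\mathsf S$ if (i) $\mathrm B$ contains all facets; (ii) whenever $\mathsf F,\mathsf G\in\mathrm B$ satisfy $\mathsf F\cap\mathsf G\neq\emptyset$ and some facet contains both $\mathsf F$ and $\mathsf G$, then $\mathsf F\cap\mathsf G\in\mathrm B$. (Equivalently, the normal cones of the faces in $\mathrm B$ contain all rays, and if two of them intersect nontrivially and their convex hull is a cone of $\Sigma(\mathsf S)$, then that cone is also among them.) $\mathrm B$-truncation. List $\mathrm B$ as $\mathsf F_1,\dots,\mathsf F_m$ in an order extending inclusion (smaller faces first), let $\mathsf S_0=\mathsf S$, and for numbers $\epsilon_{\mathsf F}>0$ let $\mathsf S_i=\operatorname{Tr}_{\epsilon_{\mathsf F_i}}[\mathsf S_{i-1},\mathsf F_i\cap\mathsf S_{i-1}]$ (truncating in direction $u_{\mathsf F_i}$). If each truncation is shallow, $\mathsf S_m$ is a $\mathrm B$-truncation of $\mathsf S$. Deformations. A deformation of $\mathsf P$ is a polytope whose normal fan coarsens $\Sigma(\mathsf P)$. The deformation space of $\mathsf P$ is the vector space $\operatorname{PL}(\Sigma(\mathsf P))$ of functions on $V^*$ that are linear on each cone of $\Sigma(\mathsf P)$. A collection of deformations of $\mathsf P$ is a polytopal generating set (resp. polytopal basis) if their support functions span (resp. form a basis of) $\operatorname{PL}(\Sigma(\mathsf P))$. The integral deformation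 space is the subgroup of functions whose restriction to each cone is given by an element of $\Lambda$; a polytopal generating set is integral if its support functions generate this group over $\mathbb Z$. Smoothness. A full-dimensional polytope with vertices in $\Lambda$ is Delzant (smooth) if at every vertex the primitive lattice vectors along the incident edges form a basis of $\Lambda$. It is primitive Delzant if moreover the only lattice points on each edge are its endpoints. *)

(* Defs.v *)
(* MathComp-Analysis.  Both V and V^* are 'rV[R]_n, identified through the dot
   product, and the lattice and its dual are the integer vectors.  Polytopes
   are point sets, so the faces of a polytope are sets of points as well. *)
From mathcomp Require Import all_boot all_order all_algebra.
From mathcomp Require Import all_classical reals topology normedtype.

Set Implicit Arguments.
Unset Strict Implicit.
Unset Printing Implicit Defensive.

Import Order.TTheory GRing.Theory Num.Theory.
Import numFieldNormedType.Exports.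

Local Open Scope classical_set_scope.
Local Open Scope ring_scope.

Section Combinations.
Variables (R : realType) (M : lmodType R).
Implicit Types (K : set R) (A : set M).

Definition span_over K A : set M :=
  [set x | exists m (c : 'I_m -> R) (g : 'I_m -> M),
     [/\ forall i, K (c i), forall i, A (g i) & x = \sum_i c i *: g i]].

Definition free_over K A : Prop :=
  forall m (c : 'I_m -> R) (g : 'I_m -> M), injective g ->
    (forall i, K (c i)) -> (forall i, A (g i)) ->
    \sum_i c i *: g i = 0 -> forall i, c i = 0.

Definition basis_over K A (W : set M) : Prop :=
  span_over K A = W /\ free_over K A.

Definition conv A : set M :=
  [set x | exists m (c : 'I_m -> R) (g : 'I_m -> M),
     [/\ forall i, 0 <= c i, \sum_i c i = 1, forall i, A (g i)
       & x = \sum_i c i *: g i]].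

End Combinations.

Definition integers (R : realType) : set R := [set c | c \is a Num.int].

Section Polytopes.
Variables (R : realType) (n : nat).
Local Notation V := 'rV[R]_n.
Implicit Types (P Q S F G E : set V) (B C : set (set V)).

Definition dot (u x : V) : R := (u *m x^T) 0 0.

Definition lattice : set V := [set x | x \is a mxOver Num.int].

(* The zero vector is not primitive: take k = 2. *)
Definition primitive (w : V) : Prop :=
  lattice w /\ forall (k : nat) (w' : V), lattice w' -> w = w' *+ k -> k = 1%N.

Definition polytope P : Prop := exists s : seq V, s != [::] /\ P = conv [set` s].

(* Dimension of the affine hull: U is the direction space of that hull. *)
Definition has_dim (A : set V) (d : nat) : Prop :=
  exists (x : V) (U : {vspace V}),
    [/\ A x, \dim U = d, forall y, A y -> y - x \in U
      & forall W : {vspace V}, (forall y, A y -> y - x \in W) -> (U <= W)%VS].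

Definition full_dimensional P : Prop := has_dim P n.

(* The infimum is a minimum, as polytopes are compact and nonempty. *)
Definition supp P (u : V) : R^o := inf [set dot u x | x in P].

Definition face_at P (u : V) : set V := [set x | P x /\ dot u x = supp P u].

(* The nonempty faces of P, including P itself (u = 0). *)
Definition face P F : Prop := exists u : V, F = face_at P u.

Definition vertex P (v : V) : Prop := face P [set v].

Definition edge P E : Prop := face P E /\ has_dim E 1.

Definition facet P G : Prop :=
  face P G /\ exists d, has_dim P d.+1 /\ has_dim G d.

Definition simple P : Prop :=
  exists2 d, has_dim P d &
    forall v, vertex P v -> ([set G | facet P G /\ G v] #= `I_d)%card.

Definition rational_facets P : Prop :=
  forall G, facet P G -> exists u : 'rV[rat]_n, G = face_at P (map_mx ratr u).

Definition normal_cone P F : set V :=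
  [set u | forall x, F x -> dot u x = supp P u].

Definition normal_fan P : set (set V) := [set normal_cone P F | F in face P].

Definition coarsens (Sigma Sigma' : set (set V)) : Prop :=
  forall K, Sigma K ->
    exists2 D, D `<=` Sigma' & K = \bigcup_(K' in D) K'.

Definition deformation P Q : Prop :=
  polytope Q /\ coarsens (normal_fan Q) (normal_fan P).

Definition PL (Sigma : set (set V)) : set (V -> R^o) :=
  [set f | forall K, Sigma K -> exists x : V, forall u, K u -> f u = dot u x].

Definition PLZ (Sigma : set (set V)) : set (V -> R^o) :=
  [set f | forall K, Sigma K ->
     exists2 x : V, lattice x & forall u, K u -> f u = dot u x].

Definition polytopal_generating_set P C : Prop :=
  C `<=` deformation P /\ span_over setT (supp @` C) = PL (normal_fan P).

Definition polytopal_basis P C : Prop :=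
  C `<=` deformation P /\ basis_over setT (supp @` C) (PL (normal_fan P)).

Definition integral_polytopal_generating_set P C : Prop :=
  polytopal_generating_set P C /\
  span_over (@integers R) (supp @` C) = PLZ (normal_fan P).

Definition facet_normal S G : V :=
  xget 0 [set u | primitive u /\ G = face_at S u].

Definition face_normal S F : V :=
  \sum_(G \in [set G | facet S G /\ F `<=` G]) facet_normal S G.

Definition neighbor P F (y : V) : Prop :=
  [/\ vertex P y, ~ F y &
      exists v E, [/\ vertex P v, F v, edge P E, E v & E y]].

(* The direction u is a separate argument: iterated truncations of S along a
   face F keep the direction face_normal S F of the seed S. *)
Definition delta P F (u : V) : R :=
  inf [set dot u y - supp P u | y in neighbor P F].

Definition cut P (u : V) (e : R) : set V :=
  [set x | P x /\ supp P u + e <= dot u x].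

Definition shallow_cut P F (u : V) (e : R) : Prop := 0 < e < delta P F u.

Definition Tr (e : R) S F : set V := cut S (face_normal S F) e.

Definition shallow (e : R) S F : Prop := shallow_cut S F (face_normal S F) e.

Definition DTr S F : set V := Tr (delta S F (face_normal S F)) S F.

Definition flat S F : Prop := DTr S F = conv [set v | vertex S v /\ ~ F v].

Definition building_set S B : Prop :=
  [/\ forall F, B F -> face S F /\ F <> S,
      forall G, facet S G -> B G
    & forall F G, B F -> B G -> F `&` G !=set0 ->
        (exists2 H, facet S H & F `<=` H /\ G `<=` H) -> B (F `&` G)].

(* Q is obtained from P by shallow truncations along the faces of S listed
   in s, in this order. *)
Fixpoint shallow_truncations S (s : seq (set V)) P Q : Prop :=
  if s is F :: s' then
    exists e, shallow_cut P (F `&` P) (face_normal S F) e /\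
      shallow_truncations S s' (cut P (face_normal S F) e) Q
  else Q = P.

Definition B_truncation S B Q : Prop :=
  exists s : seq (set V),
    [/\ uniq s, [set` s] = B,
        forall i j, (i < size s)%N -> (j < size s)%N ->
          nth set0 s i `<` nth set0 s j -> (i < j)%N
      & shallow_truncations S s S Q].

(* The primitive vectors along the edges of P at v, pointing away from v. *)
Definition edge_directions P (v : V) : set V :=
  [set w | primitive w /\
     exists E (t : R), [/\ edge P E, E v, 0 < t & E (v + t *: w)]].

Definition delzant P : Prop :=
  [/\ full_dimensional P, vertex P `<=` lattice
    & forall v, vertex P v ->
        basis_over (@integers R) (edge_directions P v) lattice].

(* The vertices of P lying on an edge are the endpoints of that edge. *)
Definition primitive_delzant P : Prop :=
  delzant P /\ forall E x, edge P E -> E x -> lattice x -> vertex P x.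

Definition seed S : Prop :=
  [/\ polytope S, full_dimensional S, rational_facets S, simple S
    & interior S 0].

End Polytopes.

(* Main.v *)
(* On the normal fan of the simple polytope S a functional q has unique
   coordinates c_G(q) >= 0 on the facet normals, and for 0 <= e <= delta_F

     supp (Tr e S F) = supp S + e phi_F,   phi_F(q) = min_(G containing F) c_G(q).

   Shallowness forces the faces of B whose truncating hyperplanes meet at a
   point of PB to be nested: a vertex of an intermediate polytope that is not on
   the face being cut lies strictly beyond the cut.  With the building set axiom
   this makes each phi_F linear on every normal cone of PB.  As PB is cut out by
   the inequalities with normals u_F, its normal cones are generated by the u_F,
   and phi_F(u_F') is 1 if F' is contained in F and 0 otherwise: a unitriangular
   matrix.  So the phi_F form a basis of PL, and over the integers when S is
   Delzant.  Since supp S = - \sum_G a_G phi_G over the facets, with a_G > 0,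
   the functions supp S + e phi_F form a basis as soon as e is not A = \sum a_G;
   in the primitive Delzant case e = 1, and A is never 1.  There supp S is an
   integral combination of the basis only if A - 1 divides A, which fails for
   the hexagon, where A = 6. *)
Require Import Defs.
From mathcomp Require Import all_boot all_order all_algebra.
From mathcomp Require Import all_classical reals topology normedtype.
From mathcomp Require Import ring lra.

Set Implicit Arguments.
Unset Strict Implicit.
Unset Printing Implicit Defensive.

Import Order.TTheory GRing.Theory Num.Theory.
Import numFieldNormedType.Exports.
Local Open Scope classical_set_scope.
Local Open Scope ring_scope.

(** * Farkas' lemma *)

(** The shape of [phi_F] has a geometric source. If q is minimal on S at a vertex v of F, the edges
    at v that leave F run along the vectors dual to the normals of the facets containing F, and
    moving by e along the edge dual to u_G raises q by e c_G(q). The cheapest of these edges gives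
    the minimum of the c_G(q), and up to delta_F all of them are long enough. If v is off F, some
    c_G(q) vanishes and v survives the cut. No combinatorial model of the normal fan of PB is built.
    Linear programming duality gives what is needed: a functional minimal at a point y of PB is a
    nonnegative combination of the u_F tight at y. The nestedness of these F is carried through the
    cuts as an invariant. The exceptional value A comes from the identity \sum_G a_G (supp S + e
    phi_G) = (A - e) supp S, summed over the facets. For e = A it is a linear relation among the
    truncations; otherwise it recovers supp S from them, at the price of a division by A - e. With e
    = 1 this division is the obstruction to integrality. *)

Section DotProduct.
Variables (R : realType) (n : nat).
Local Notation V := 'rV[R]_n.
Implicit Types (u v x y : V) (a : R).

Lemma dotE u x : dot u x = \sum_j u 0 j * x 0 j.
Proof. by rewrite /dot mxE; apply: eq_bigr => j _; rewrite !mxE. Qed.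

Lemma dotC u x : dot u x = dot x u.
Proof. by rewrite !dotE; apply: eq_bigr => j _; rewrite mulrC. Qed.

Lemma dotDl u v x : dot (u + v) x = dot u x + dot v x.
Proof. by rewrite /dot mulmxDl mxE. Qed.

Lemma dotZl a u x : dot (a *: u) x = a * dot u x.
Proof. by rewrite /dot -scalemxAl mxE. Qed.

Lemma dotDr u x y : dot u (x + y) = dot u x + dot u y.
Proof. by rewrite dotC dotDl !(dotC u). Qed.

Lemma dotZr a u x : dot u (a *: x) = a * dot u x.
Proof. by rewrite dotC dotZl dotC. Qed.

Lemma dot0l x : dot 0 x = 0.
Proof. by rewrite -(scale0r x) dotZl mul0r. Qed.

Lemma dot0r u : dot u 0 = 0.
Proof. by rewrite dotC dot0l. Qed.

Lemma dotNl u x : dot (- u) x = - dot u x.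
Proof. by rewrite -scaleN1r dotZl mulN1r. Qed.

Lemma dotNr u x : dot u (- x) = - dot u x.
Proof. by rewrite dotC dotNl dotC. Qed.

Lemma dotBl u v x : dot (u - v) x = dot u x - dot v x.
Proof. by rewrite dotDl dotNl. Qed.

Lemma dotBr u x y : dot u (x - y) = dot u x - dot u y.
Proof. by rewrite dotDr dotNr. Qed.

Lemma dot_suml (I : Type) (r : seq I) (P : pred I) (F : I -> V) x :
  dot (\sum_(i <- r | P i) F i) x = \sum_(i <- r | P i) dot (F i) x.
Proof.
by elim/big_rec2: _ => [|i y1 y2 _ <-]; rewrite ?dot0l // dotDl.
Qed.

Lemma dot_sumr (I : Type) (r : seq I) (P : pred I) (F : I -> V) u :
  dot u (\sum_(i <- r | P i) F i) = \sum_(i <- r | P i) dot u (F i).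
Proof. by rewrite dotC dot_suml; apply: eq_bigr => i _; rewrite dotC. Qed.

Lemma dot_delta u j : dot u (delta_mx 0 j) = u 0 j.
Proof.
rewrite dotE (bigD1 j) //= big1 ?addr0 => [|k kj]; rewrite mxE eqxx /=.
  by rewrite eqxx mulr1.
by rewrite (negPf kj) mulr0.
Qed.

Lemma dot_inj u v : (forall x, dot u x = dot v x) -> u = v.
Proof. by move=> uv; apply/rowP => j; rewrite -!dot_delta. Qed.

Lemma dot_injr x y : (forall u, dot u x = dot u y) -> x = y.
Proof. by move=> xy; apply: dot_inj => u; rewrite !(dotC _ u). Qed.

Lemma dot_self_gt0 u : u != 0 -> 0 < dot u u.
Proof.
move=> u0; rewrite dotE lt0r sumr_ge0 ?andbT => [|j _]; last exact: sqr_ge0.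
apply: contra u0; rewrite psumr_eq0 => [|j _]; last exact: sqr_ge0.
move=> /allP u0; apply/eqP/rowP => j; rewrite mxE.
by have := u0 j (mem_index_enum _); rewrite /= mulf_eq0 orbb => /eqP.
Qed.

End DotProduct.

Section Farkas.
Variable R : realType.

(* If [b] is not in the cone of the first m generators, some [y] separates it;
   when [y] is negative on the last generator, project along that generator
   onto the orthogonal of [y] and recurse. *)
Lemma farkas n m (a : 'I_m -> 'rV[R]_n) (b : 'rV[R]_n) :
  (exists c : 'I_m -> R, (forall i, 0 <= c i) /\ b = \sum_i c i *: a i) \/
  (exists y, (forall i, 0 <= dot (a i) y) /\ dot b y < 0).
Proof.
elim: m a b => [|m IH] a b.
  have [->|b0] := eqVneq b 0.
    by left; exists (fun _ => 0); split=> //; rewrite big_ord0.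
  by right; exists (- b); split=> [[]//|]; rewrite dotNr oppr_lt0 dot_self_gt0.
pose a' (i : 'I_m) := a (widen_ord (leqnSn m) i).
have [[c [c0 bE]]|[y [ya yb]]] := IH a' b.
  left; exists (fun i => oapp c 0 (insub (val i))); split=> [i|].
    by case: insub.
  rewrite big_ord_recr /= insubN ?ltnn // scale0r addr0 bE.
  by apply: eq_bigr => i _; rewrite [insub _](valK i).
have [yl|yl] := leP 0 (dot (a ord_max) y).
  right; exists y; split=> // i; case: (unliftP ord_max i) => [j ->|-> //].
  by have := ya j; congr (0 <= dot (a _) y); apply: val_inj;
    rewrite /= /bump leqNgt ltn_ord.
pose l := a ord_max; pose z x := x - (dot x y / dot l y) *: l.
have l0 : dot l y != 0 by rewrite lt_eqF.
have [[c [c0 bE]]|[w [wa wb]]] := IH (fun i => z (a' i)) (z b).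
  (* The last coefficient restores what the projection removed. It is nonnegative because [b] and
     [l] are both negative on [y], while the other generators are nonnegative there. *)
  left; exists (fun i => if insub (val i) is Some j then c j else
     dot b y / dot l y - \sum_j c j * (dot (a' j) y / dot l y)); split=> [i|].
    case: insub => // ; rewrite subr_ge0 (@le_trans _ _ 0) //.
      apply: sumr_le0 => j _; rewrite mulr_ge0_le0 //.
      by rewrite mulr_ge0_le0 // invr_le0 ltW.
    by rewrite mulr_le0 ?invr_le0 ?ltW.
  rewrite big_ord_recr /= insubN ?ltnn // -[a ord_max]/l.
  rewrite [X in X + _](_ : _ = \sum_j c j *: a' j); last first.
    by apply: eq_bigr => i _; rewrite [insub _](valK i).
  have : z b + (dot b y / dot l y) *: l = b by rewrite subrK.
  rewrite bE => {1}<-; rewrite scalerBl addrA addrAC; congr (_ + _).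
  rewrite scaler_suml -sumrB; apply: eq_bigr => i _.
  by rewrite scalerBr scalerA.
(* The transpose of the projection [z], applied to [w]. *)
right; exists (w - (dot l w / dot l y) *: y).
have key x : dot x (w - (dot l w / dot l y) *: y) = dot (z x) w.
  by rewrite dotBr dotZr dotBl dotZl; field.
split=> [i|]; last by rewrite key.
rewrite key; case: (unliftP ord_max i) => [j ->|->].
  by have := wa j; congr (0 <= dot (z (a _)) w); apply: val_inj;
    rewrite /= /bump leqNgt ltn_ord.
by rewrite /z -/l divff // scale1r subrr dot0l.
Qed.

Lemma dot_row_mx n (u x : 'rV[R]_n) (s t : R) :
  dot (row_mx u s%:M) (row_mx x t%:M) = dot u x + s * t.
Proof.
rewrite /dot tr_row_mx mul_row_col mxE; congr (_ + _).
by rewrite tr_scalar_mx -scalar_mxM mxE eqxx mulr1n.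
Qed.

Lemma row_mxP n (x : 'rV[R]_(n + 1)) :
  exists (x1 : 'rV[R]_n) (t : R), x = row_mx x1 t%:M.
Proof.
by exists (lsubmx x), (rsubmx x 0 0); rewrite -mx11_scalar hsubmxK.
Qed.

Lemma farkas_affine n m (a : 'I_m -> 'rV[R]_n) (be : 'I_m -> R) u ga :
  (exists x, forall i, be i <= dot (a i) x) ->
  (forall x, (forall i, be i <= dot (a i) x) -> ga <= dot u x) ->
  exists c : 'I_m -> R,
    [/\ forall i, 0 <= c i, u = \sum_i c i *: a i & ga <= \sum_i c i * be i].
Proof.
move=> [x0 x0P] uP.
(* Homogenization: the constants become a last coordinate, and the extra generator (0, 1) absorbs
   the slack in the bound [ga]. *)
pose A (i : 'I_m.+1) : 'rV_(n + 1) := if insub (val i) is Some j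
  then row_mx (a j) (- be j)%:M else row_mx 0 1%:M.
have AE (i : 'I_m) : A (widen_ord (leqnSn m) i) = row_mx (a i) (- be i)%:M.
  by rewrite /A [insub _](valK i).
have Al : A ord_max = row_mx 0 1%:M by rewrite /A /= insubN ?ltnn.
have [[c [c0 E]]|[y [yA yu]]] := farkas A (row_mx u (- ga)%:M).
  exists (fun i => c (widen_ord (leqnSn m) i)); split=> //.
    apply: dot_inj => x; move: (congr1 (fun w => dot w (row_mx x 0%:M)) E).
    rewrite big_ord_recr /= dotDl dotZl Al !dot_row_mx !mulr0 dot0l !addr0 mulr0 addr0 => ->.
    rewrite !dot_suml; apply: eq_bigr => i _.
    by rewrite !dotZl AE dot_row_mx mulr0 addr0.
  move: (congr1 (fun w => dot w (row_mx 0 1%:M)) E).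
  rewrite big_ord_recr /= dotDl dotZl Al !dot_row_mx !mulr1 !dot0r !add0r mulr1 dot_suml.
  rewrite (eq_bigr (fun i => - (c (widen_ord (leqnSn m) i) * be i))) => [|i _];
    last first.
    by rewrite dotZl AE dot_row_mx mulr1 dot0r add0r mulrN.
  rewrite sumrN => e; have := c0 ord_max; set s := \sum_i _; move: e; rewrite -/s.
  lra.
exfalso; have [y1 [t yE]] := row_mxP y.
move: yu; rewrite yE dot_row_mx => yu.
have t0 : 0 <= t by have := yA ord_max; rewrite Al yE dot_row_mx dot0l add0r mul1r.
have yi i : be i * t <= dot (a i) y1.
  have := yA (widen_ord (leqnSn m) i); rewrite AE yE dot_row_mx mulNr; lra.
have [t_gt0|] := boolP (0 < t).
  have : ga <= dot u (t^-1 *: y1).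
    by apply: uP => i; rewrite dotZr mulrC ler_pdivlMr.
  rewrite dotZr mulrC ler_pdivlMr //; lra.
rewrite lt_def t0 andbT negbK => /eqP tE; subst t.
have uy : dot u y1 < 0 by lra.
(* For t = 0 the vector [y1] is a recession direction along which [u] decreases; this [k] goes far
   enough to push [u] below [ga]. *)
pose k := (`|dot u x0 - ga| + 1) / - dot u y1.
have k0 : 0 <= k by rewrite divr_ge0 ?addr_ge0 // oppr_ge0 ltW.
have : ga <= dot u (x0 + k *: y1).
  apply: uP => i; rewrite dotDr dotZr -[be i]addr0 lerD // mulr_ge0 //.
  by have := yi i; rewrite mulr0.
rewrite dotDr dotZr.
have -> : k * dot u y1 = - (`|dot u x0 - ga| + 1) by rewrite /k; field; rewrite lt_eqF.
have := ler_norm (dot u x0 - ga); lra.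
Qed.

(** Strong duality with complementary slackness. One certificate [c] serves all optimal points x at
    once, which later ties the coordinates of a functional to a whole face. *)
Lemma dual_optimum n m (a : 'I_m -> 'rV[R]_n) (be : 'I_m -> R) u y :
  (forall i, be i <= dot (a i) y) ->
  (forall x, (forall i, be i <= dot (a i) x) -> dot u y <= dot u x) ->
  exists c : 'I_m -> R,
    [/\ forall i, 0 <= c i, u = \sum_i c i *: a i
      & forall x, (forall i, be i <= dot (a i) x) -> dot u x = dot u y ->
          forall i, c i != 0 -> dot (a i) x = be i].
Proof.
move=> yP uP.
have [c [c0 uE cb]] := farkas_affine (ex_intro _ y yP) uP.
exists c; split=> // x xP xy i ci.
have uxE : dot u x = \sum_i c i * dot (a i) x.
  by rewrite uE dot_suml; apply: eq_bigr => j _; rewrite dotZl.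
have s0 : \sum_i c i * (dot (a i) x - be i) = 0.
  apply/eqP; rewrite eq_le sumr_ge0 ?andbT => [|j _]; last first.
    by rewrite mulr_ge0 ?subr_ge0.
  rewrite (eq_bigr _ (fun j _ => mulrBr _ _ _)) sumrB -uxE xy.
  by rewrite subr_le0.
move/eqP: s0; rewrite psumr_eq0 => [/allP/(_ i (mem_index_enum _))|j _].
  by rewrite /= mulf_eq0 (negPf ci) subr_eq0 => /eqP.
by rewrite mulr_ge0 ?subr_ge0.
Qed.

End Farkas.

(** * Polytopes, faces and cuts *)

Lemma seq_argmin (R : realType) (T : eqType) (f : T -> R) (s : seq T) :
  s != [::] -> exists2 y, y \in s & forall z, z \in s -> f y <= f z.
Proof.
elim: s => // a s IH _; have [->|s0] := eqVneq s [::].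
  by exists a; rewrite ?mem_head // => z; rewrite inE => /eqP ->.
have [y ys ymin] := IH s0; have [ay|ya] := leP (f a) (f y).
  exists a; rewrite ?mem_head // => z; rewrite inE => /predU1P[-> //|/ymin].
  exact: le_trans.
exists y; rewrite ?inE ?ys ?orbT // => z; rewrite inE => /predU1P[->|/ymin //].
exact: ltW.
Qed.

Lemma convex_comb_lt (R : realType) (l l' a b : R) : 0 <= l -> 0 <= l' ->
  l + l' = 1 -> l * a + l' * b < a -> l * a + l' * b < b -> False.
Proof.
set m := l * a + l' * b => l0 l'0 ll ma mb.
have : l * (a - m) + l' * (b - m) = 0.
  have -> : l * (a - m) + l' * (b - m) = m - (l + l') * m by rewrite /m; ring.
  by rewrite ll mul1r subrr.
have /orP[lp|lp] : (0 < l) || (0 < l') 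
  by rewrite !lt0r l0 l'0 !andbT -negb_and; apply/negP => /andP[/eqP ? /eqP ?]; lra.
  by have := mulr_gt0 lp (_ : 0 < a - m); have := mulr_ge0 l'0 (_ : 0 <= b - m); lra.
by have := mulr_ge0 l0 (_ : 0 <= a - m); have := mulr_gt0 lp (_ : 0 < b - m); lra.
Qed.

Section ConvexHulls.
Variables (R : realType) (n : nat).
Local Notation V := 'rV[R]_n.
Implicit Types (A B : set V) (u x y z : V).

Lemma conv_fin (I : finType) A (c : I -> R) (g : I -> V) :
  (forall i, 0 <= c i) -> \sum_i c i = 1 -> (forall i, A (g i)) ->
  conv A (\sum_i c i *: g i).
Proof.
move=> c0 c1 gA; exists #|I|, (c \o enum_val), (g \o enum_val).
split=> [i|||]; first exact: c0.
- by rewrite -c1 (reindex (@enum_val I I)) //=; exact/onW_bij/enum_val_bij.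
- by move=> i; exact: gA.
- by rewrite (reindex (@enum_val I I)) //=; exact/onW_bij/enum_val_bij.
Qed.

Lemma mem_conv A y : A y -> conv A y.
Proof.
move=> Ay; exists 1%N, (fun=> 1), (fun=> y).
by split=> //; rewrite big_ord1 ?scale1r.
Qed.

Lemma conv_exists A x q : conv A x -> exists2 a, A a & dot q a <= dot q x.
Proof.
move=> [m [c [g [c0 c1 gA xE]]]]; apply: contrapT => H.
have gt i : 0 < dot q (g i) - dot q x.
  by rewrite subr_gt0 ltNge; apply/negP => le; apply: H; exists (g i).
have s0 : \sum_i c i * (dot q (g i) - dot q x) = 0.
  rewrite (eq_bigr _ (fun j _ => mulrBr _ _ _)) sumrB -mulr_suml c1 mul1r.
  rewrite xE dot_sumr; apply/eqP; rewrite subr_eq0.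
  by apply/eqP/eq_bigr => i _; rewrite dotZr.
move/eqP: s0; rewrite psumr_eq0 => [/allP cz|j _]; last by rewrite mulr_ge0 // ltW.
have : \sum_i c i = 0.
  apply: big1 => i _; have := cz i (mem_index_enum _).
  by rewrite mulf_eq0 (gt_eqF (gt i)) orbF => /eqP.
by rewrite c1 => /eqP; rewrite oner_eq0.
Qed.

Lemma conv_ge A x q (be : R) :
  conv A x -> (forall a, A a -> be <= dot q a) -> be <= dot q x.
Proof. by move=> /(conv_exists q)[a Aa ax] /(_ a Aa) /le_trans; apply. Qed.

Lemma conv_set1 y x : conv [set y] x -> x = y.
Proof.
move=> cx; apply: dot_injr => u; apply: le_anti.
have [_ -> ->] := conv_exists u cx; have [_ ->] := conv_exists (- u) cx.
by rewrite !dotNl lerN2 andbT.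
Qed.

Lemma conv_face A x u (be : R) : (forall a, A a -> be <= dot u a) ->
  conv A x -> dot u x = be -> conv [set a | A a /\ dot u a = be] x.
Proof.
move=> Abe [m [c [g [c0 c1 gA xE]]]] ux.
have s0 : \sum_i c i * (dot u (g i) - be) == 0.
  rewrite (eq_bigr _ (fun j _ => mulrBr _ _ _)) sumrB -mulr_suml c1 mul1r.
  rewrite -ux xE dot_sumr subr_eq0; apply/eqP/eq_bigr => i _.
  by rewrite dotZr.
have [i0 ci0] : exists i0, c i0 != 0.
  apply: contrapT => H; move: c1; rewrite big1 => [/eqP|i _].
    by rewrite eq_sym oner_eq0.
  by apply/eqP/negP => /negP ci; apply: H; exists i.
rewrite psumr_eq0 in s0; last by move=> j _; rewrite mulr_ge0 ?subr_ge0 ?Abe.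
have tight i : c i != 0 -> dot u (g i) = be.
  move=> ci; have := allP s0 i (mem_index_enum _).
  by rewrite mulf_eq0 (negPf ci) subr_eq0 => /eqP.
(* Points of weight zero need not lie on the hyperplane, so they are replaced by [g i0], which
   does. *)
exists m, c, (fun i => if c i == 0 then g i0 else g i); split=> // [i|].
  by case: ifPn => [_|/tight]; split=> //; exact: tight.
rewrite xE; apply: eq_bigr => i _; case: eqP => // ->.
by rewrite !scale0r.
Qed.

(** Farkas' lemma in one more dimension: a last coordinate 1 turns conic combinations into convex
    ones. *)
Lemma conv_sep (s : seq V) x : ~ conv [set` s] x ->
  exists u, forall y, y \in s -> dot u x < dot u y.
Proof.
move=> nx; pose a (i : 'I_(size s)) : 'rV[R]_(n + 1) := row_mx s`_i 1%:M.
have [[c [c0 cE]]|[y [ya yx]]] := farkas a (row_mx x 1%:M).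
  case: nx; exists (size s), c, (fun i => s`_i); split=> //.
  - move: (congr1 (fun w => dot w (row_mx 0 1%:M)) cE).
    rewrite dot_row_mx dot0r add0r mulr1 dot_suml => ->.
    by apply: eq_bigr => i _; rewrite dotZl dot_row_mx dot0r add0r !mulr1.
  - by move=> i; rewrite /= mem_nth.
  - apply: dot_inj => w; move: (congr1 (fun v => dot v (row_mx w 0%:M)) cE).
    rewrite dot_row_mx mulr0 addr0 !dot_suml => ->.
    by apply: eq_bigr => i _; rewrite !dotZl dot_row_mx mulr0 addr0.
have [w [t yE]] := row_mxP y; exists w => z zs.
have iz : (index z s < size s)%N by rewrite index_mem.
have := ya (Ordinal iz); move: yx; rewrite /a yE !dot_row_mx /= nth_index //.
rewrite !(dotC w); lra.
Qed.

Lemma conv_seq_sub (s : seq V) A : A `<=` conv [set` s] -> conv A `<=` conv [set` s].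
Proof.
move=> As x cx; apply: contrapT => /conv_sep[u us].
have [a /As ca ax] := conv_exists u cx.
have [b bs ba] := conv_exists u ca.
by have := us b bs; rewrite ltNge (le_trans ba ax).
Qed.

End ConvexHulls.

Section PolytopeBasics.
Variables (R : realType) (n : nat).
Local Notation V := 'rV[R]_n.
Implicit Types (P Q F : set V) (u x y z : V).

Lemma supp_eq P u y : P y -> (forall x, P x -> dot u y <= dot u x) ->
  supp P u = dot u y.
Proof.
move=> Py ymin; rewrite /supp; apply/le_anti/andP; split.
  by apply: ge_inf; [exists (dot u y) => _ [x /ymin ? <-] | exists y].
by apply: lb_le_inf; [exists (dot u y); exists y | move=> _ [x /ymin ? <-]].
Qed.

Lemma supp_attained P u : polytope P ->
  exists2 y, P y & (dot u y = supp P u) /\ forall x, P x -> dot u y <= dot u x.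
Proof.
move=> [s [s0 PE]]; have [y ys ymin] := seq_argmin (fun y => dot u y) s0.
have Py : P y by rewrite PE; exact: mem_conv.
have yP x : P x -> dot u y <= dot u x.
  by rewrite PE => /conv_ge; apply => a /ymin.
by exists y => //; split=> //; rewrite (supp_eq Py yP).
Qed.

Lemma supp_le P u x : polytope P -> P x -> supp P u <= dot u x.
Proof. by move=> /(supp_attained u)[y _ [<-]]; apply. Qed.

Lemma face_at_nonempty P u : polytope P -> face_at P u !=set0.
Proof. by move=> /(supp_attained u)[y Py [uy _]]; exists y. Qed.

Lemma face_sub P F : face P F -> F `<=` P.
Proof. by move=> [u ->] x []. Qed.

Lemma vertex_in P v : vertex P v -> P v.
Proof. by move=> /face_sub; apply. Qed.

Lemma irredundant_generators (s : seq V) : s != [::] ->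
  exists s' : seq V, [/\ s' != [::], conv [set` s'] = conv [set` s] &
    forall y, y \in s' -> exists u, forall z, z \in s' -> z != y -> dot u y < dot u z].
Proof.
have [k] := ubnP (size s); elim: k s => // k IH s; rewrite ltnS => sk s0.
have [all_exp|] := pselect (forall y, y \in s ->
    exists u, forall z, z \in s -> z != y -> dot u y < dot u z).
  by exists s.
move=> /existsNP[y /not_implyP[ys nexp]].
pose t := [seq z <- s | z != y].
have cy : conv [set` t] y.
  apply: contrapT => /conv_sep[u us]; apply: nexp; exists u => z zs zy.
  by apply: us; rewrite mem_filter zy.
have t0 : t != [::].
  by have [a ta _] := conv_exists 0 cy; apply/eqP => tE; move: ta; rewrite /= tE.
have tk : (size t < k)%N.
  apply: leq_trans sk; rewrite size_filter -(count_predC (fun z => z != y) s) -addn1 leq_add2l.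
  by rewrite -has_count; apply/hasP; exists y; rewrite //= negbK.
have [s' [s'0 s'E s'P]] := IH t tk t0.
exists s'; split=> //; rewrite s'E; apply/seteqP; split.
  apply: conv_seq_sub => z /=; rewrite mem_filter => /andP[_ zs].
  exact: mem_conv.
apply: conv_seq_sub => z /= zs; have [->//|zy] := eqVneq z y.
by apply: mem_conv; rewrite /= mem_filter zy.
Qed.

Lemma vertex_conv (s : seq V) v : vertex (conv [set` s]) v -> v \in s.
Proof.
move=> [u vE].
have [cv vs] : face_at (conv [set` s]) u v by rewrite -vE.
have pol : polytope (conv [set` s]).
  exists s; split=> //; apply/eqP => s0; have [a] := conv_exists 0 cv.
  by rewrite s0.
have ub a : a \in s -> supp (conv [set` s]) u <= dot u a.
  by move=> sa; apply: supp_le => //; exact: mem_conv.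
have [a [/= sa ua] _] := conv_exists 0 (conv_face ub cv vs).
have : face_at (conv [set` s]) u a by split=> //; exact: mem_conv.
by rewrite -vE => /= <-.
Qed.

Lemma polytope_vertices P : polytope P ->
  exists s : seq V, [/\ s != [::], P = conv [set` s]
    & forall y, y \in s <-> vertex P y].
Proof.
move=> polP; have [s0 [s00 PE]] := polP.
have [s [sn sE sexp]] := irredundant_generators s00.
have {}PE : P = conv [set` s] by rewrite PE.
exists s; split=> // y; split=> [ys|]; last by rewrite PE; exact: vertex_conv.
have [u uy] := sexp y ys; exists u.
have Py : P y by rewrite PE; exact: mem_conv.
have ymin z : z \in s -> dot u y <= dot u z.
  by move=> zs; have [->//|zy] := eqVneq z y; apply/ltW/uy.
have ymin' x : P x -> dot u y <= dot u x.
  by rewrite PE => /conv_ge; apply.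
have uE := supp_eq Py ymin'.
apply/seteqP; split=> [x -> //|x [Px ux]]; apply: conv_set1.
rewrite PE in Px; rewrite uE in ux.
have := conv_face ymin Px ux; congr (conv _ _).
apply/seteqP; split=> [z /= [zs zu]|z -> //].
apply/eqP/negP => /negP zy.
by have := uy z zs zy; rewrite zu ltxx.
Qed.

Lemma face_vertex P x w q : polytope P -> face_at P w x ->
  exists z, [/\ vertex P z, face_at P w z & dot q z <= dot q x].
Proof.
move=> polP [Px wx]; have [s [_ PE sv]] := polytope_vertices polP.
have ub a : a \in s -> supp P w <= dot w a.
  by move=> /sv /vertex_in; exact: supp_le.
rewrite PE in Px; have [a [/= sa wa] ax] := conv_exists q (conv_face ub Px wx).
have va : vertex P a by apply/sv.
by exists a; split=> //; split=> //; exact: vertex_in.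
Qed.

Lemma supp_vertex P q : polytope P -> exists2 z, vertex P z & dot q z = supp P q.
Proof.
move=> polP; have [x qx] := face_at_nonempty q polP.
by have [z [vz [_ qz] _]] := face_vertex 0 polP qx; exists z.
Qed.

(* The cut of a hull is spanned by the points on the right side of the
   hyperplane and by the points where the segments between the two sides
   cross it; the weights below come from the transport of mass that balances
   the deficits [d] against the surpluses [e]. *)
Lemma conv_cut (A : set V) (u : V) (be : R) (x : V) :
  conv A x -> be <= dot u x ->
  conv [set z | (A z /\ be <= dot u z) \/
    exists a b, [/\ A a, A b, dot u a < be, be <= dot u b &
      z = ((dot u b - be) / (dot u b - dot u a)) *: a
          + ((be - dot u a) / (dot u b - dot u a)) *: b]] x.
Proof.
move=> [m [c [g [c0 c1 gA xE]]]] bx.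
pose N i := dot u (g i) < be.
pose d i := be - dot u (g i).
pose D := \sum_(i | N i) c i * d i.
pose E := \sum_(i | ~~ N i) c i * - d i.
have DE : D <= E.
  have : 0 <= \sum_i c i * - d i.
    rewrite (_ : \sum_i _ = dot u x - be) ?subr_ge0 //.
    rewrite xE dot_sumr -[be]mul1r -c1 mulr_suml -sumrB.
    by apply: eq_bigr => i _; rewrite dotZr opprB mulrBr.
  rewrite (bigID N) /= -/E (eq_bigr (fun i => - (c i * d i))) => [|i _];
    last by rewrite mulrN.
  rewrite sumrN -/D; lra.
have d_gt0 i : N i -> 0 < d i by rewrite subr_gt0.
have d_le0 i : ~~ N i -> 0 <= - d i by rewrite -leNgt opprB subr_ge0.
have D0 : 0 <= D by apply: sumr_ge0 => i /d_gt0/ltW di; rewrite mulr_ge0.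
have [E0|E0] := eqVneq E 0.
  have DZ : D = 0 by apply/eqP; rewrite eq_le D0 andbT -E0.
  have cN i : N i -> c i = 0.
    move=> Ni; have := DZ; rewrite /D => /eqP; rewrite psumr_eq0 => [|j /d_gt0/ltW dj];
      last by rewrite mulr_ge0.
    move=> /allP/(_ i (mem_index_enum _)); rewrite Ni /= mulf_eq0 (gt_eqF (d_gt0 i Ni)) orbF.
    by move/eqP.
  have [i0 Ni0] : exists i0, ~~ N i0.
    apply: contrapT => H; move: c1; rewrite big1 => [/eqP|i _].
      by rewrite eq_sym oner_eq0.
    by apply: cN; apply/negP => /negP Ni; apply: H; exists i.
  exists m, c, (fun i => if N i then g i0 else g i); split=> // [i|].
    by left; case: ifPn => Ni; split=> //; rewrite leNgt.
  rewrite xE; apply: eq_bigr => i _; case: ifP => // /cN ->.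
  by rewrite !scale0r.
have Egt0 : 0 < E by rewrite lt0r E0 (le_trans D0 DE).
pose I := ('I_m * 'I_m + 'I_m)%type.
pose p i j := ((- d j) / (d i - d j)) *: g i + (d i / (d i - d j)) *: g j.
have [j0 Nj0] : exists j, ~~ N j.
  apply: contrapT => H; move/eqP: E0; apply; rewrite /E big1 // => i Ni.
  by case: H; exists i.
(* Each point i below the hyperplane is distributed over the points j above it in proportion to
   their surplus [c j * - d j / E]. This uses the fraction [D / E] of the weight of each j, and the
   rest stays at j. *)
pose cc (t : I) := match t with
  | inl (i, j) => if N i && ~~ N j then c i * c j * (d i - d j) / E else 0
  | inr j => if N j then 0 else c j * (1 - D / E) end.
pose gg (t : I) := match t with
  | inl (i, j) => if N i && ~~ N j then p i j else g j0
  | inr j => if N j then g j0 else g j end.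
have sumI (W : lmodType R) (F : I -> W) :
    \sum_t F t = \sum_i \sum_j F (inl (i, j)) + \sum_j F (inr j).
  rewrite big_sumType /=; congr (_ + _); rewrite pair_bigA /=.
  by apply: eq_bigr => -[].
(* For an arbitrary module, so that one computation yields both the point x and the total weight
   1. *)
have ccE (W : lmodType R) (h : 'I_m -> W) (hp : 'I_m -> 'I_m -> W) (h0 : W) :
    (forall i j, N i -> ~~ N j -> (d i - d j) *: hp i j = (- d j) *: h i + d i *: h j) ->
    \sum_t cc t *: (match t with
      | inl (i, j) => if N i && ~~ N j then hp i j else h0
      | inr j => if N j then h0 else h j end) = \sum_i c i *: h i.
  move=> hpE; rewrite sumI.
  have -> : \sum_i \sum_j cc (inl (i, j)) *: (if N i && ~~ N j then hp i j else h0)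
     = \sum_(i | N i) \sum_(j | ~~ N j)
       ((c i * (c j * - d j / E)) *: h i + (c j * (c i * d i / E)) *: h j).
    rewrite [RHS]big_mkcond; apply: eq_bigr => i _; case: (boolP (N i)) => Ni; last first.
      by rewrite big1 // => j _; rewrite /cc (negPf Ni) scale0r.
    rewrite [RHS]big_mkcond; apply: eq_bigr => j _; rewrite /cc Ni /=;
      case: (boolP (N j)) => Nj /=.
      by rewrite scale0r.
    have -> : c i * c j * (d i - d j) / E = (c i * c j / E) * (d i - d j) by ring.
    rewrite -scalerA hpE // scalerDr !scalerA; congr (_ *: _ + _ *: _); ring.
  under eq_bigr do rewrite big_split.
  rewrite big_split /= -addrA [RHS](bigID N) /=; congr (_ + _).
    apply: eq_bigr => i Ni; rewrite -scaler_suml; congr (_ *: _).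
    rewrite -mulr_sumr -mulr_suml -/E; field; exact: E0.
  rewrite exchange_big /= [X in _ + X](bigID N) /=.
  rewrite [X in _ + (X + _)]big1 ?add0r => [|i Ni]; last first.
    by rewrite Ni scale0r.
  rewrite -big_split /=; apply: eq_bigr => j Nj.
  rewrite -scaler_suml (negPf Nj) -scalerDl; congr (_ *: _).
  rewrite -mulr_sumr -mulr_suml -/D; field; exact: E0.
have -> : x = \sum_t cc t *: gg t.
  rewrite xE; symmetry; apply: ccE => i j Ni Nj.
  rewrite /p scalerDr !scalerA; congr (_ *: _ + _ *: _); field.
    by rewrite gt_eqF // ltr_wpDr ?d_gt0 ?d_le0.
  by rewrite gt_eqF // ltr_wpDr ?d_gt0 ?d_le0.
apply: conv_fin => [[[i j]|j]||[[i j]|j]] /=.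
- case: ifP => // /andP[Ni Nj]; rewrite divr_ge0 ?(ltW Egt0) // mulr_ge0 ?mulr_ge0 //.
  by rewrite ltW // ltr_wpDr ?d_gt0 ?d_le0.
- by case: ifP => // _; rewrite mulr_ge0 // subr_ge0 ler_pdivrMr // mul1r.
- have := ccE R^o (fun=> 1) (fun _ _ => 1) 1.
  rewrite (eq_bigr cc) => [->|t _].
  + by rewrite -[RHS]c1; apply: eq_bigr => i _; rewrite /GRing.scale /= mulr1.
  + by move=> i j _ _; rewrite /GRing.scale /=; ring.
  + by case: t => [[i j]|j] /=; rewrite /GRing.scale /=; case: ifP; rewrite ?mulr1.
- case: ifP => [/andP[Ni Nj]|_]; last by left; split=> //; rewrite leNgt.
  right; exists (g i), (g j); split=> //; first by rewrite leNgt.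
  have dij : dot u (g j) - dot u (g i) = d i - d j by rewrite /d; ring.
  by rewrite /p dij /d opprB.
- by left; case: ifPn => Nj; split=> //; rewrite leNgt.
Qed.

Lemma polytope_cut P u (e : R) : polytope P -> cut P u e !=set0 -> polytope (cut P u e).
Proof.
move=> polP [x0 Cx0]; have [s [s0 PE]] := polP.
pose be : R := supp P u + e.
pose pt (ab : V * V) := ((dot u ab.2 - be) / (dot u ab.2 - dot u ab.1)) *: ab.1
          + ((be - dot u ab.1) / (dot u ab.2 - dot u ab.1)) *: ab.2.
pose t := [seq z <- s | be <= dot u z] ++
  [seq pt ab | ab <- [seq (a, b) | a <- s, b <- s] & (dot u ab.1 < be) && (be <= dot u ab.2)].
have Pt x : cut P u e x -> conv [set` t] x.
  move=> [Px ux]; rewrite PE in Px; have {}ux : be <= dot u x := ux;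
    have := conv_cut Px ux; apply: conv_seq_sub => z zP.
  apply: mem_conv; rewrite /= mem_cat; case: zP => [[zs uz]|[a [b [sa sb ua ub zE]]]].
    by rewrite mem_filter uz /= (idP zs).
  apply/orP; right; apply/mapP; exists (a, b) => //; rewrite mem_filter /= ua ub /=.
  by apply/allpairsP; exists (a, b).
exists t; split.
  by apply/eqP => tE; have [a] := conv_exists 0 (Pt _ Cx0); rewrite tE.
apply/seteqP; split=> // x cx.
have tge z : z \in t -> P z /\ be <= dot u z.
  rewrite mem_cat mem_filter => /orP[/andP[uz zs]|/mapP[[a b]]].
    by split=> //; rewrite PE; exact: mem_conv.
  rewrite mem_filter => /andP[/= /andP[ua ub] /allpairsP[[a' b'] /= [sa sb [aE bE]]]] ->.
  subst a' b'; have ab : 0 < dot u b - dot u a by rewrite subr_gt0 (lt_le_trans ua).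
  rewrite /pt /=; split.
    rewrite PE; apply: contrapT => /conv_sep[w ws].
    have := ws a sa; have := ws b sb; rewrite dotDr !dotZr.
    set A := dot w a; set B := dot w b; set l := _ / _; set l' := (be - _) / _ => wb wa.
    have l0 : 0 <= l by rewrite divr_ge0 ?(ltW ab) // subr_ge0.
    have l'0 : 0 <= l' by rewrite divr_ge0 ?(ltW ab) // subr_ge0 ltW.
    have ll : l + l' = 1 by rewrite /l /l'; field; rewrite gt_eqF.
    exact: convex_comb_lt l0 l'0 ll wa wb.
  rewrite dotDr !dotZr le_eqVlt; apply/orP; left; apply/eqP; field.
  by rewrite gt_eqF.
split; last by apply: (conv_ge cx) => z /tge[].
by rewrite PE; apply: conv_seq_sub cx => z /tge[]; rewrite PE.
Qed.

End PolytopeBasics.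

(** * Edges and neighbors *)

Section SmallPerturbations.
Variable R : realType.

(** Each condition is required on a whole interval [0 < t <= t0], so finitely many of them survive
    taking the minimum of the bounds. *)
Lemma seq_small (T : eqType) (Q : T -> R -> Prop) (s : seq T) :
  (forall y, y \in s -> exists2 t0, 0 < t0 & forall t, 0 < t <= t0 -> Q y t) ->
  exists2 t0, 0 < t0 & forall t, 0 < t <= t0 -> forall y, y \in s -> Q y t.
Proof.
elim: s => [|a s IH] H; first by exists 1.
have [t1 t1_gt0 Qa] := H a (mem_head _ _).
have [|t2 t2_gt0 Qs] := IH; first by move=> y ys; apply: H; rewrite inE ys orbT.
exists (Num.min t1 t2); first by rewrite lt_min t1_gt0.
move=> t /andP[t_gt0]; rewrite le_min => /andP[tt1 tt2] y.
rewrite inE => /predU1P[->|ys]; first by apply: Qa; rewrite t_gt0.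
by apply: Qs; rewrite ?t_gt0.
Qed.

Lemma linear_small (al be : R) : 0 < al ->
  exists2 t0, 0 < t0 & forall t, 0 < t <= t0 -> 0 < al + t * be.
Proof.
move=> al0; have b0 : 0 < `|be| + 1 by rewrite ltr_pwDr.
exists (al / (`|be| + 1)); first exact: divr_gt0.
move=> t /andP[t0]; rewrite ler_pdivlMr // => tb.
have : - (t * be) <= t * `|be| by rewrite -mulrN ler_pM2l // -normrN ler_norm.
lra.
Qed.

End SmallPerturbations.

Section Edges.
Variables (R : realType) (n : nat).
Local Notation V := 'rV[R]_n.
Implicit Types (P Q F E : set V) (u v x y z p q : V).

Lemma vertex_exposed P z : vertex P z -> polytope P ->
  exists a, forall y, P y -> y != z -> dot a z < dot a y.
Proof.
move=> [a za] polP; exists a => y Py yz.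
have [_ az] : face_at P a z by rewrite -za.
rewrite lt_def az supp_le // andbT; apply/negP => /eqP ya.
have : face_at P a y by [].
by rewrite -za => /= yE; rewrite yE eqxx in yz.
Qed.

Section ImprovingEdge.
Variables (s : seq V) (z a : V).
Hypothesis az : forall y, y \in s -> y != z -> dot a z < dot a y.

Let M c := [seq y <- s | (dot c y == dot c z) && (y != z)].
Let good c := (forall y, y \in s -> dot c z <= dot c y) /\ M c != [::].

(** [M c] lists the points other than z that tie with z for [c]. Tilting [c] slightly by
    [p - r *: a], with r the least ratio of p to a on the ties, keeps only the ties attaining that
    ratio; on these p is r times a. *)
Let refine c p : good c -> exists c' r, [/\ good c', {subset M c' <= M c},
    forall y, y \in M c' -> dot p (y - z) = r * dot a (y - z)
  & forall y, y \in M c -> r * dot a (y - z) <= dot p (y - z)].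
Proof.
move=> [cz M0].
have a_gt0 y : y \in M c -> 0 < dot a (y - z).
  by rewrite mem_filter dotBr subr_gt0 => /andP[/andP[_ yz] /az]; apply.
have [y0 My0 ymin] := seq_argmin (fun y => dot p (y - z) / dot a (y - z)) M0.
set r := _ / _ in ymin.
have pr y : y \in M c -> r * dot a (y - z) <= dot p (y - z).
  by move=> My; rewrite -ler_pdivlMr ?a_gt0 // ymin.
pose d := p - r *: a.
have [t0 t0_gt0 tP] : exists2 t0, 0 < t0 & forall t, 0 < t <= t0 -> forall y, y \in s ->
    0 < dot c (y - z) -> 0 < dot c (y - z) + t * dot d (y - z).
  apply: seq_small => y ys.
  have [cp|] := boolP (0 < dot c (y - z)); last by exists 1.
  by have [t0 ? ?] := linear_small (dot d (y - z)) cp; exists t0; auto.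
pose c' := c + t0 *: d.
have c'E y : dot c' y - dot c' z = dot c (y - z) + t0 * dot d (y - z).
  by rewrite -dotBr dotDl dotZl.
have dE y : dot d (y - z) = dot p (y - z) - r * dot a (y - z).
  by rewrite dotBl dotZl.
have t0P y : y \in s -> 0 < dot c (y - z) -> 0 < dot c' y - dot c' z.
  by move=> ys cp; rewrite c'E tP // t0_gt0 lexx.
have McE y : y \in s -> y != z -> y \notin M c -> 0 < dot c (y - z).
  move=> ys yz; rewrite mem_filter yz ys !andbT => cy.
  by rewrite dotBr subr_gt0 lt_def cy cz.
have c'M y : y \in M c -> dot c' y - dot c' z = t0 * (dot p (y - z) - r * dot a (y - z)).
  rewrite mem_filter => /andP[/andP[/eqP cy _] _].
  by rewrite c'E dE dotBr cy subrr add0r.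
exists c', r; split=> //; [split| |].
- move=> y ys; rewrite -subr_ge0; have [->|yz] := eqVneq y z; first by rewrite subrr.
  have [My|My] := boolP (y \in M c); last by rewrite ltW // t0P // McE.
  by rewrite c'M // mulr_ge0 ?(ltW t0_gt0) // subr_ge0 pr.
- suff : y0 \in M c' by case: (M c').
  move: (My0); rewrite !mem_filter => /andP[/andP[_ ->] ->]; rewrite !andbT -subr_eq0.
  by rewrite c'M // /r divfK ?subrr ?mulr0 // gt_eqF // a_gt0.
- move=> y; rewrite mem_filter => /andP[/andP[/eqP cy yz] ys].
  apply: contraT => /(McE y ys yz)/(t0P y ys).
  by rewrite cy subrr ltxx.
- move=> y My; have McY : y \in M c.
    move: My; rewrite mem_filter => /andP[/andP[/eqP cy yz] ys].
    by apply: contraT => /(McE y ys yz)/(t0P y ys); rewrite cy subrr ltxx.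
  move: My; rewrite mem_filter => /andP[/andP[/eqP cy _] _].
  have := c'M y McY; rewrite cy subrr => /esym/eqP.
  by rewrite mulf_eq0 gt_eqF //= subr_eq0 => /eqP.
Qed.

(** Refining 0 along q yields ties that all improve q, since the least ratio is negative. Refining
    further until the tie set is minimal makes it collinear with z. This finds an edge without
    induction on the dimension. *)
Lemma exposed_segment q : (exists2 x, x \in s & dot q x < dot q z) ->
  exists c y0, [/\ forall y, y \in s -> dot c z <= dot c y,
    y0 \in s, y0 != z /\ dot c y0 = dot c z, dot q y0 < dot q z
  & forall y, y \in s -> dot c y = dot c z -> exists k, y - z = k *: (y0 - z)].
Proof.
move=> [x xs qx].
have xz : x != z by apply/eqP => xz; rewrite xz ltxx in qx.
have g0 : good 0.
  split=> [y _|]; first by rewrite !dot0l.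
  suff : x \in M 0 by case: (M 0).
  by rewrite mem_filter !dot0l eqxx xz.
have [c1 [r [g1 _ c1q c0q]]] := refine q g0.
have rneg : r < 0.
  have := c0q x; rewrite mem_filter !dot0l eqxx xz => /(_ xs).
  move=> H; rewrite ltNge; apply/negP => r0.
  have : 0 <= r * dot a (x - z) by rewrite mulr_ge0 // dotBr subr_ge0 ltW // az.
  by move=> /le_trans/(_ H); rewrite dotBr subr_ge0 leNgt qx.
have better y : y \in M c1 -> dot q y < dot q z.
  move=> My; rewrite -subr_lt0 -dotBr c1q // nmulr_rlt0 //.
  by move: My; rewrite mem_filter dotBr subr_gt0 => /andP[/andP[_ yz] /az]; apply.
have [c [gc Mc cmin]] : exists c, [/\ good c, {subset M c <= M c1} &
    forall c', good c' -> {subset M c' <= M c} -> {subset M c <= M c'}].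
  suff H k : forall c2, good c2 -> {subset M c2 <= M c1} ->
      (size (undup (M c2)) < k)%N ->
      exists c, [/\ good c, {subset M c <= M c1} &
        forall c', good c' -> {subset M c' <= M c} -> {subset M c <= M c'}].
    exact: (H _ c1 g1 (fun y => id) (ltnSn _)).
  elim: k => // k IH c2 g2 s2; rewrite ltnS => k2.
  have [[c3 [g3 s3 n3]]|nex] := pselect (exists c3, [/\ good c3,
      {subset M c3 <= M c2} & ~ {subset M c2 <= M c3}]).
    apply: (IH c3 g3) => [y /s3/s2 //|].
    apply: leq_trans k2; rewrite ltnNge; apply/negP => le; apply: n3 => y.
    rewrite -mem_undup -[y \in M c3]mem_undup.
    have sub3 : {subset undup (M c3) <= undup (M c2)} by move=> t; rewrite !mem_undup;
      exact: s3.
    by have [_ ->] := uniq_min_size (undup_uniq _) sub3 le.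
  exists c2; split=> // c' gc' s'; apply: contrapT => ns; apply: nex.
  by exists c'.
have [y0 My0] : exists y0, y0 \in M c.
  by case: gc => _; case: (M c) => // y0 l _; exists y0; exact: mem_head.
have := My0; rewrite mem_filter => /andP[/andP[/eqP cy0 y0z] y0s].
have a0 : dot a (y0 - z) != 0 by rewrite dotBr gt_eqF // subr_gt0 az.
exists c, y0; split=> //; [by case: gc|by apply/better/Mc|].
move=> y ys cy; have [->|yz] := eqVneq y z.
  by exists 0; rewrite subrr scale0r.
exists (dot a (y - z) / dot a (y0 - z)); apply: dot_injr => p.
(* By minimality a further refinement loses no tie, so every functional p is proportional to [a] on
   [M c]. *)
have [c' [r' [gc' s' pE _]]] := refine p gc.
have My : y \in M c by rewrite mem_filter cy eqxx yz.
have cc' := cmin c' gc' s'.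
by rewrite dotZr !pE ?cc' //; field.
Qed.

End ImprovingEdge.

(** The step of the simplex method. *)
Lemma improving_edge P q z : polytope P -> vertex P z ->
  (exists2 x, P x & dot q x < dot q z) ->
  exists E y, [/\ edge P E, E z, E y, vertex P y & dot q y < dot q z].
Proof.
move=> polP vz [x Px qx].
have [s [s0 PE sv]] := polytope_vertices polP.
have [a az] := vertex_exposed vz polP.
have sP y : y \in s -> P y by move=> /sv /vertex_in.
have azs y : y \in s -> y != z -> dot a z < dot a y by move=> /sP; exact: az.
have [|c [y0 [cz y0s [y0z cy0] qy0 col]]] := exposed_segment azs (q := q).
  rewrite PE in Px; have [b /= bs bx] := conv_exists q Px.
  by exists b => //; exact: le_lt_trans qx.
have Pz := vertex_in vz.
have cmin y : P y -> dot c z <= dot c y by rewrite PE => /conv_ge; apply.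
have sE := supp_eq Pz cmin.
exists (face_at P c), y0; split=> //; [|by split; rewrite ?cy0 //; exact: sP|exact/sv].
split; first by exists c.
exists z, <[y0 - z]>%VS; split=> //.
- by rewrite dim_vline subr_eq0 y0z.
- move=> y [Py cy]; apply/vlineP.
  rewrite PE in Py; rewrite sE in cy.
  have [m [k [g [k0 k1 gP yE]]]] := conv_face cz Py cy.
  have kk i : exists k, g i - z = k *: (y0 - z) by have [gs gc] := gP i; exact: col.
  pose f i := xget 0 [set k | g i - z = k *: (y0 - z)].
  have fP i : g i - z = f i *: (y0 - z).
    by have [l lP] := kk i; rewrite /f; case: xgetP => [_ _ //|/(_ l)].
  exists (\sum_i k i * f i); rewrite yE -[z in LHS]scale1r -k1 !scaler_suml -sumrB.
  by apply: eq_bigr => i _; rewrite -scalerBr fP scalerA.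
- move=> W WP; rewrite -memvE; apply: WP; split; first exact: sP.
  by rewrite cy0.
Qed.

Lemma neighbor_ge P u y : polytope P -> neighbor P (face_at P u) y ->
  delta P (face_at P u) u <= dot u y - supp P u.
Proof.
move=> polP yn; apply: ge_inf; last by exists y.
by exists 0 => _ [w [/vertex_in Pw _ _] <-]; rewrite subr_ge0 supp_le.
Qed.

Lemma face_atN_gt P u y : polytope P -> P y -> ~ face_at P u y -> supp P u < dot u y.
Proof.
move=> polP Py ny; rewrite lt_def supp_le // andbT.
by apply/eqP => yu; apply: ny.
Qed.

(* Descending along improving edges leads from any vertex into the face, and
   the last vertex before the face is a neighbor. *)
Lemma descend P u z : polytope P -> vertex P z -> ~ face_at P u z ->
  exists2 y, neighbor P (face_at P u) y & dot u y <= dot u z.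
Proof.
move=> polP; have [s [s0 PE sv]] := polytope_vertices polP.
have [k] := ubnP (count (fun y => dot u y < dot u z) s).
elim: k z => // k IH z; rewrite ltnS => kz vz nz.
have Pz := vertex_in vz.
have uz := face_atN_gt polP Pz nz.
have [x Px [ux _]] := supp_attained u polP.
have [|E [y [eE Ez Ey vy uy]]] := @improving_edge P u z polP vz.
  by exists x => //; rewrite ux.
have [fy|fy] := pselect (face_at P u y).
  by exists z => //; split=> //; exists y, E.
suff ky : (count (fun w => (dot u w < dot u y)%R) s < k)%N.
  have [y' ny' uy'] := IH y ky vy fy.
  by exists y' => //; apply: le_trans (ltW uy).
apply: leq_trans kz.
have sub : subpred (fun w => dot u w < dot u y) (fun w => dot u w < dot u z).
  by move=> w /= /lt_trans; apply.
have -> : count (fun w => dot u w < dot u y) s =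
    count (fun w => dot u w < dot u y) [seq w <- s | dot u w < dot u z].
  by rewrite count_filter; apply: eq_count => w /=; apply/idP/idP => [wy|/andP[]//];
    rewrite wy sub.
rewrite -[X in (_ < X)%N]size_filter ltn_neqAle count_size andbT -all_count.
apply/negP => /allP /(_ y); rewrite mem_filter uy ltxx => /(_ _)/negP; apply => //.
exact/sv.
Qed.

(** [delta] looks at neighbors only; descent extends its bound to all vertices off the face. *)
Lemma delta_le_vertex P u z : polytope P -> vertex P z -> ~ face_at P u z ->
  delta P (face_at P u) u <= dot u z - supp P u.
Proof.
move=> polP vz nz; have [y /neighbor_ge-/(_ polP) yd yz] := descend polP vz nz.
by apply: le_trans yd _; rewrite lerD2r.
Qed.

Lemma neighbor_exists P u : polytope P -> (exists2 x, P x & ~ face_at P u x) ->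
  exists y, neighbor P (face_at P u) y.
Proof.
move=> polP [x Px nx].
(* The face of the functional 0 is P itself, so this is a vertex of P at least as high as x for [u],
   hence off the face. *)
have [z [vz _ zx]] : exists z, [/\ vertex P z, face_at P 0 z & dot (- u) z <= dot (- u) x].
  by apply: face_vertex => //; split=> //; rewrite (supp_eq Px) // => y _; rewrite !dot0l.
have [|y yn _] := descend polP vz (u := u); last by exists y.
move=> [Pz uz]; have := face_atN_gt polP Px nx.
by rewrite -uz ltNge -lerN2 -!dotNl zx.
Qed.

(** A neighbor is asked for because the infimum of the empty set is 0 by convention. *)
Lemma delta_ge P u (be : R) : (exists y, neighbor P (face_at P u) y) ->
  (forall y, vertex P y -> ~ face_at P u y -> be <= dot u y - supp P u) ->
  be <= delta P (face_at P u) u.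
Proof.
move=> [y yn] H; apply: lb_le_inf; first by exists (dot u y - supp P u), y.
by move=> _ [w [vw nw _] <-]; exact: H.
Qed.

Lemma delta_gt0 P u : polytope P -> (exists2 x, P x & ~ face_at P u x) ->
  0 < delta P (face_at P u) u.
Proof.
move=> polP nx; have yn := neighbor_exists polP nx.
have [s [s0 PE sv]] := polytope_vertices polP.
pose t := [seq y <- s | supp P u < dot u y].
have tP y : vertex P y -> ~ face_at P u y -> y \in t.
  move=> vy ny; rewrite mem_filter; apply/andP; split; last exact/sv.
  by apply: face_atN_gt => //; exact: vertex_in.
have t0 : t != [::].
  have [y [vy ny _]] := yn; apply/eqP => tE; have := tP y vy ny.
  by rewrite tE.
have [y + ymin] := seq_argmin (fun y => dot u y - supp P u) t0.
rewrite mem_filter -subr_gt0 => /andP[/lt_le_trans yt _]; apply: yt.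
by apply: delta_ge => // w vw nw; apply/ymin/tP.
Qed.

(** Linearity of the support function on the cones of P suffices. A functional u is in the relative
    interior of the normal cone [K'] of the face it exposes on P, and this places [K'] inside every
    normal cone of Q that contains u. *)
Lemma deformation_PL P Q : polytope P -> polytope Q ->
  PL (normal_fan P) (supp Q) -> deformation P Q.
Proof.
move=> polP polQ PLQ; split=> // _ [_ [u0 ->] <-].
pose K := normal_cone Q (face_at Q u0).
exists [set K' | normal_fan P K' /\ K' `<=` K]; first by move=> ? [].
apply/seteqP; split=> [u Ku|u [K' [_ +]]]; last exact.
pose K' := normal_cone P (face_at P u).
have K'u : K' u by move=> x [].
have fK' : normal_fan P K' by exists (face_at P u) => //; exists u.
exists K' => //; split=> // w K'w x fx.
have [zz zzE] := PLQ K' fK'.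
have [s [s0 PE sv]] := polytope_vertices polP.
have [y0 fy0] := face_at_nonempty u polP.
have [t0 t0_gt0 tP] : exists2 t0, 0 < t0 & forall t, 0 < t <= t0 -> forall y, y \in s ->
    supp P u - t * supp P w <= dot u y - t * dot w y.
  apply: seq_small => y /sv /vertex_in Py.
  have [fy|fy] := pselect (face_at P u y).
    by exists 1 => // t _; rewrite (K'w y fy); case: fy => _ ->.
  have := face_atN_gt polP Py fy; rewrite -subr_gt0 => /(linear_small (supp P w - dot w y)).
  move=> [t0 t0_gt0 tP]; exists t0 => // t /tP; lra.
(* A small step backwards from u stays in [K']. Linearity there, compared with [supp_le] for v at x,
   gives the missing inequality for w. *)
pose v := u - t0 *: w.
have K'v : K' v.
  move=> y fy; have [Py uy] := fy; rewrite (supp_eq Py) // => y' Py'.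
  rewrite PE in Py'; apply: (conv_ge Py') => a sa.
  rewrite !dotBl !dotZl uy (K'w y fy); apply: tP => //.
  by rewrite t0_gt0 lexx.
have Qx : Q x by case: fx.
have := supp_le v polQ Qx; rewrite zzE // !dotBl !dotZl (Ku x fx) zzE //.
rewrite lerD2l lerN2 ler_pM2l // => le.
by apply/eqP; rewrite eq_le (supp_le w polQ Qx) andbT (zzE w K'w) le.
Qed.

End Edges.

(** * Coordinates on the normal fan of a simple polytope *)

Section SimpleSystem.
Variables (R : realType) (n : nat) (S : set 'rV[R]_n).
Variables (N : nat) (u : 'I_N -> 'rV[R]_n) (b : 'I_N -> R).
Local Notation V := 'rV[R]_n.
Implicit Types (v x y z q : V) (J : {set 'I_N}) (e : R).

Definition tight x i : bool := dot (u i) x == b i.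

(** For a tight i, [w i] is the direction of the edge at v that leaves the facet i and stays in the
    other facets through v. *)
Definition dual_basis v (w : 'I_N -> V) : Prop :=
  (forall i j, tight v i -> tight v j -> dot (u i) (w j) = (i == j)%:R) /\
  (forall x, x = \sum_(i | tight v i) dot (u i) x *: w i).

Definition cone_normal J : V := \sum_(i in J) u i.

Definition level J : R := \sum_(i in J) b i.

Definition face_of J : set V := [set x | S x /\ forall i, i \in J -> tight x i].

(* The normals indexed by J span a cone of the normal fan of S. *)
Definition cplx J : Prop := face_of J !=set0.

Hypothesis polS : polytope S.
Hypothesis SE : forall x, S x <-> forall i, b i <= dot (u i) x.
Hypothesis dualS : forall v, vertex S v -> exists w, dual_basis v w.

Lemma cone_normal_ge J x : S x -> level J <= dot (cone_normal J) x.
Proof. by move=> /SE Sx; rewrite dot_suml; apply: ler_sum => i _. Qed.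

Lemma cone_normal_eq J x : S x ->
  dot (cone_normal J) x = level J <-> forall i, i \in J -> tight x i.
Proof.
move=> /SE Sx; rewrite dot_suml; split=> [e i iJ|H]; last first.
  by apply: eq_bigr => i /H/eqP.
have : \sum_(i in J) (dot (u i) x - b i) == 0 by rewrite sumrB e subrr.
rewrite psumr_eq0 => [/allP/(_ i (mem_index_enum _))|j _]; last by rewrite subr_ge0.
by rewrite iJ subr_eq0.
Qed.

Lemma supp_cone_normal J : cplx J -> supp S (cone_normal J) = level J.
Proof.
move=> [x [Sx /(cone_normal_eq J Sx) e]]; rewrite (supp_eq Sx) // => y Sy.
by rewrite e cone_normal_ge.
Qed.

Lemma face_cone_normal J : cplx J -> face_at S (cone_normal J) = face_of J.
Proof.
move=> cJ; rewrite /face_at supp_cone_normal //.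
by apply/seteqP; split=> x [Sx] /(cone_normal_eq J Sx).
Qed.

Lemma cplx_vertex J : cplx J -> exists2 v, vertex S v & forall i, i \in J -> tight v i.
Proof.
move=> cJ; have [x] := cJ; rewrite -face_cone_normal // => fx.
have [v [vv + _]] := face_vertex 0 polS fx.
by rewrite face_cone_normal // => -[_ ?]; exists v.
Qed.

Lemma cplxS J J' : J \subset J' -> cplx J' -> cplx J.
Proof. by move=> /fintype.subsetP JJ' [x [Sx xJ]]; exists x; split=> // i /JJ'/xJ. Qed.

Lemma coord_exists q : exists c : 'I_N -> R, [/\ forall i, 0 <= c i,
  q = \sum_i c i *: u i &
  forall x, S x -> dot q x = supp S q -> forall i, c i != 0 -> tight x i].
Proof.
have [y Sy [qy ymin]] := supp_attained q polS.
have [|x /SE|c [c0 qE cP]] := @dual_optimum _ _ _ u b q y; [exact/SE|exact: ymin|].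
exists c; split=> // x /SE Sx qx i ci; apply/eqP/cP => //; by rewrite qx.
Qed.

(* The coordinates of q on the rays of the smallest cone of the normal fan of S
   that contains it; unique because S is simple. *)
Definition fan_coord q : 'I_N -> R := projT1 (cid (coord_exists q)).

Lemma coordP q : [/\ forall i, 0 <= fan_coord q i, q = \sum_i fan_coord q i *: u i &
  forall x, S x -> dot q x = supp S q -> forall i, fan_coord q i != 0 -> tight x i].
Proof. exact: projT2 (cid (coord_exists q)). Qed.

Lemma coord_ge0 q i : 0 <= fan_coord q i.
Proof. by have [] := coordP q. Qed.

Lemma dual_basis_coef v w (la : 'I_N -> R) j : dual_basis v w -> tight v j ->
  (forall i, la i != 0 -> tight v i) -> dot (\sum_i la i *: u i) (w j) = la j.
Proof.
move=> [dw _] vj lav; rewrite dot_suml (bigD1 j) //= dotZl dw // eqxx mulr1.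
rewrite big1 ?addr0 // => i ij; rewrite dotZl.
have [->|/lav vi] := eqVneq (la i) 0; first by rewrite mul0r.
by rewrite dw // (negPf ij) mulr0.
Qed.

Lemma coord_vertex v w q i : vertex S v -> dual_basis v w -> dot q v = supp S q ->
  fan_coord q i = if tight v i then dot q (w i) else 0.
Proof.
move=> vv dw qv; have [_ qE qP] := coordP q.
have cv := qP v (vertex_in vv) qv; case: ifPn => [vi|vi].
  by rewrite {2}qE (dual_basis_coef dw vi cv).
by apply/eqP; apply: contraNT vi => /cv.
Qed.

(** Uniqueness of the coordinates: pairing with the dual basis at v reads off the coefficients of
    any nonnegative combination of normals tight at v. *)
Lemma coord_cone v (la : 'I_N -> R) q : vertex S v -> (forall i, 0 <= la i) ->
  (forall i, la i != 0 -> tight v i) -> q = \sum_i la i *: u i ->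
  dot q v = supp S q /\ forall i, fan_coord q i = la i.
Proof.
move=> vv la0 lav qE; have Sv := vertex_in vv.
have qv : dot q v = supp S q.
  symmetry; apply: supp_eq => // x /SE Sx; rewrite qE !dot_suml.
  apply: ler_sum => i _; rewrite !dotZl.
  have [->|/lav/eqP ->] := eqVneq (la i) 0; first by rewrite !mul0r.
  exact: ler_wpM2l.
split=> // i; have [w dw] := dualS vv.
rewrite (coord_vertex i vv dw qv); case: ifPn => [vi|vi].
  by rewrite qE (dual_basis_coef dw vi lav).
by apply/esym/eqP; apply: contraNT vi => /lav.
Qed.

(* The minimum of the coordinates of q on J.  It is the direction in which the
   support function of S moves under truncation along the face of J. *)
Definition phi J q : R := xget 0 [set t | exists i, [/\ i \in J, t = fan_coord q i
  & forall j, j \in J -> fan_coord q i <= fan_coord q j]].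

Lemma phi_eq J q i : i \in J -> (forall j, j \in J -> fan_coord q i <= fan_coord q j) ->
  phi J q = fan_coord q i.
Proof.
move=> iJ imin; rewrite /phi; case: xgetP => [_ _ [j [jJ -> jmin]]|/(_ (fan_coord q i))].
  by apply: le_anti; rewrite imin // jmin.
by case; exists i.
Qed.

Lemma phiP J q : (exists i, i \in J) -> exists i, [/\ i \in J, phi J q = fan_coord q i
  & forall j, j \in J -> fan_coord q i <= fan_coord q j].
Proof.
move=> [i0 i0J]; have J0 : enum J != [::].
  by apply/eqP => JE; have := mem_enum J i0; rewrite JE i0J.
have [i] := seq_argmin (fan_coord q) J0; rewrite mem_enum => iJ imin.
have {}imin j : j \in J -> fan_coord q i <= fan_coord q j by rewrite -mem_enum => /imin.
by exists i; split=> //; exact: phi_eq.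
Qed.

(** Off the face of J some coordinate of q in J belongs to a facet missing v and is 0; on the face,
    [dot q (w i)] is the cost of the cheapest edge leaving it. *)
Lemma phi_vertex J q : (exists i, i \in J) -> exists v w,
  [/\ vertex S v, dual_basis v w, dot q v = supp S q &
   (~ face_of J v /\ phi J q = 0) \/
   exists2 i, i \in J & face_of J v /\ phi J q = dot q (w i)].
Proof.
move=> J0; have [v vv qv] := supp_vertex q polS; have [w dw] := dualS vv.
exists v, w; split=> //; have [i [iJ pE imin]] := phiP q J0.
have [fv|nfv] := pselect (face_of J v); [right|left].
  exists i => //; split=> //; rewrite pE (coord_vertex i vv dw qv).
  by case: fv => _ ->.
split=> //; have [j jJ vj] : exists2 j, j \in J & ~~ tight v j.
  apply: contrapT => H; apply: nfv; split; first exact: vertex_in.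
  by move=> j jJ; apply: contrapT => /negP vj; apply: H; exists j.
apply: le_anti; rewrite {2}pE coord_ge0 andbT pE.
have <- : fan_coord q j = 0 by rewrite (coord_vertex j vv dw qv) (negPf vj).
exact: imin.
Qed.

Lemma edge_from v w i : vertex S v -> dual_basis v w -> tight v i ->
  exists t E, [/\ 0 < t, vertex S (v + t *: w i),
     [/\ edge S E, E v & E (v + t *: w i)]
     & forall e, 0 <= e <= t -> E (v + e *: w i)].
Proof.
move=> vv dw vi; have Sv := vertex_in vv; have [dw1 dw2] := dw.
pose A := [set j | tight v j && (j != i)]%SET.
have fv : face_of A v by split=> // j; rewrite inE => /andP[].
have cA : cplx A by exists v.
have line x : face_of A x -> x - v = dot (u i) (x - v) *: w i.
  move=> [Sx xA]; rewrite {1}[x - v]dw2 (bigD1 i) //= big1 ?addr0 // => j jA.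
  rewrite dotBr; have := xA j; rewrite inE jA => /(_ isT)/eqP ->.
  by case/andP: jA => /eqP -> _; rewrite subrr scale0r.
have wi1 : dot (u i) (w i) = 1 by rewrite dw1 // eqxx.
have wA j : tight v j -> j != i -> dot (u j) (w i) = 0.
  by move=> vj ji; rewrite dw1 // (negPf ji).
have [t0 t0_gt0 t0P] : exists2 t0, 0 < t0 & forall t, 0 < t <= t0 ->
    forall j, j \in enum 'I_N -> b j <= dot (u j) v + t * dot (u j) (w i).
  apply: seq_small => j _; have := Sv; move/SE => /(_ j).
  rewrite le_eqVlt => /orP[/eqP vj|].
    exists 1 => // t /andP[t_gt0 _]; rewrite -vj lerDl dw1 ?/tight ?vj //.
    by rewrite mulr_ge0 // ltW.
  rewrite -subr_gt0 => /(linear_small (dot (u j) (w i)))[t0 t0_gt0 tP].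
  by exists t0 => // t /tP; lra.
have f0 : face_of A (v + t0 *: w i).
  split=> [|j].
    by apply/SE => j; rewrite dotDr dotZr t0P ?t0_gt0 ?lexx ?mem_enum.
  rewrite inE => /andP[vj ji]; rewrite /tight dotDr dotZr wA // mulr0 addr0.
  exact: vj.
rewrite -face_cone_normal // in f0.
(* The other end of the edge: a vertex of the face at least as far in direction [u i] as the point
   at [t0], hence different from v. *)
have [y [vy fy qy]] := face_vertex (- u i) polS f0.
rewrite face_cone_normal // in fy.
pose t := dot (u i) (y - v).
have yE : y = v + t *: w i by rewrite /t -(line y fy) addrC subrK.
have t_gt0 : 0 < t.
  apply: lt_le_trans t0_gt0 _; move: qy; rewrite !dotNl lerN2 dotDr dotZr wi1 mulr1.
  by rewrite /t dotBr; lra.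
exists t, (face_of A); rewrite -yE; split=> //.
  split=> //; split; first by exists (cone_normal A); rewrite face_cone_normal.
  exists v, <[w i]>%VS; split=> //.
  - rewrite dim_vline; case: eqP wi1 => // ->; rewrite dot0r => /eqP.
    by rewrite eq_sym oner_eq0.
  - by move=> x fx; apply/vlineP; exists (dot (u i) (x - v)); exact: line.
  - move=> W WP; rewrite -memvE; have := WP y fy; rewrite line // -/t => /(memvZ t^-1).
    by rewrite scalerA mulVf ?scale1r // gt_eqF.
move=> e /andP[e0 et]; split=> [|j]; last first.
  rewrite inE => /andP[vj ji]; rewrite /tight dotDr dotZr wA // mulr0 addr0.
  exact: vj.
apply/SE => j; rewrite dotDr dotZr.
have /SE/(_ j) bv := Sv; have /SE/(_ j) := vertex_in vy; rewrite yE dotDr dotZr => bt.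
have [w0|w0] := leP 0 (dot (u j) (w i)).
  by rewrite -[b j]addr0 lerD // mulr_ge0.
by apply: le_trans bt _; rewrite lerD2l ler_nM2r.
Qed.

Lemma cone_normal_dual J v w i : dual_basis v w -> (forall j, j \in J -> tight v j) ->
  i \in J -> dot (cone_normal J) (w i) = 1.
Proof.
move=> [dw _] vJ iJ; rewrite dot_suml (bigD1 i) //= dw ?vJ // eqxx big1 ?addr0 //.
by move=> j /andP[jJ ji]; rewrite dw ?vJ // (negPf ji).
Qed.

Lemma edge_neighbor J v w i t E : face_of J v -> vertex S v -> dual_basis v w ->
  i \in J ->
  0 < t -> vertex S (v + t *: w i) -> edge S E -> E v -> E (v + t *: w i) ->
  neighbor S (face_of J) (v + t *: w i) /\
  dot (cone_normal J) (v + t *: w i) - supp S (cone_normal J) = t.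
Proof.
move=> fv vv dw iJ t0 vy eE Ev Ey; have [Sv vJ] := fv.
have cJ : cplx J by exists v.
have yE : dot (cone_normal J) (v + t *: w i) - supp S (cone_normal J) = t.
  rewrite supp_cone_normal // dotDr dotZr (cone_normal_dual dw vJ iJ) mulr1.
  by have /(cone_normal_eq J Sv) -> := vJ; rewrite addrC addKr.
split=> //; split=> //; last by exists v, E.
rewrite -face_cone_normal // => -[_ e]; move: yE t0; rewrite e subrr => <-.
by rewrite ltxx.
Qed.

Lemma neighbor_of_face J : cplx J -> (exists i, i \in J) ->
  exists y, neighbor S (face_of J) y.
Proof.
move=> cJ [i iJ]; have [v vv vJ] := cplx_vertex cJ; have [w dw] := dualS vv.
have [t [E [t0 vy [eE Ev Ey] _]]] := edge_from vv dw (vJ i iJ).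
have fv : face_of J v by split=> //; exact: vertex_in.
by have [ny _] := edge_neighbor fv vv dw iJ t0 vy eE Ev Ey; exists (v + t *: w i).
Qed.

Lemma face_of_proper J i : i \in J -> cplx J -> exists2 x, S x & ~ face_of J x.
Proof.
move=> iJ cJ; have [|y [vy ny _]] := @neighbor_of_face J cJ; first by exists i.
by exists y => //; exact: vertex_in.
Qed.

Lemma delta_face_gt0 J : cplx J -> (exists i, i \in J) ->
  0 < delta S (face_of J) (cone_normal J).
Proof.
move=> cJ [i iJ]; have [x Sx nx] := face_of_proper iJ cJ.
by rewrite -face_cone_normal //; apply: delta_gt0 => //; exists x;
  rewrite ?face_cone_normal.
Qed.

(** Weak duality: subtracting m = [phi J q] from the coordinates in J writes q as a nonnegative
    combination of facet normals plus m times the normal of J, whose bound the cut raises by e. *)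
Lemma cut_face_ge J e q x : cplx J -> (exists i, i \in J) -> 0 <= e ->
  cut S (cone_normal J) e x -> supp S q + e * phi J q <= dot q x.
Proof.
move=> cJ J0 e0 [Sx]; rewrite supp_cone_normal // => Jx.
have [i [iJ pE imin]] := phiP q J0; rewrite pE; set m := fan_coord q i in imin *.
have [c0 qE cP] := coordP q.
pose c j := fan_coord q j - (j \in J)%:R * m.
have cc0 j : 0 <= c j.
  rewrite subr_ge0; have [jJ|_] := boolP (j \in J); last by rewrite mul0r.
  by rewrite mul1r imin.
have sJ (f : 'I_N -> R) : \sum_j fan_coord q j * f j =
  \sum_j c j * f j + m * \sum_(j in J) f j.
  rewrite mulr_sumr [X in _ + X]big_mkcond -big_split; apply: eq_bigr => j _ /=.
  by rewrite /c; case: (j \in J) => /=; ring.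
have dE y : dot q y = \sum_j fan_coord q j * dot (u j) y.
  by rewrite {1}qE dot_suml; apply: eq_bigr => j _; rewrite dotZl.
have sE : supp S q = \sum_j fan_coord q j * b j.
  have [y [Sy qy]] := face_at_nonempty q polS.
  rewrite -qy dE; apply: eq_bigr => j _.
  have [->|cj] := eqVneq (fan_coord q j) 0; first by rewrite !mul0r.
  by have /eqP -> := cP y Sy qy j cj.
have m0 : 0 <= m by exact: c0.
rewrite sE dE !sJ -addrA lerD //.
  by apply: ler_sum => j _; rewrite ler_wpM2l //; have /SE := Sx.
rewrite -/(level J) [e * m]mulrC -mulrDr ler_wpM2l //.
by move: Jx; rewrite dot_suml.
Qed.

(** The bound of [cut_face_ge] is attained: at v if v is off the face, as all such vertices survive
    the cut, and otherwise at [v + e *: w i], which lies on an edge of length parameter at least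
    [delta]. *)
Lemma supp_cut_face J e q : cplx J -> (exists i, i \in J) ->
  0 <= e <= delta S (face_of J) (cone_normal J) ->
  supp (cut S (cone_normal J) e) q = supp S q + e * phi J q.
Proof.
move=> cJ J0 /andP[e0 ed].
have [v [w [vv dw qv H]]] := phi_vertex q J0.
have [y Cy yE] : exists2 y, cut S (cone_normal J) e y & dot q y = supp S q + e * phi J q.
  case: H => [[nf ->]|[i iJ [fv ->]]].
    exists v; last by rewrite mulr0 addr0.
    split; first exact: vertex_in.
    rewrite -face_cone_normal // in nf ed.
    by have := le_trans ed (delta_le_vertex polS vv nf); rewrite lerBrDl.
  have [Sv vJ] := fv.
  have [t [E [t0 vy [eE Ev Ey] seg]]] := edge_from vv dw (vJ i iJ).
  have [ny yE] := edge_neighbor fv vv dw iJ t0 vy eE Ev Ey.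
  have et : e <= t.
    apply: le_trans ed _; rewrite -yE -face_cone_normal //.
    by apply: neighbor_ge => //; rewrite face_cone_normal.
  exists (v + e *: w i); last by rewrite dotDr dotZr qv.
  split; first by apply: (face_sub eE.1); apply: seg; rewrite e0.
  rewrite supp_cone_normal // dotDr dotZr (cone_normal_dual dw vJ iJ) mulr1.
  by have /(cone_normal_eq J Sv) -> := vJ.
by rewrite (supp_eq Cy) // => x Cx; rewrite yE cut_face_ge.
Qed.

Lemma polytope_cut_face J e : cplx J -> (exists i, i \in J) ->
  0 <= e <= delta S (face_of J) (cone_normal J) ->
  polytope (cut S (cone_normal J) e).
Proof.
move=> cJ J0 /andP[e0 ed]; apply: polytope_cut => //.
have [y [vy ny _]] := neighbor_of_face cJ J0.
exists y; split; first exact: vertex_in.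
rewrite -face_cone_normal // in ny ed.
by have := le_trans ed (delta_le_vertex polS vy ny); rewrite lerBrDl.
Qed.

(** If i is in J' but not in J, the edge along [w i] from a vertex of the face of J stays in that
    face and leaves the facet i. *)
Lemma face_ofS J J' : cplx J -> face_of J `<=` face_of J' -> J' \subset J.
Proof.
move=> cJ JJ'; have [v vv vJ] := cplx_vertex cJ.
have Sv := vertex_in vv; have [_ vJ'] : face_of J' v by apply: JJ'.
apply/fintype.subsetP => i iJ'; apply: contraT => iJ.
have [w dw] := dualS vv; have vi := vJ' i iJ'.
have [t [E [t0 vy _ _]]] := edge_from vv dw vi.
have : face_of J' (v + t *: w i).
  apply: JJ'; split; first exact: vertex_in.
  move=> j jJ; rewrite /tight dotDr dotZr; have [dw1 _] := dw.
  rewrite dw1 ?vi ?vJ //; have -> : (j == i) = false by apply: contraNF iJ => /eqP <-.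
  by rewrite mulr0 addr0; exact: vJ.
move=> [_ /(_ i iJ')]; rewrite /tight dotDr dotZr; have [-> //] := dw.
by rewrite eqxx mulr1 (eqP vi) -subr_eq0 addrC addKr gt_eqF.
Qed.

(** The coordinates of [cone_normal J'] are the indicator of J', whose minimum on J is 1 exactly
    when J is contained in J'. *)
Lemma phi_cone_normal J J' : (exists i, i \in J) -> cplx J' ->
  phi J (cone_normal J') = (J \subset J')%:R.
Proof.
move=> J0 cJ'; have [v vv vJ'] := cplx_vertex cJ'.
pose la (i : 'I_N) : R := (i \in J')%:R.
have laE : cone_normal J' = \sum_i la i *: u i.
  rewrite /cone_normal big_mkcond; apply: eq_bigr => i _; rewrite /la.
  by case: (i \in J'); rewrite ?scale1r ?scale0r.
have [_ cE] : dot (cone_normal J') v = supp S (cone_normal J') /\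
    forall i, fan_coord (cone_normal J') i = la i.
  have la0 i : 0 <= la i by rewrite /la ler0n.
  have lav i : la i != 0 -> tight v i.
    by rewrite /la; case: (boolP (i \in J')) => [/vJ'//|_]; rewrite eqxx.
  exact: coord_cone laE.
have [i [iJ -> imin]] := phiP (cone_normal J') J0; rewrite cE /la.
have [JJ'|/subsetPn[j jJ jJ']] := boolP (J \subset J').
  by rewrite (fintype.subsetP JJ').
have := imin j jJ; rewrite !cE /la (negPf jJ').
by case: (i \in J'); rewrite // ler10.
Qed.

End SimpleSystem.

(** * Nestedness along shallow truncations *)

Section Spans.
Variables (R : realType) (M : lmodType R) (K : set R).
Implicit Types (A : set M) (x y : M).

Hypothesis K0 : K 0.
Hypothesis K1 : K 1.
Hypothesis KB : forall a c, K a -> K c -> K (a - c).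
Hypothesis KM : forall a c, K a -> K c -> K (a * c).

Lemma span_over_fin (I : finType) A (c : I -> R) (g : I -> M) :
  (forall i, K (c i)) -> (forall i, A (g i)) -> span_over K A (\sum_i c i *: g i).
Proof.
move=> cK gA; exists #|I|, (c \o enum_val), (g \o enum_val).
split=> [i||]; first exact: cK.
- by move=> i; exact: gA.
- by rewrite (reindex (@enum_val I I)) //=; exact/onW_bij/enum_val_bij.
Qed.

Lemma span_over_mem A x : A x -> span_over K A x.
Proof.
move=> Ax; have := @span_over_fin 'I_1 A (fun=> 1) (fun=> x) (fun=> K1) (fun=> Ax).
by rewrite big_ord1 scale1r.
Qed.

Lemma span_overD A x y : span_over K A x -> span_over K A y -> span_over K A (x + y).
Proof.
move=> [m [c [g [cK gA ->]]]] [m' [c' [g' [cK' gA' ->]]]].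
pose cc (t : 'I_m + 'I_m') := match t with inl i => c i | inr i => c' i end.
pose gg (t : 'I_m + 'I_m') := match t with inl i => g i | inr i => g' i end.
have : span_over K A (\sum_t cc t *: gg t).
  by apply: span_over_fin => -[].
by rewrite big_sumType.
Qed.

Lemma span_overZ A a x : K a -> span_over K A x -> span_over K A (a *: x).
Proof.
move=> aK [m [c [g [cK gA ->]]]]; exists m, (fun i => a * c i), g; split=> // [i|].
  exact: KM.
by rewrite scaler_sumr; apply: eq_bigr => i _; rewrite scalerA.
Qed.

Lemma span_over_sum A (T : eqType) (r : seq T) (c : T -> R) (g : T -> M) :
  (forall t, t \in r -> K (c t)) -> (forall t, t \in r -> span_over K A (g t)) ->
  span_over K A (\sum_(t <- r) c t *: g t).
Proof.
move=> cK gA; rewrite big_seq; elim/big_rec: _ => [|t x tr xA].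
  by exists 0%N, (fun=> 0), (fun=> 0); split=> [[]|[]|]; rewrite ?big_ord0.
by apply: span_overD => //; apply: span_overZ; [exact: cK|exact: gA].
Qed.

Lemma span_overB A x y : span_over K A x -> span_over K A y -> span_over K A (x - y).
Proof.
move=> Ax Ay; apply: span_overD => //; rewrite -scaleN1r; apply: span_overZ => //.
by rewrite -sub0r; exact: KB.
Qed.

End Spans.

(** * Unitriangular systems indexed by inclusion *)

Section Triangular.
Variables (R : realType) (T : finType).
Implicit Types (d : seq {set T}) (la g : {set T} -> R).

(** Forward substitution: no later member of d is contained in the head, so the equation at the head
    determines its coefficient. Only subtractions occur, so the solution stays in K. *)
Lemma triangular_solve (K : set R) d g :
  K 0 -> (forall a c, K a -> K c -> K (a - c)) ->
  pairwise (fun F J : {set T} => ~~ (J \subset F)) d -> (forall J, J \in d -> K (g J)) ->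
  exists la, (forall J, J \in d -> K (la J)) /\
    forall J', J' \in d -> \sum_(J <- d) la J * (J \subset J')%:R = g J'.
Proof.
move=> K0 KB; elim: d g => [|F d IH] g; first by exists (fun=> 0).
move=> /= /andP[/allP Fd dd] gK; have gF : K (g F) by apply: gK; rewrite mem_head.
have [|la [laK laE]] := IH (fun J => g J - g F * (F \subset J)%:R) dd.
  move=> J Jd; apply: KB; first by apply: gK; rewrite inE Jd orbT.
  by case: (F \subset J); rewrite ?mulr1 ?mulr0.
have FE J : J \in d -> (J == F) = false.
  by move=> /Fd; apply: contraNF => /eqP ->.
exists (fun J => if J == F then g F else la J); split=> [J|J'].
  by rewrite inE; case: eqP => //= _; exact: laK.
rewrite inE big_cons eqxx => /predU1P[->|J'd].
  rewrite subxx mulr1 big_seq big1 ?addr0 // => J Jd.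
  by rewrite (negPf (Fd J Jd)) mulr0.
rewrite (eq_big_seq (fun J => la J * (J \subset J')%:R)) => [|J Jd]; last by rewrite FE.
by rewrite laE // addrC subrK.
Qed.

Lemma triangular_free d la : pairwise (fun F J : {set T} => ~~ (J \subset F)) d ->
  (forall J', J' \in d -> \sum_(J <- d) la J * (J \subset J')%:R = 0) ->
  forall J, J \in d -> la J = 0.
Proof.
elim: d => // F d IH /= /andP[/allP Fd dd] H.
have laF : la F = 0.
  have := H F (mem_head _ _); rewrite big_cons subxx mulr1 big_seq big1 ?addr0 //.
  by move=> J Jd; rewrite (negPf (Fd J Jd)) mulr0.
move=> J; rewrite inE => /predU1P[-> //|]; apply: IH => // J' J'd.
by have := H J'; rewrite inE J'd orbT big_cons laF mul0r add0r; apply.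
Qed.

End Triangular.

(** * The nestedness invariant and its preservation by a shallow cut *)

Section Truncations.
Variables (R : realType) (n : nat) (S : set 'rV[R]_n).
Variables (N : nat) (u : 'I_N -> 'rV[R]_n) (b : 'I_N -> R).
Local Notation V := 'rV[R]_n.
Local Notation tight := (tight u b).
Local Notation nrm := (cone_normal u).
Local Notation level := (level b).
Local Notation face_of := (face_of S u b).
Local Notation cplx := (cplx S u b).
Local Notation cover := finset.cover.
Implicit Types (v x y z q : V) (F J : {set 'I_N}) (D : {set {set 'I_N}}).
Implicit Types (d : seq {set 'I_N}) (P : set V).

Hypothesis polS : polytope S.
Hypothesis SE : forall x, S x <-> forall i, b i <= dot (u i) x.

(* The last clause says that facets of P can only meet in a nested way: if the
   union of some of the truncated cones that are tight at a point of P is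
   itself a truncated cone, then it is one of them.  The facets of S that have
   not been truncated take part through I. *)
Definition stage d (be : {set 'I_N} -> R) P : Prop :=
  [/\ polytope P,
      forall x, P x <-> S x /\ forall J, J \in d -> be J <= dot (nrm J) x,
      forall J, J \in d -> level J < be J
    & forall x D (I : {set 'I_N}), P x ->
        (forall J, J \in D -> J \in d /\ dot (nrm J) x = be J) ->
        (forall i, i \in I -> tight x i) ->
        cplx (cover D :|: I) /\ (cover D :|: I \in d -> cover D :|: I \in D)].

Lemma stage0 be : stage [::] be S.
Proof.
split=> //; first by move=> x; split=> // -[].
move=> x D I Sx DP IP; split=> //; exists x; split=> // i.
rewrite inE => /orP[|/IP//]; rewrite /cover => /finset.bigcupP[J /DP[]].
by rewrite in_nil.
Qed.

Lemma stage_step d be P F e : stage d be P -> cplx F -> (exists i, i \in F) ->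
  (forall J, J \in d -> ~~ (J \subset F)) ->
  shallow_cut P (face_of F `&` P) (nrm F) e ->
  exists be', stage (F :: d) be' (cut P (nrm F) e).
Proof.
move=> [polP PE be_gt nest] cF F0 dF sh.
have PS x : P x -> S x by move=> /PE[].
(* Shallowness implies that the face still meets P: without neighbors [delta] would be the infimum
   of the empty set, which is 0, leaving no room for e. *)
have [y0 [_ Fy0] Py0] : exists2 y, face_of F y & P y.
  have /andP[e0 ed] := sh.
  have [[y [_ _ [v [E [/vertex_in Pv [Fv _] _ _ _]]]]]|nex] :=
    pselect (exists y, neighbor P (face_of F `&` P) y); first by exists v.
  move: (lt_trans e0 ed); rewrite /delta (_ : neighbor _ _ = classical_sets.set0).
    by rewrite image_set0 inf0 ltxx.
  by apply/seteqP; split=> // y yn; apply: nex; exists y.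
have y0F : dot (nrm F) y0 = level F by apply/(cone_normal_eq SE F (PS _ Py0)).
have sP : supp P (nrm F) = level F.
  rewrite (supp_eq Py0) // => x Px; rewrite y0F.
  exact: (cone_normal_ge SE F (PS _ Px)).
have fP : face_of F `&` P = face_at P (nrm F).
  apply/seteqP; split=> x.
    by move=> [[Sx Fx] Px]; split=> //; rewrite sP; apply/(cone_normal_eq SE F Sx).
  move=> [Px]; rewrite sP => xF; split=> //; split; first exact: PS.
  exact/(cone_normal_eq SE F (PS _ Px)).
rewrite /shallow_cut fP in sh; have /andP[e0 ed] := sh.
pose be' J := if J == F then level F + e else be J.
have nF J : J \in d -> (J == F) = false.
  by move=> /dF; apply: contraNF => /eqP ->.
have cE x : cut P (nrm F) e x <-> P x /\ be' F <= dot (nrm F) x.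
  by rewrite /cut /be' /= eqxx sP.
exists be'; split.
- apply: polytope_cut => //; have [|y yn] := neighbor_exists (u := nrm F) polP.
    have [i iF] := F0; rewrite -fP; have := ed; rewrite -fP.
    have [[x Px nx]|nex] := pselect (exists2 x, P x & ~ (face_of F `&` P) x);
      first by exists x.
    rewrite /delta (_ : neighbor _ _ = classical_sets.set0).
      by rewrite image_set0 inf0 ltNge (ltW e0).
    apply/seteqP; split=> // y [/vertex_in Py ny _]; apply: nex; exists y => //.
  have := lt_le_trans ed (neighbor_ge polP yn); rewrite ltrBrDl => /ltW yc.
  by exists y; split=> //; case: yn => /vertex_in.
- move=> x; rewrite cE PE; split=> [[[Sx dx] Fx]|[Sx dx]].
    by split=> // J; rewrite inE => /predU1P[-> //|Jd]; rewrite /be' nF // dx.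
  split; last by apply: dx; rewrite mem_head.
  by split=> // J Jd; have := dx J; rewrite inE Jd orbT /be' nF //; apply.
- move=> J; rewrite inE => /predU1P[->|Jd]; first by rewrite /be' eqxx ltrDl.
  by rewrite /be' nF // be_gt.
move=> x D I /cE[Px xF] DP IP.
have Sx := PS _ Px.
have [FD|FD] := boolP (F \in D); last first.
  have DP' J : J \in D -> J \in d /\ dot (nrm J) x = be J.
    move=> JD; have [] := DP J JD; rewrite inE /be'; case: eqP => [JF|_ /= -> //].
    by rewrite -JF JD in FD.
  have [cT nT] := nest x D I Px DP' IP; split=> //.
  rewrite inE => /predU1P[TF|/nT//].
  (* The one new case is a union equal to F itself. A member of D would be contained in F, against
     [dF]; so D is empty, all facets in F are tight at x, and x lies on the face that was cut
     off. *)
  have D0 J : J \notin D.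
    apply/negP => JD; have [Jd _] := DP' J JD; have := dF J Jd.
    by rewrite -TF (fintype.subset_trans _ (finset.subsetUl _ _)) // /cover (finset.bigcup_sup J).
  have IF i : i \in F -> tight x i.
    rewrite -TF inE => /orP[/finset.bigcupP[J JD]|/IP//].
    by rewrite (negPf (D0 J)) in JD.
  have : dot (nrm F) x = level F by apply/(cone_normal_eq SE F Sx).
  by move=> e'; move: xF; rewrite e' /be' eqxx gerDl leNgt e0.
have [_] := DP F FD; rewrite {1}/be' eqxx => xFe.
pose D' := D :\ F.
have DP' J : J \in D' -> J \in d /\ dot (nrm J) x = be J.
  by rewrite !inE => /andP[JF /DP]; rewrite inE /be' (negPf JF) /=.
(* A vertex of the face of P cut out by D' and I on which the normal of F is
   no larger than at x: by shallowness it must lie on F. *)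
pose t := \sum_(J in D') nrm J + nrm I.
have tge y : P y -> \sum_(J in D') be J + level I <= dot t y.
  move=> Py; rewrite dotDl dot_suml; apply: lerD;
    last exact: (cone_normal_ge SE I (PS y Py)).
  by apply: ler_sum => J JD; have /PE[_] := Py; apply; have [] := DP' J JD.
have tx : dot t x = \sum_(J in D') be J + level I.
  rewrite dotDl dot_suml; congr (_ + _); last exact/(cone_normal_eq SE I Sx).
  by apply: eq_bigr => J /DP'[].
have st : supp P t = \sum_(J in D') be J + level I.
  by rewrite -tx; apply: (supp_eq Px) => z; rewrite tx; exact: tge.
have ft : face_at P t x by split; rewrite ?tx.
have [z [vz [Pz tz] Fz]] := face_vertex (nrm F) polP ft.
have Sz := PS z Pz.
have [zD zI] : (forall J, J \in D' -> dot (nrm J) z = be J) /\ (forall i, i \in I ->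
  tight z i).
  have le1 : level I <= dot (nrm I) z by exact: (cone_normal_ge SE).
  have le2 J : J \in D' -> be J <= dot (nrm J) z.
    by move=> /DP'[Jd _]; have /PE[_] := Pz; apply.
  have le2s : \sum_(J in D') be J <= \sum_(J in D') dot (nrm J) z by exact: ler_sum.
  move: tz; rewrite st dotDl dot_suml => tz; split; last first.
    by apply/(cone_normal_eq SE I Sz); lra.
  move=> J JD.
  have : \sum_(J in D') (dot (nrm J) z - be J) == 0 by rewrite sumrB subr_eq0;
    apply/eqP; lra.
  rewrite psumr_eq0 => [/allP/(_ J (mem_index_enum _))|j jD];
    last by rewrite subr_ge0 le2.
  by rewrite JD subr_eq0 => /eqP.
have zF : face_at P (nrm F) z.
  apply: contrapT => nz; have := lt_le_trans ed (delta_le_vertex polP vz nz).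
  by rewrite sP; move: Fz xFe; lra.
rewrite -fP in zF; have [[_ zFt] _] := zF.
(* At z all facets in F are tight, so F moves from D to I, and the invariant of the previous stage
   at z speaks of the same union. *)
have IFt i : i \in F :|: I -> tight z i by rewrite inE => /orP[/zFt|/zI].
have DPz J : J \in D' -> J \in d /\ dot (nrm J) z = be J.
  by move=> JD; split; [have [] := DP' J JD|exact: zD].
have [cT nT] := nest z D' (F :|: I) Pz DPz IFt.
have TE : cover D :|: I = cover D' :|: (F :|: I).
  by rewrite finset.setUA [cover D' :|: F]finset.setUC /cover (big_setD1 F FD).
rewrite TE; split=> //; rewrite inE => /predU1P[->//|/nT].
by rewrite inE => /andP[].
Qed.

End Truncations.

(** * Piecewise linear functions on the truncated fan *)

Section PiecewiseLinear.
Variables (R : realType) (n : nat).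
Local Notation V := 'rV[R]_n.
Implicit Types (Sigma : set (set V)) (f g : V -> R^o).

Lemma fct_lincombE (T : Type) (r : seq T) (c : T -> R) (g : T -> V -> R^o) (q : V) :
  (\sum_(t <- r) c t *: g t) q = \sum_(t <- r) c t * g t q.
Proof. by elim/big_rec2: _ => // t y1 y2 _ <-. Qed.

Lemma PL_lincomb Sigma (T : eqType) (r : seq T) (c : T -> R) (g : T -> V -> R^o) :
  (forall t, t \in r -> PL Sigma (g t)) -> PL Sigma (\sum_(t <- r) c t *: g t).
Proof.
move=> gPL; rewrite big_seq; elim/big_rec: _ => [|t f tr fPL] K SK.
  by exists 0 => q _; rewrite dot0r.
have [x xE] := gPL t tr K SK; have [y yE] := fPL K SK.
by exists (c t *: x + y) => q Kq; rewrite dotDr dotZr -xE // -yE.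
Qed.

Lemma lattice_lincomb (a : R) (x y : V) :
  a \is a Num.int -> lattice x -> lattice y -> lattice (a *: x + y).
Proof.
move=> ai /mxOverP xi /mxOverP yi; apply/mxOverP => i j; rewrite !mxE.
by rewrite rpredD ?rpredM.
Qed.

Lemma lattice0 : lattice (0 : V).
Proof. by apply/mxOverP => i j; rewrite mxE rpred0. Qed.

Lemma PLZ_lincomb Sigma (T : eqType) (r : seq T) (c : T -> R) (g : T -> V -> R^o) :
  (forall t, t \in r -> c t \is a Num.int) -> (forall t, t \in r -> PLZ Sigma (g t)) ->
  PLZ Sigma (\sum_(t <- r) c t *: g t).
Proof.
move=> cZ gPL; rewrite big_seq; elim/big_rec: _ => [|t f tr fPL] K SK.
  by exists 0; [exact: lattice0|move=> q _; rewrite dot0r].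
have [x xl xE] := gPL t tr K SK; have [y yl yE] := fPL K SK.
exists (c t *: x + y); first by apply: lattice_lincomb => //; exact: cZ.
by move=> q Kq; rewrite dotDr dotZr -xE // -yE.
Qed.

Lemma PLZ_PL Sigma : PLZ Sigma `<=` PL Sigma.
Proof. by move=> f fP K SK; have [x _ xE] := fP K SK; exists x. Qed.

End PiecewiseLinear.

Section TruncatedFan.
Variables (R : realType) (n : nat) (S : set 'rV[R]_n).
Variables (N : nat) (u : 'I_N -> 'rV[R]_n) (b : 'I_N -> R).
Local Notation V := 'rV[R]_n.
Local Notation tight := (tight u b).
Local Notation nrm := (cone_normal u).
Local Notation level := (level b).
Local Notation face_of := (face_of S u b).
Local Notation cplx := (cplx S u b).
Local Notation cover := finset.cover.
Implicit Types (v x y z q : V) (F J : {set 'I_N}) (D : {set {set 'I_N}}).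

Hypothesis polS : polytope S.
Hypothesis SE : forall x, S x <-> forall i, b i <= dot (u i) x.
Hypothesis dualS : forall v, vertex S v -> exists w, dual_basis u b v w.

Local Notation phi := (phi polS SE).
Local Notation fan_coord := (fan_coord polS SE).

Variables (d : seq {set 'I_N}) (be : {set 'I_N} -> R) (P : set V).
Hypothesis stP : stage S u b d be P.
Hypothesis d_triang : pairwise (fun F J : {set 'I_N} => ~~ (J \subset F)) d.
Hypothesis d1 : forall i, [set i]%SET \in d.
Hypothesis d0 : forall J, J \in d -> exists i, i \in J.
Hypothesis dC : forall J, J \in d -> cplx J.
Hypothesis dU : forall J J', J \in d -> J' \in d -> (exists2 i, i \in J & i \in J') ->
  cplx (J :|: J') -> J :|: J' \in d.

Let polP : polytope P.
Proof. by case: stP. Qed.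

Lemma d_uniq : uniq d.
Proof.
elim: d d_triang => //= F l IH /andP[/allP Fl /IH ->]; rewrite andbT.
by apply/negP => /Fl; rewrite subxx.
Qed.

Let dn (k : 'I_(size d)) := nth finset.set0 d k.

Let dn_mem k : dn k \in d.
Proof. exact: mem_nth. Qed.

(** All singletons are in d and [be] exceeds their [level], so the truncating inequalities imply
    those of S. *)
Lemma trunc_mem x : P x <-> forall k, be (dn k) <= dot (nrm (dn k)) x.
Proof.
have [_ PE be_gt _] := stP; split=> [/PE[_ H] k|H]; first exact: H.
have H' J : J \in d -> be J <= dot (nrm J) x.
  move=> Jd; have iJ : (index J d < size d)%N by rewrite index_mem.
  by have := H (Ordinal iJ); rewrite /dn /= nth_index.
apply/PE; split=> //; apply/SE => i; have := H' _ (d1 i); have := be_gt _ (d1 i).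
rewrite /level /cone_normal !big_set1 => /ltW; exact: le_trans.
Qed.

Lemma trunc_dual q : exists la : 'I_(size d) -> R,
  [/\ forall k, 0 <= la k, q = \sum_k la k *: nrm (dn k) &
   forall x, P x -> dot q x = supp P q ->
     forall k, la k != 0 -> dot (nrm (dn k)) x = be (dn k)].
Proof.
have [y Py [qy ymin]] := supp_attained q polP.
have yP : forall k, be (dn k) <= dot (nrm (dn k)) y by apply/trunc_mem.
have yM x : (forall k, be (dn k) <= dot (nrm (dn k)) x) -> dot q y <= dot q x.
  by move=> /trunc_mem; exact: ymin.
have [la [la0 qE laP]] := dual_optimum yP yM.
exists la; split=> // x /trunc_mem Px; rewrite -qy => qx k.
exact: laP.
Qed.

(* If no coordinate on F were the smallest on all the rays tight at y, then each
   i in F would lie in a tight J not containing F; the union of F with these J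
   would be in d, against the nestedness in [stage]. *)
Lemma tight_linear y : P y -> exists v w, [/\ vertex S v, dual_basis u b v w,
    forall q, dot q y = supp P q -> supp S q = dot q v
  & forall F, F \in d -> exists i, forall q, dot q y = supp P q ->
      phi F q = if tight v i then dot q (w i) else 0].
Proof.
move=> Py; have [_ _ _ nest] := stP.
pose D := [set J in d | dot (nrm J) y == be J]%SET.
have DP J : J \in D -> J \in d /\ dot (nrm J) y = be J.
  by rewrite inE => /andP[? /eqP].
have I0 i : i \in (finset.set0 : {set 'I_N}) -> tight y i by rewrite inE.
have [cD _] := nest y D finset.set0 Py DP I0; rewrite finset.setU0 in cD.
have [v vv vD] := cplx_vertex polS SE cD; have [w dw] := dualS vv.
have lin q : dot q y = supp P q -> exists mu : 'I_N -> R,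
    [/\ dot q v = supp S q, forall i, fan_coord q i = mu i &
     forall i j, (forall J, J \in D -> i \in J -> j \in J) -> mu i <= mu j].
  move=> qy; have [la [la0 qE laP]] := trunc_dual q.
  (* The coordinate on a ray i collects the weights of the tight cones containing i. Hence it is
     monotone: if every tight cone through i contains j, then [mu i <= mu j]. *)
  pose mu i := \sum_k la k * (i \in dn k)%:R.
  have laD k : la k != 0 -> dn k \in D.
    by move=> lk; rewrite inE dn_mem (laP y Py qy) // eqxx.
  have mu0 i : 0 <= mu i by apply: sumr_ge0 => k _; rewrite mulr_ge0 ?ler0n.
  have muv i : mu i != 0 -> tight v i.
    move=> mi; apply: vD; have [k lk] : exists k, la k * (i \in dn k)%:R != 0.
      apply: contrapT => nex; move/eqP: mi; apply; apply: big1 => k _.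
      by apply/eqP/negP => /negP lk; apply: nex; exists k.
    have [iJ|iJ] := boolP (i \in dn k); last by rewrite (negPf iJ) mulr0 eqxx in lk.
    apply/finset.bigcupP; exists (dn k) => //; apply: laD.
    by apply: contraNneq lk => ->; rewrite mul0r.
  have qmu : q = \sum_i mu i *: u i.
    rewrite {1}qE; under [RHS]eq_bigr do rewrite scaler_suml.
    rewrite exchange_big; apply: eq_bigr => k _ /=.
    rewrite /cone_normal big_mkcond scaler_sumr; apply: eq_bigr => i _.
    by rewrite -scalerA; case: (i \in dn k); rewrite ?scale1r ?scale0r.
  have [qv cE] := coord_cone polS SE dualS vv mu0 muv qmu.
  exists mu; split=> // i j ij; apply: ler_sum => k _.
  have [->|/laD kD] := eqVneq (la k) 0; first by rewrite !mul0r.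
  rewrite ler_wpM2l // ler_nat; have := ij _ kD.
  by case: (i \in dn k) => // ->.
exists v, w; split=> // [q /lin[mu []]//|F Fd].
have [i [iF iD]] : exists i, i \in F /\ forall J, J \in D -> i \in J -> F \subset J.
  apply: contrapT => nex.
  pose D0 := [set J in D | ~~ (F \subset J) && (J :&: F != finset.set0)]%SET.
  have D0D J : J \in D0 -> J \in D by rewrite inE => /andP[].
  have FD0 : F \subset cover D0.
    apply/fintype.subsetP => i iF; apply: contrapT => niD0; apply: nex; exists i;
      split=> // J JD iJ.
    apply: contrapT => /negP FJ; apply: niD0; apply/finset.bigcupP; exists J => //.
    by rewrite inE JD FJ; apply/set0Pn; exists i; rewrite inE iJ.
  have D0sub J : J \in D -> J \subset cover D.
    by move=> JD; exact: (finset.bigcup_sup J).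
  have D0D' : cover D0 \subset cover D.
    by apply/finset.bigcupsP => J /D0D /D0sub.
  (* The building set axiom joins two members at a time, so those of [D0] are added to F one by one.
     Each of them meets F, and the union stays inside [cover D], a cone of S. *)
  have UT (l : seq {set 'I_N}) : {subset l <= D0} ->
    F :|: \bigcup_(J <- l) J \in d /\ F :|: \bigcup_(J <- l) J \subset cover D.
    elim: l => [|J l IH] lD; first by rewrite big_nil finset.setU0 (fintype.subset_trans FD0).
    have [|Td Tsub] := IH; first by move=> K Kl; apply: lD; rewrite inE Kl orbT.
    have JD0 := lD J (mem_head _ _).
    have JD := D0D J JD0.
    have [i] : exists i, i \in J :&: F.
      by apply/set0Pn; move: JD0; rewrite inE => /and3P[].
    rewrite inE => /andP[iJ iF].
    rewrite big_cons finset.setUA [F :|: J]finset.setUC -finset.setUA; split; last first.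
      by rewrite finset.subUset D0sub.
    apply: dU => //; first by case: (DP J JD).
      by exists i; rewrite // inE iF.
    by apply: (cplxS _ cD); rewrite finset.subUset D0sub.
  have [|Td _] := UT (enum D0); first by move=> J; rewrite mem_enum.
  have TE : F :|: \bigcup_(J <- enum D0) J = cover D0.
    by rewrite big_enum /=; apply/finset.setUidPr.
  have DP0 J : J \in D0 -> J \in d /\ dot (nrm J) y = be J by move=> /D0D/DP.
  (* Nestedness makes the union a member of [D0]; but it contains F, which no member of [D0]
     does. *)
  have [_] := nest y D0 finset.set0 Py DP0 I0; rewrite finset.setU0 -TE => /(_ Td).
  by rewrite TE inE FD0 andbF.
exists i => q qy; have [mu [qv cE muP]] := lin q qy.
rewrite -(coord_vertex polS SE i vv dw qv); apply: phi_eq => // j jF.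
by rewrite !cE; apply: muP => J JD iJ; apply: (fintype.subsetP (iD J JD iJ)).
Qed.

Let cone_point K : normal_fan P K -> exists2 y, P y & forall q, K q -> dot q y = supp P q.
Proof.
move=> [_ [q0 ->] <-]; have [y fy] := face_at_nonempty q0 polP.
by exists y; [case: fy|move=> q; apply].
Qed.

Lemma supp_PL : PL (normal_fan P) (supp S).
Proof.
move=> K /cone_point[y Py Ky]; have [v [w [_ _ lin _]]] := tight_linear Py.
by exists v => q /Ky/lin.
Qed.

Lemma phi_PL F : F \in d -> PL (normal_fan P) (phi F).
Proof.
move=> Fd K /cone_point[y Py Ky]; have [v [w [_ _ _ lin]]] := tight_linear Py.
have [i iP] := lin F Fd; exists (if tight v i then w i else 0) => q /Ky/iP ->.
by case: ifP => // _; rewrite dot0r.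
Qed.

Lemma supp_PLZ : (forall v, vertex S v -> lattice v) -> PLZ (normal_fan P) (supp S).
Proof.
move=> vZ K /cone_point[y Py Ky]; have [v [w [vv _ lin _]]] := tight_linear Py.
by exists v; [exact: vZ|move=> q /Ky/lin].
Qed.

Lemma phi_PLZ F : (forall v w i, vertex S v -> dual_basis u b v w -> tight v i ->
    lattice (w i)) -> F \in d -> PLZ (normal_fan P) (phi F).
Proof.
move=> wZ Fd K /cone_point[y Py Ky]; have [v [w [vv dw _ lin]]] := tight_linear Py.
have [i iP] := lin F Fd; exists (if tight v i then w i else 0).
  by case: ifP => [vi|_]; [exact: wZ dw vi|exact: lattice0].
by move=> q /Ky/iP ->; case: ifP => // _; rewrite dot0r.
Qed.

(** The normals with nonzero weight in the dual expansion of q lie in the same normal cone as q, and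
    f is linear there. *)
Lemma PL_determined (f : V -> R^o) : PL (normal_fan P) f ->
  (forall J, J \in d -> f (nrm J) = 0) -> forall q, f q = 0.
Proof.
move=> fPL f0 q; pose K := normal_cone P (face_at P q).
have NK : normal_fan P K by exists (face_at P q) => //; exists q.
have Kq : K q by move=> x [].
have [z zE] := fPL K NK; rewrite zE //.
have [la [la0 qE laP]] := trunc_dual q.
rewrite qE dot_suml big1 // => k _; rewrite dotZl.
have [->|lk] := eqVneq (la k) 0; first by rewrite mul0r.
rewrite -zE ?f0 ?mulr0 // => x [Px qx].
rewrite (laP x Px qx k lk); symmetry; rewrite -(laP x Px qx k lk).
by apply: supp_eq => // y /trunc_mem/(_ k); rewrite (laP x Px qx k lk).
Qed.

Lemma phi_nrm J J' : J \in d -> J' \in d -> phi J (nrm J') = (J \subset J')%:R.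
Proof. by move=> /d0 J0 /dC; exact: phi_cone_normal. Qed.

Lemma PL_expand (K : set R) f : K 0 -> (forall a c, K a -> K c -> K (a - c)) ->
  PL (normal_fan P) f -> (forall J, J \in d -> K (f (nrm J))) ->
  exists la : {set 'I_N} -> R, (forall J, J \in d -> K (la J)) /\
    f = \sum_(J <- d) la J *: (phi J : V -> R^o).
Proof.
move=> K0 KB fPL fK.
have [la [laK laE]] := triangular_solve K0 KB d_triang fK.
exists la; split=> //.
(* [None] stands for f, which makes f minus its expansion a single combination of piecewise linear
   functions. *)
pose G (o : option {set 'I_N}) := if o is Some J then phi J : V -> R^o else f.
pose c (o : option {set 'I_N}) := if o is Some J then - la J else 1.
pose h : V -> R^o := \sum_(o <- None :: map Some d) c o *: G o.
have hPL : PL (normal_fan P) h.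
  apply: PL_lincomb => -[J|] //.
  by rewrite inE /= => /mapP[J' Jd [->]]; exact: phi_PL.
have hE q : h q = f q - \sum_(J <- d) la J * phi J q.
  rewrite /h fct_lincombE big_cons big_map /= mul1r -sumrN; congr (_ + _).
  by apply: eq_bigr => J _; rewrite mulNr.
have h0 q : h q = 0.
  apply: PL_determined hPL _ q => J' J'd; rewrite hE -laE // big_seq [X in _ - X]big_seq.
  by apply/eqP; rewrite subr_eq0; apply/eqP/eq_bigr => J Jd; rewrite phi_nrm.
apply/funext => q; rewrite fct_lincombE; apply/eqP.
by rewrite -subr_eq0 -hE h0.
Qed.

Lemma phi_free (la : {set 'I_N} -> R) :
  (forall q, \sum_(J <- d) la J * phi J q = 0) -> forall J, J \in d -> la J = 0.
Proof.
move=> H; apply: triangular_free => // J' J'd; rewrite -[RHS](H (nrm J')).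
by apply: eq_big_seq => J Jd; rewrite phi_nrm.
Qed.

Lemma supp_phi q : supp S q = \sum_i b i * phi [set i]%SET q.
Proof.
have [c0 qE cP] := coordP polS SE q.
have [y [Sy qy]] := face_at_nonempty q polS.
rewrite -qy {1}qE dot_suml; apply: eq_bigr => i _; rewrite dotZl mulrC.
rewrite (phi_eq (i := i)) ?inE // => [|j]; last by rewrite inE => /eqP ->.
have [->|ci] := eqVneq (fan_coord q i) 0; first by rewrite !mulr0.
by have /eqP -> := cP y Sy qy i ci.
Qed.

End TruncatedFan.

(** * Facet description of a seed *)

Lemma card_uniq_I (T : choiceType) (L : seq T) k : uniq L ->
  ([set` L] #= `I_k)%card <-> size L = k.
Proof.
move=> uL; have LE : ([set` L] #= `I_(size L))%card.
  case: L uL => [_|x0 L uL].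
    by rewrite II0 (_ : [set` _] = set0) ?card_eq00 //; apply/seteqP; split.
  have -> : [set` x0 :: L] = nth x0 (x0 :: L) @` `I_(size (x0 :: L)).
    apply/seteqP; split=> [y yL|_ [i iL <-]]; last exact: mem_nth.
    exists (index y (x0 :: L)); last exact: nth_index.
    by rewrite /mkset index_mem.
  apply: inj_card_eq => i j; rewrite !inE => iL jL /eqP.
  by rewrite nth_uniq // => /eqP.
split=> [Lk|<- //]; apply: card_eq_II; apply: card_eq_trans Lk.
by rewrite card_eq_sym.
Qed.

Section InteriorOrigin.
Variables (R : realType) (n : nat).
Local Notation V := 'rV[R]_n.
Implicit Types (S F G : set V) (x p : V).

Lemma interior_scale S p : interior S 0 -> exists2 t : R, 0 < t & S (t *: p).
Proof.
move=> /nbhs_ballP[e /= e0 eS].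
pose M := \sum_j `|p 0 j| + 1.
have M0 : 0 < M by rewrite ltr_pwDr // sumr_ge0.
exists (e / 2 / M); first by rewrite !divr_gt0.
apply: eS; split=> // i j; rewrite ord1 !mxE /ball /= sub0r normrN normrM.
have pM : `|p 0 j| < M.
  by rewrite /M (bigD1 j) //= -addrA ltrDl ltr_wpDl // sumr_ge0.
rewrite gtr0_norm ?divr_gt0 // mulrAC ltr_pdivrMr //.
apply: (@lt_le_trans _ _ (e / 2 * M)); first by rewrite ltr_pM2l // divr_gt0.
by rewrite ler_pM2r //; have := e0; lra.
Qed.

Lemma supp_lt0 S p : polytope S -> interior S 0 -> p != 0 -> supp S p < 0.
Proof.
move=> polS i0 p0; have [t t0 St] := interior_scale (- p) i0.
apply: le_lt_trans (supp_le p polS St) _.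
by rewrite dotZr dotNr mulrN oppr_lt0 mulr_gt0 // dot_self_gt0.
Qed.

Lemma has_dim_uniq S d d' : has_dim S d -> has_dim S d' -> d = d'.
Proof.
move=> [x [U [Sx <- xU Umin]]] [x' [U' [Sx' <- xU' Umin']]].
have shift (y y' : V) (W : {vspace V}) : S y' -> (forall z, S z -> z - y \in W) ->
    forall z, S z -> z - y' \in W.
  move=> Sy' yW z Sz; have -> : z - y' = (z - y) - (y' - y).
    by rewrite opprB addrA subrK.
  by rewrite memvB ?yW.
apply/eqP; rewrite eqn_leq !dimvS //.
  by apply: Umin'; exact: (shift x x').
by apply: Umin; exact: (shift x' x).
Qed.

Lemma interior_full_dimensional S : interior S 0 -> full_dimensional S.
Proof.
move=> i0; have S0 : S 0 by have [t _] := interior_scale 0 i0; rewrite scaler0.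
exists 0, fullv; split=> // [|y _|W WP]; rewrite ?memvf //.
  by rewrite dimvf /dim /= mul1n.
apply/subvP => p _; have [t t0 /WP] := interior_scale p i0.
by rewrite subr0 => /(memvZ t^-1); rewrite scalerA mulVf ?scale1r // gt_eqF.
Qed.

Lemma span_dot0 (X : seq V) p w : (forall y, y \in X -> dot p y = 0) ->
  w \in <<X>>%VS -> dot p w = 0.
Proof.
move=> pX wX; rewrite (coord_span (X := in_tuple X) wX) dot_sumr big1 // => i _.
by rewrite dotZr pX ?mulr0 // mem_nth.
Qed.

(** Equality of row and column rank for the matrix with rows X. *)
Lemma span_full (X : seq V) : (forall p, (forall y, y \in X -> dot p y = 0) -> p = 0) ->
  <<X>>%VS = fullv.
Proof.
move=> H; pose A : 'M[R]_(size X, n) := \matrix_k X`_k.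
have kA (B : 'cV[R]_n) : A *m B = 0 -> B = 0.
  move=> AB; apply/trmx_inj; rewrite trmx0; apply: H => y yX.
  have iy : (index y X < size X)%N by rewrite index_mem.
  move/matrixP: AB => /(_ (Ordinal iy) 0); rewrite [RHS]mxE => <-.
  rewrite dotC /dot trmxK !mxE; apply: eq_bigr => j _.
  by rewrite !mxE /= nth_index.
have fA : row_free A^T.
  rewrite -kermx_eq0; apply/eqP/row_matrixP => k.
  rewrite row0; apply: trmx_inj; rewrite trmx0; apply: kA; apply: trmx_inj.
  by rewrite trmx_mul trmxK trmx0 -row_mul mulmx_ker row0.
have rA : row_full A by rewrite /row_full -mxrank_tr.
apply/eqP; rewrite eqEsubv subvf; apply/subvP => p _.
have /submxP[c ->] : (p <= A)%MS by rewrite submx_full.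
rewrite mulmx_sum_row; apply: memv_suml => k _; rewrite memvZ // rowK.
by rewrite memv_span // mem_nth.
Qed.

(* Among the functionals that are at least -1 on S and below -1 at x, one with
   the most vertices on its hyperplane: pushing it along some p orthogonal to
   these vertices would add a vertex, so they span the space. *)
Lemma facet_separates S x : polytope S -> interior S 0 -> ~ S x ->
  exists G, facet S G /\ forall q, G = face_at S q -> q != 0 -> dot q x < supp S q.
Proof.
move=> polS i0 nSx; have [s' [s'0 S'E]] := polS.
have [s [s_uniq s0 SE]] : exists s, [/\ uniq s, s != [::] & S = conv [set` s]].
  exists (undup s'); rewrite undup_uniq S'E; split=> //.
    by case: s' s'0 {S'E} => // y l _; apply/eqP => e; have := mem_undup (y :: l) y;
      rewrite e mem_head.
  by congr conv; apply/seteqP; split=> y /=; rewrite mem_undup.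
have sS y : y \in s -> S y by rewrite SE; exact: mem_conv.
have supp_s q : exists2 y, y \in s & dot q y = supp S q.
  have [y ys ymin] := seq_argmin (fun y => dot q y) s0.
  exists y => //; symmetry; apply: supp_eq; first exact: sS.
  by rewrite SE => z /conv_ge; apply.
(* The level -1 is a normalization: since 0 is interior, nonzero functionals have negative support
   values and can be rescaled. *)
pose ok u := (forall y, y \in s -> -1 <= dot u y) /\ dot u x < -1.
pose T u := [seq y <- s | dot u y == -1].
have [u1 ok1] : exists u, ok u.
  have [|u us] := @conv_sep _ _ s x; first by rewrite -SE.
  have [y ys ymin] := supp_s u.
  have u0 : u != 0.
    by apply/eqP => u0; have := us y ys; rewrite u0 !dot0l ltxx.
  have k0 := supp_lt0 polS i0 u0; exists ((- supp S u)^-1 *: u); split=> [z zs|];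
    rewrite dotZl.
    by rewrite mulrC ler_pdivlMr ?oppr_gt0 // mulN1r opprK; apply/supp_le/sS.
  by rewrite mulrC ltr_pdivrMr ?oppr_gt0 // mulN1r opprK -ymin us.
have [u [oku Tmax]] : exists u, ok u /\ forall u', ok u' -> (size (T u') <= size (T u))%N.
  suff H k : forall u, ok u -> (size s - size (T u) < k)%N ->
      exists u, ok u /\ forall u', ok u' -> (size (T u') <= size (T u))%N.
    exact: (H _ u1 ok1 (ltnSn _)).
  elim: k => // k IH u oku; rewrite ltnS => uk.
  have [[u' ok' lt]|nex] := pselect (exists2 u', ok u' & (size (T u) < size (T u'))%N).
    apply: (IH u' ok'); apply: leq_trans uk; apply: ltn_sub2l => //.
    by apply: leq_trans lt _; rewrite size_filter count_size.
  by exists u; split=> // u' ok'; rewrite leqNgt; apply/negP => lt; apply: nex; exists u'.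
have [us ux] := oku.
have u_neq0 : u != 0 by apply: contraTneq ux => ->; rewrite dot0l -leNgt lerN10.
have Tspan p : (forall y, y \in T u -> dot p y = 0) -> p = 0.
  move=> pT; apply/eqP; apply: contraT => p0.
  wlog px : p pT p0 / dot p x <= 0.
    move=> H; have [/H|/ltW px] := leP (dot p x) 0; first exact.
    apply: (H (- p)); rewrite ?oppr_eq0 // ?dotNl ?oppr_le0 //.
    by move=> y /pT; rewrite dotNl => ->; rewrite oppr0.
  pose r := [seq y <- s | dot p y < 0].
  have r0 : r != [::].
    have [y ys yp] := supp_s p; have := supp_lt0 polS i0 p0; rewrite -yp => y0.
    by apply/eqP => sE; have : y \in r; [by rewrite mem_filter y0 ys|by rewrite sE].
  (* Ratio test: t is the largest step along p that keeps s at or above -1, and [y0] is a point that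
     reaches the hyperplane. *)
  have [y0 + ymin] := seq_argmin (fun y => (1 + dot u y) / - dot p y) r0.
  rewrite mem_filter => /andP[py0 y0s]; set t := _ / _ in ymin.
  have t0 : 0 <= t by rewrite divr_ge0 ?oppr_ge0 ?(ltW py0) //; have := us y0 y0s; lra.
  have ok' : ok (u + t *: p).
    split=> [y ys|]; rewrite dotDl dotZl; last first.
      by have := mulr_ge0_le0 t0 px; lra.
    have [py|py] := leP 0 (dot p y); first by have := mulr_ge0 t0 py; have := us y ys;
      lra.
    have := ymin y; rewrite mem_filter py ys => /(_ isT).
    by rewrite ler_pdivlMr ?oppr_gt0 // mulrN; lra.
  have TT : {subset y0 :: T u <= T (u + t *: p)}.
    move=> y; rewrite inE => /predU1P[->|yT].
      rewrite mem_filter y0s andbT dotDl dotZl /t; apply/eqP; field.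
      by rewrite lt_eqF.
    by move: (yT); rewrite !mem_filter dotDl dotZl (pT y yT) mulr0 addr0.
  have := Tmax _ ok'; rewrite leqNgt => /negP[].
  apply: uniq_leq_size TT; rewrite /= filter_uniq // andbT mem_filter negb_and.
  apply/orP; left; apply: contraTneq py0 => uy0.
  by rewrite pT ?ltxx // mem_filter uy0 eqxx.
have [y0 y0T] : exists y, y \in T u.
  apply: contrapT => nex; move/eqP: u_neq0; apply; apply: Tspan => y yT.
  by case: nex; exists y.
have TP y : y \in T u -> S y /\ dot u y = -1.
  by rewrite mem_filter => /andP[/eqP uy /sS].
have [Sy0 uy0] := TP y0 y0T.
have su : supp S u = -1.
  by rewrite (supp_eq Sy0) // uy0 SE => z /conv_ge; apply.
pose X := [seq y - y0 | y <- T u].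
have X0 w : w \in <<X>>%VS -> dot u w = 0.
  by apply: span_dot0 => _ /mapP[y /TP[_ uy] ->]; rewrite dotBr uy uy0 subrr.
have y0X : y0 \notin <<X>>%VS.
  by apply/negP => /X0; rewrite uy0 => /eqP; rewrite oppr_eq0 oner_eq0.
have full : (<<X>> + <[y0]>)%VS = fullv.
  apply/eqP; rewrite eqEsubv subvf -(span_full Tspan); apply/span_subvP => y yT.
  rewrite -[y](subrK y0) memv_add ?memv_line //; apply: memv_span.
  exact: map_f.
have dX : (\dim <<X>>).+1 = n.
  have dj : (<<X>> :&: <[y0]>)%VS = 0%VS.
    apply/eqP; rewrite -subv0; apply/subvP => w; rewrite memv_cap memv0.
    move=> /andP[wX /vlineP[k wE]]; rewrite wE; have := X0 w wX.
    by rewrite wE dotZr uy0 mulrN1 => /eqP; rewrite oppr_eq0 => /eqP ->; rewrite scale0r.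
  have := dimv_disjoint_sum dj; rewrite full dimvf /dim /= mul1n dim_vline.
  have -> : y0 != 0 by apply: contraNneq y0X => ->; rewrite mem0v.
  by rewrite addn1 => /esym.
exists (face_at S u); split; last first.
  move=> q Gq q0; have sq := supp_lt0 polS i0 q0.
  have qT y : y \in T u -> dot q y = supp S q.
    move=> /TP[Sy uy]; have : face_at S u y by split; rewrite ?su.
    by rewrite Gq => -[].
  (* On the points of [T u], which span the space, q equals [supp S q] and u equals -1. So any
     functional exposing this facet is a positive multiple of u. *)
  have /eqP : q + supp S q *: u = 0.
    by apply: Tspan => y yT; rewrite dotDl dotZl qT //; have [_ ->] := TP y yT;
      rewrite mulrN1 subrr.
  rewrite addr_eq0 => /eqP qE; rewrite {1}qE dotNl dotZl -subr_gt0 opprK.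
  by rewrite -[X in X + _]mulr1 -mulrDr nmulr_rgt0 //; move: ux; lra.
split; first by exists u.
exists (\dim <<X>>); split; first by rewrite dX; exact: interior_full_dimensional.
exists y0, <<X>>%VS; split=> //.
- by split; rewrite ?su.
- move=> y [Sy]; rewrite su => uy; rewrite SE in Sy.
  have [m [c [g [c0 c1 gP ->]]]] := conv_face us Sy uy.
  rewrite -[y0]scale1r -c1 scaler_suml -sumrB; apply: memv_suml => k _.
  rewrite -scalerBr memvZ // memv_span //; apply/mapP; exists (g k) => //.
  by have [gs gu] := gP k; rewrite mem_filter gs gu eqxx.
- move=> W WP; apply/span_subvP => _ /mapP[y /TP[Sy uy] ->].
  by apply: WP; split; rewrite ?su.
Qed.

End InteriorOrigin.

(** * Lattice vectors and primitive multiples *)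

Section LatticeVectors.
Variables (R : realType) (n : nat).
Local Notation V := 'rV[R]_n.
Implicit Types (u v w x : V).

Lemma lattice_dot u x : lattice u -> lattice x -> dot u x \is a Num.int.
Proof.
move=> /mxOverP ui /mxOverP xi; rewrite dotE rpred_sum // => j _.
by rewrite rpredM.
Qed.

Lemma latticeD u x : lattice u -> lattice x -> lattice (u + x).
Proof. by move=> ul xl; rewrite -[u]scale1r; apply: lattice_lincomb. Qed.

Lemma lattice_sum (I : Type) (r : seq I) (P : pred I) (F : I -> V) :
  (forall i, P i -> lattice (F i)) -> lattice (\sum_(i <- r | P i) F i).
Proof.
by move=> FP; elim/big_rec: _ => [|i x Pi]; [exact: lattice0|apply/latticeD/FP].
Qed.

Lemma lattice_delta j : lattice (delta_mx 0 j : V).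
Proof.
by apply/mxOverP => i k; rewrite mxE; case: (_ && _); rewrite ?rpred1 ?rpred0.
Qed.

Lemma primitive_neq0 u : primitive u -> u != 0.
Proof.
move=> [_ prim]; apply/eqP => u0; have := prim 2 0 (@lattice0 R n).
by rewrite mul0rn => /(_ u0).
Qed.

Lemma lattice_norm1 w : lattice w -> exists m : nat, \sum_j `|w 0 j| = m%:R.
Proof.
move=> /mxOverP wi; apply/natrP; rewrite rpred_sum // => j _.
by rewrite natr_norm_int.
Qed.

(** After clearing denominators, the l1 norm is a natural number, and each division by an integer
    factor other than 1 makes it smaller. *)
Lemma rational_primitive (q : 'rV[rat]_n) : q != 0 ->
  exists2 k : R, 0 < k & primitive (k *: map_mx ratr q).
Proof.
move=> q0; set p : V := map_mx ratr q.
have p0 : p != 0 by rewrite map_mx_eq0.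
have [k0 k0_gt0 k0l] : exists2 k : R, 0 < k & lattice (k *: p).
  exists (\prod_j (denq (q 0 j))%:~R).
    by apply: prodr_gt0 => j _; rewrite ltr0z denq_gt0.
  apply/mxOverP => i j; rewrite ord1 !mxE (bigD1 j) //= mulrAC rpredM //.
    by rewrite /ratr mulrC divfK ?intr_eq0 ?denq_neq0 // intr_int.
  by apply: rpred_prod => l _; rewrite intr_int.
have [m] := lattice_norm1 k0l.
elim/ltn_ind: m k0 k0_gt0 k0l => m IH k k_gt0 kl km.
have [prim|] := pselect (primitive (k *: p)); first by exists k.
move=> nprim; have [l [w [wl kw l1]]] : exists l w, [/\ lattice w,
  k *: p = w *+ l & l <> 1%N].
  apply: contrapT => nex; apply: nprim; split=> // l w wl kw.
  by apply: contrapT => l1; apply: nex; exists l, w.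
have l0 : (0 < l)%N.
  rewrite lt0n; apply/negP => /eqP l0; move/eqP: kw.
  by rewrite l0 mulr0n scaler_eq0 gt_eqF //= (negPf p0).
have lR : (l%:R : R) != 0 by rewrite pnatr_eq0 -lt0n.
have wE : w = (k / l%:R) *: p.
  by rewrite mulrC -scalerA kw -[w *+ l]scaler_nat scalerA mulVf // scale1r.
have [m' wm] := lattice_norm1 wl.
have mm' : m = (l * m')%N.
  apply/eqP; rewrite -(eqr_nat R) -km natrM -wm mulr_sumr; apply/eqP/eq_bigr => j _.
  by rewrite kw mulmxnE -[in LHS]mulr_natl normrM normr_nat.
apply: (IH m' _ (k / l%:R)); rewrite -?wE //; last by rewrite divr_gt0 // ltr0n.
rewrite mm' -{1}[m']mul1n ltn_pmul2r; first by case: (l) l0 l1 => [|[|]].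
rewrite lt0n; apply/negP => /eqP m'0; move/eqP: wm; rewrite m'0 psumr_eq0 // => /allP w0.
have w_eq0 : w = 0.
  by apply/rowP => j; have := w0 j (mem_index_enum _); rewrite normr_eq0 => /eqP ->;
    rewrite mxE.
by move: wE => /eqP; rewrite w_eq0 eq_sym scaler_eq0 (negPf p0) orbF
  mulf_eq0 invr_eq0 (negPf lR) gt_eqF.
Qed.

End LatticeVectors.

(** * Halfspaces, dual bases and index sets of a seed *)

Section Seeds.
Variables (R : realType) (n : nat) (S : set 'rV[R]_n).
Local Notation V := 'rV[R]_n.
Implicit Types (v x y z q : V) (F G : set V).

Hypothesis seedS : seed S.

Let polS : polytope S. Proof. by case: seedS. Qed.
Let i0 : interior S 0. Proof. by case: seedS. Qed.

Lemma suppZ P (k : R) q : polytope P -> 0 < k -> supp P (k *: q) = k * supp P q.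
Proof.
move=> polP k0; have [y Py [qy ymin]] := supp_attained q polP.
rewrite -qy -dotZl; apply: supp_eq => // x Px.
by rewrite !dotZl ler_pM2l // ymin.
Qed.

Lemma face_atZ P (k : R) q : polytope P -> 0 < k -> face_at P (k *: q) = face_at P q.
Proof.
move=> polP k0; apply/seteqP; split=> x [Px e]; split=> //; move: e;
  rewrite dotZl (suppZ _ polP k0).
  by move=> /(mulfI (lt0r_neq0 k0)).
by move=> ->.
Qed.

Lemma facet_neq G : facet S G -> G <> S.
Proof.
move=> [_ [m [dS dG]]] GS; rewrite GS in dG.
by have /eqP := has_dim_uniq dS dG; rewrite gtn_eqF.
Qed.

(** Rationality of the facets supplies a primitive normal, so the choice in [facet_normal] does not
    fall back on 0. *)
Lemma facet_normalP G : facet S G ->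
  primitive (facet_normal S G) /\ G = face_at S (facet_normal S G).
Proof.
move=> fG; have [_ _ rat _ _] := seedS; have [q Gq] := rat G fG.
have q0 : q != 0.
  apply/eqP => q0; apply: (facet_neq fG); rewrite Gq q0 map_mx0.
  apply/seteqP; split=> [x []//|x Sx]; split=> //.
  by rewrite (supp_eq Sx) // => y _; rewrite !dot0l.
have [k k0 kp] := rational_primitive R q0.
rewrite /facet_normal; case: xgetP => [w _ //|/(_ (k *: map_mx ratr q))[]].
by split=> //; rewrite face_atZ.
Qed.

Variable fs : seq (set V).
Hypothesis fs_uniq : uniq fs.
Hypothesis fsP : forall G, G \in fs <-> facet S G.

Definition facet_of (i : 'I_(size fs)) : set V := nth set0 fs i.
Definition fnormal i : V := facet_normal S (facet_of i).
Definition foffset i : R := supp S (fnormal i).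

Local Notation tight := (tight fnormal foffset).
Local Notation nrm := (cone_normal fnormal).
Local Notation face_of := (face_of S fnormal foffset).
Local Notation cplx := (cplx S fnormal foffset).

Lemma facet_ofP i : facet S (facet_of i).
Proof. by apply/fsP; exact: mem_nth. Qed.

Lemma facet_ofE G : facet S G -> exists i, facet_of i = G.
Proof.
move=> /fsP Gfs; have iG : (index G fs < size fs)%N by rewrite index_mem.
by exists (Ordinal iG); rewrite /facet_of /= nth_index.
Qed.

Lemma facet_of_inj : injective facet_of.
Proof.
by move=> i j /eqP; rewrite nth_uniq // => /eqP ij; apply: val_inj.
Qed.

Lemma facet_of_tight i x : S x -> facet_of i x <-> tight x i.
Proof.
move=> Sx; have [_ ->] := facet_normalP (facet_ofP i).
by split=> [[_ /eqP]|/eqP].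
Qed.

Lemma fnormal_primitive i : primitive (fnormal i).
Proof. by have [] := facet_normalP (facet_ofP i). Qed.

Lemma foffset_lt0 i : foffset i < 0.
Proof. exact/supp_lt0/primitive_neq0/fnormal_primitive. Qed.

Lemma seed_halfspaces x : S x <-> forall i, foffset i <= dot (fnormal i) x.
Proof.
split=> [Sx i|H]; first exact: supp_le.
apply: contrapT => nS; have [G [fG Gx]] := facet_separates polS i0 nS.
have [i iG] := facet_ofE fG; have := H i; rewrite leNgt => /negP; apply.
have [pi Gi] := facet_normalP (facet_ofP i).
by apply: Gx; rewrite ?primitive_neq0 // -iG.
Qed.

(** Otherwise small steps from v along p and along -p both stay in S, and the functional exposing v
    would have to increase along both. *)
Lemma seed_vertex_kernel v p : vertex S v ->
  (forall i, tight v i -> dot (fnormal i) p = 0) -> p = 0.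
Proof.
move=> vv pv; have Sv := vertex_in vv; apply/eqP; apply: contraT => p0.
have [a av] := vertex_exposed vv polS.
have small (p' : V) : (forall i, tight v i -> dot (fnormal i) p' = 0) ->
    exists2 t : R, 0 < t & S (v + t *: p').
  move=> p'v; have [t0 t0_gt0 tP] : exists2 t0, 0 < t0 & forall t, 0 < t <= t0 ->
      forall i, i \in enum 'I_(size fs) ->
        foffset i <= dot (fnormal i) v + t * dot (fnormal i) p'.
    apply: seq_small => i _; have /seed_halfspaces/(_ i) := Sv.
    rewrite le_eqVlt => /orP[/eqP vi|].
      exists 1 => // t _; rewrite p'v ?mulr0 ?addr0 -?vi //.
      by rewrite /tight -vi.
    rewrite -subr_gt0 => /(linear_small (dot (fnormal i) p'))[t0 t0_gt0 tP].
    by exists t0 => // t /tP; lra.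
  exists t0 => //; apply/seed_halfspaces => i; rewrite dotDr dotZr tP ?mem_enum //.
  by rewrite t0_gt0 lexx.
have pos (p' : V) : p' != 0 -> (forall i, tight v i -> dot (fnormal i) p' = 0) ->
  0 < dot a p'.
  move=> p'0 /small[t t0 /av]; rewrite -subr_eq0 addrC addKr scaler_eq0 gt_eqF //= (negPf p'0).
  by move=> /(_ isT); rewrite dotDr dotZr ltrDl pmulr_rgt0.
have := pos p p0 pv; have := pos (- p); rewrite oppr_eq0 => /(_ p0).
rewrite dotNr oppr_gt0 => H; have /H : forall i, tight v i -> dot (fnormal i) (- p) = 0.
  by move=> i /pv; rewrite dotNr => ->; rewrite oppr0.
by move=> /lt_trans h /h; rewrite ltxx.
Qed.

Lemma seed_tight_card v : vertex S v -> #|tight v| = n.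
Proof.
move=> vv; have Sv := vertex_in vv; have [_ dS _ [m dm simp] _] := seedS.
have {dm}mn : m = n := has_dim_uniq dm dS.
have := simp v vv; rewrite mn.
have -> : [set G | facet S G /\ G v] = [set` [seq facet_of i | i <- enum (tight v)]].
  apply/seteqP; split=> [G [fG Gv]|G /= /mapP[i]].
    have [i iG] := facet_ofE fG; apply/mapP; exists i => //.
    by rewrite mem_enum; apply/(facet_of_tight i Sv); rewrite iG.
  rewrite mem_enum => vi ->; split; first exact: facet_ofP.
  exact/(facet_of_tight i Sv).
move=> /card_uniq_I; rewrite map_inj_uniq ?enum_uniq; last exact: facet_of_inj.
by rewrite size_map -cardE; apply.
Qed.

(** Simplicity gives n tight normals, and they have trivial kernel; the columns of the inverse of
    their matrix are the dual basis. *)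
Lemma seed_dual v : vertex S v -> exists w, dual_basis fnormal foffset v w.
Proof.
move=> vv; pose A := tight v; have cA : #|A| = n := seed_tight_card vv.
pose M : 'M[R]_(#|A|, n) := \matrix_k fnormal (enum_val k).
have kM (B : 'cV[R]_n) : M *m B = 0 -> B = 0.
  move=> MB; apply/trmx_inj; rewrite trmx0; apply: (seed_vertex_kernel vv) => i vi.
  have iA : i \in A by [].
  move/matrixP: MB => /(_ (enum_rank_in iA i) 0); rewrite [RHS]mxE => <-.
  rewrite /dot trmxK !mxE; apply: eq_bigr => j _.
  by rewrite !mxE enum_rankK_in.
have fT : row_free M^T.
  rewrite -kermx_eq0; apply/eqP/row_matrixP => k.
  rewrite row0; apply: trmx_inj; rewrite trmx0; apply: kM; apply: trmx_inj.
  by rewrite trmx_mul trmxK trmx0 -row_mul mulmx_ker row0.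
have fM : row_free M by rewrite /row_free [X in _ == X]cA -mxrank_tr.
have [B MB] := row_freeP fM.
have BM (x : 'cV[R]_n) : B *m (M *m x) = x.
  apply/eqP; rewrite -subr_eq0; apply/eqP/kM.
  by rewrite mulmxBr mulmxA MB mul1mx subrr.
pose w i := \sum_k (if enum_val k == i then (col k B)^T else 0 : V).
have wE k : w (enum_val k) = (col k B)^T.
  rewrite /w (bigD1 k) //= eqxx big1 ?addr0 // => l lk.
  by rewrite (inj_eq enum_val_inj) (negPf lk).
have dE k (x : 'cV[R]_n) : (M *m x) k 0 = dot (fnormal (enum_val k)) x^T.
  by rewrite /dot trmxK !mxE; apply: eq_bigr => j _; rewrite !mxE.
exists w; split=> [i j vi vj|x].
  have iA : i \in A by []. have jA : j \in A by [].
  rewrite -(enum_rankK_in iA iA) -(enum_rankK_in iA jA) wE -dE colE mulmxA MB mul1mx.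
  by rewrite !mxE eqxx andbT (inj_eq enum_val_inj).
rewrite (eq_bigl (fun i => i \in A)) // big_enum_val /=.
apply/rowP => j; have /matrixP/(_ j 0) := BM x^T; rewrite [x^T j 0]mxE => <-.
rewrite mxE summxE; apply: eq_bigr => k _.
by rewrite wE dE trmxK !mxE mulrC.
Qed.

(** Faces are handled through the facets containing them, which reverses inclusion and turns a
    nonempty intersection into a union. *)
Definition idx F : {set 'I_(size fs)} := [set i | `[< F `<=` facet_of i >]]%SET.

(** By complementary slackness the facets with a nonzero coefficient in q contain F, and tightness
    on them already makes q minimal. *)
Lemma face_of_idx F : face S F -> F <> S ->
  [/\ F = face_of (idx F), cplx (idx F) & exists i, i \in idx F].
Proof.
move=> [q Fq] FS; have [x0 Fx0] := face_at_nonempty q polS; rewrite -Fq in Fx0.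
have FE : F = face_of (idx F).
  apply/seteqP; split=> x.
    move=> Fx; have Sx : S x by move: Fx; rewrite Fq => -[].
    by split=> // i; rewrite inE => /asboolP/(_ x Fx)/(facet_of_tight i Sx).
  move=> [Sx xF]; rewrite Fq; split=> //.
  have [c [c0 qE cP]] := coord_exists polS seed_halfspaces q.
  have cF i : c i != 0 -> i \in idx F.
    move=> ci; rewrite inE; apply/asboolP => y; rewrite {1}Fq => -[Sy qy].
    by apply/(facet_of_tight i Sy); exact: cP ci.
  have Sx0 : S x0 by move: Fx0; rewrite Fq => -[].
  have <- : dot q x0 = supp S q by move: Fx0; rewrite {1}Fq => -[].
  rewrite qE !dot_suml; apply: eq_bigr => i _; rewrite !dotZl.
  have [->|ci] := eqVneq (c i) 0; first by rewrite !mul0r.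
  have /eqP -> := xF i (cF i ci).
  by have := cF i ci; rewrite inE => /asboolP/(_ x0 Fx0)/(facet_of_tight i Sx0)/eqP ->.
split=> //; first by exists x0; rewrite -FE.
apply: contrapT => nex; apply: FS; rewrite FE; apply/seteqP; split=> [x []//|x Sx].
by split=> // i iF; case: nex; exists i.
Qed.

Lemma idx_face_of J : cplx J -> idx (face_of J) = J.
Proof.
move=> cJ; apply/setP => i; rewrite inE; apply/asboolP/idP => [sub|iJ x [Sx /(_ i iJ)]].
  have : face_of J `<=` face_of [set i]%SET.
    move=> x Jx; have Sx : S x by case: Jx.
    split=> // j; rewrite inE => /eqP ->; apply/(facet_of_tight i Sx); exact: sub.
  move=> /(face_ofS polS seed_halfspaces seed_dual cJ) /fintype.subsetP; apply.
  by rewrite inE.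
by move=> /(facet_of_tight i Sx).
Qed.

Lemma face_normal_idx F : face_normal S F = nrm (idx F).
Proof.
rewrite /face_normal /cone_normal.
have -> : [set G | facet S G /\ F `<=` G] = [set` [seq facet_of i | i <- enum (idx F)]].
  apply/seteqP; split=> [G [fG FG]|G /= /mapP[i]].
    have [i iG] := facet_ofE fG; apply/mapP; exists i => //.
    by rewrite mem_enum inE; apply/asboolP; rewrite iG.
  by rewrite mem_enum inE => /asboolP Fi ->; split=> //; exact: facet_ofP.
rewrite -fsbig_seq; last by rewrite map_inj_uniq ?enum_uniq //; exact: facet_of_inj.
by rewrite big_map big_enum.
Qed.

Lemma facet_of_face i : facet_of i = face_of [set i]%SET.
Proof.
have [_ Gi] := facet_normalP (facet_ofP i); rewrite {1}Gi.
apply/seteqP; split=> x [Sx xi]; split=> //.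
  by move=> j; rewrite inE => /eqP ->; apply/eqP.
by apply/eqP/xi; rewrite inE.
Qed.

Lemma cplx1 i : cplx [set i]%SET.
Proof.
have [_ Gi] := facet_normalP (facet_ofP i).
by have := face_at_nonempty (facet_normal S (facet_of i)) polS; rewrite -Gi facet_of_face.
Qed.

Lemma idx_facet i : idx (facet_of i) = [set i]%SET.
Proof. by rewrite facet_of_face idx_face_of //; exact: cplx1. Qed.

End Seeds.

(** * Delzant seeds *)

Section DelzantSeeds.
Variables (R : realType) (n : nat) (S : set 'rV[R]_n).
Local Notation V := 'rV[R]_n.
Implicit Types (v x y z q : V) (F G : set V).

Hypothesis seedS : seed S.
Variable fs : seq (set V).
Hypothesis fs_uniq : uniq fs.
Hypothesis fsP : forall G, G \in fs <-> facet S G.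

Let polS : polytope S. Proof. by case: seedS. Qed.
Let SE := seed_halfspaces seedS fsP.
Let dualS := seed_dual seedS fs_uniq fsP.

Local Notation u := (@fnormal R n S fs).
Local Notation b := (@foffset R n S fs).
Local Notation tight := (tight u b).
Local Notation nrm := (cone_normal u).
Local Notation face_of := (face_of S u b).
Local Notation cplx := (cplx S u b).

(** Choose a tight i with [dot (u i) d] nonzero. The functional q exposing the edge vanishes on d,
    which forces its coordinate at i to be 0; so q vanishes on [w i] too, the edge along [w i] ends
    in E, and E has dimension 1. *)
Lemma edge_direction v w d E t : vertex S v -> dual_basis u b v w -> edge S E -> E v ->
  0 < t -> E (v + t *: d) -> d != 0 ->
  exists i, tight v i /\ exists2 k, 0 < k & d = k *: w i.
Proof.
move=> vv dw [fE [x [U [Ex dU xU _]]]] Ev t0 Ed d0; have [dw1 dw2] := dw.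
have sub y y' : E y -> E y' -> y - y' \in U.
  move=> Ey Ey'; have -> : y - y' = (y - x) - (y' - x) by rewrite opprB addrA subrK.
  by rewrite memvB ?xU.
have dU' : d \in U.
  have := sub _ _ Ed Ev; rewrite addrC addKr => /(memvZ t^-1).
  by rewrite scalerA mulVf ?scale1r // gt_eqF.
have [q Eq] := fE; have Sv := face_sub fE Ev.
have ud i : tight v i -> 0 <= dot (u i) d.
  move=> /eqP vi; have /SE/(_ i) := face_sub fE Ed.
  by rewrite dotDr dotZr vi lerDl pmulr_rge0.
have qv : dot q v = supp S q by move: Ev; rewrite Eq => -[].
have qd : dot q d = 0.
  move: Ed; rewrite Eq => -[_]; rewrite dotDr dotZr qv => /eqP.
  by rewrite -subr_eq0 addrC addKr mulf_eq0 gt_eqF //= => /eqP.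
have [i [vi di]] : exists i, tight v i /\ dot (u i) d != 0.
  apply: contrapT => nex; move/eqP: d0; apply; rewrite (dw2 d) big1 // => i vi.
  have [->|di] := eqVneq (dot (u i) d) 0; first by rewrite scale0r.
  by case: nex; exists i.
have [c0 qE cP] := coordP polS SE q.
have ci : fan_coord polS SE q i = 0.
  have : \sum_j fan_coord polS SE q j * dot (u j) d == 0.
    apply/eqP; rewrite -[RHS]qd [in RHS]qE dot_suml.
    by apply: eq_bigr => j _; rewrite dotZl.
  rewrite psumr_eq0 => [/allP/(_ i (mem_index_enum _))|j _].
    by rewrite mulf_eq0 (negPf di) orbF => /eqP.
  have [->|/(cP v Sv qv j)/ud] := eqVneq (fan_coord polS SE q j) 0;
    first by rewrite mul0r.
  exact: mulr_ge0.
have qw : dot q (w i) = 0 by rewrite -ci (coord_vertex polS SE i vv dw qv) vi.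
have [t1 [E1 [t1_gt0 vy [eE1 _ E1y] _]]] := edge_from polS SE vv dw vi.
have wU : w i \in U.
  have Ey : E (v + t1 *: w i).
    by rewrite Eq; split; [exact: vertex_in|rewrite dotDr dotZr qw mulr0 addr0].
  have := sub _ _ Ey Ev; rewrite addrC addKr => /(memvZ t1^-1).
  by rewrite scalerA mulVf ?scale1r // gt_eqF.
have w0 : w i != 0.
  by apply/eqP => w0; have := dw1 i i vi vi; rewrite w0 dot0r eqxx => /eqP;
    rewrite eq_sym oner_eq0.
have UE : U = <[w i]>%VS.
  by apply/esym/eqP; rewrite eqEdim -memvE wU dU dim_vline w0.
exists i; split=> //; exists (dot (u i) d); first by rewrite lt0r di ud.
move: dU'; rewrite UE => /vlineP[k ->].
by rewrite dotZr dw1 // eqxx mulr1.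
Qed.

(** The primitive direction along [w i] is [k *: w i] with k a natural number. Each lattice vector
    is an integral combination of edge directions, on which [u i] takes the values 0 and k only; so
    k divides [u i], and k = 1 as [u i] is primitive. *)
Lemma delzant_dual v w i : delzant S -> vertex S v -> dual_basis u b v w -> tight v i ->
  lattice (w i).
Proof.
move=> [_ _ dz] vv dw vi; have [spanD freeD] := dz v vv.
set D := edge_directions S v in spanD freeD.
have [ul ui_prim] := fnormal_primitive seedS fsP i.
have [dw1 _] := dw.
have Dl d : D d -> lattice d by move=> [[]].
have Ddir d : D d -> exists j, tight v j /\ exists2 k, 0 < k & d = k *: w j.
  move=> [pd [E [t [eE Ev t0 Ed]]]].
  exact: edge_direction vv dw eE Ev t0 Ed (primitive_neq0 pd).
have Ddot d : D d -> dot (u i) d = 0 \/ exists2 k, 0 < k & d = k *: w i.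
  move=> /Ddir[j [vj [k k0 dE]]]; have [ij|ij] := eqVneq i j.
    by right; exists k; rewrite // ij.
  by left; rewrite dE dotZr dw1 // (negPf ij) mulr0.
have [d [Dd [k k0 dE]]] : exists d, D d /\ exists2 k, 0 < k & d = k *: w i.
  apply: contrapT => nex.
  have Dz d : D d -> dot (u i) d = 0.
    by move=> Dd; have [//|kd] := Ddot d Dd; case: nex; exists d.
  have /eqP : u i = 0.
    apply/rowP => j; rewrite mxE -dot_delta; have := @lattice_delta R n j.
    rewrite -spanD => -[m [c [g [_ gD ->]]]].
    by rewrite dot_sumr big1 // => l _; rewrite dotZr Dz ?mulr0.
  by apply/negP; apply: primitive_neq0; split.
have uk : dot (u i) d = k by rewrite dE dotZr dw1 // eqxx mulr1.
have kZ : k \is a Num.int by rewrite -uk; apply/lattice_dot/Dl.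
have Duniq d' : D d' -> (exists2 k, 0 < k & d' = k *: w i) -> d' = d.
  move=> Dd' [k' k'0 d'E]; apply: contrapT => dd'.
  have uk' : dot (u i) d' = k' by rewrite d'E dotZr dw1 // eqxx mulr1.
  have k'Z : k' \is a Num.int by rewrite -uk'; apply/lattice_dot/Dl.
  (* Two different directions along [w i] would satisfy the integral relation k' d - k d' = 0. *)
  pose c (l : 'I_2) := if l == 0 then k' else - k.
  pose g (l : 'I_2) := if l == 0 then d else d'.
  have ginj : injective g.
    by move=> [[|[|//]] p] [[|[|//]] p'] e; apply: val_inj => //; case: dd';
      first [exact: e | exact: esym e].
  have cZ l : integers (c l) by rewrite /c; case: ifP => _ //=;
    rewrite /integers /= rpredN.
  have gD l : D (g l) by rewrite /g; case: ifP.
  have s0 : \sum_l c l *: g l = 0.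
    rewrite big_ord_recl big_ord1 /c /g /= dE d'E !scalerA mulNr scaleNr.
    by rewrite mulrC subrr.
  by have /eqP := freeD 2 c g ginj cZ gD s0 0; rewrite /c eqxx gt_eqF.
have [kk kE] : exists kk : nat, k = kk%:R by apply/natrP; rewrite natrEint kZ ltW.
have coordZ j : exists2 a : R, a \is a Num.int & u i 0 j = k * a.
  rewrite -dot_delta; have := @lattice_delta R n j;
    rewrite -spanD => -[m [c [g [cZ gD ->]]]].
  exists (\sum_(l | g l == d) c l); first by apply: rpred_sum => l _; exact: cZ.
  rewrite dot_sumr mulr_sumr [RHS]big_mkcond; apply: eq_bigr => l _; rewrite dotZr.
  case: eqP => [->|gd]; first by rewrite uk mulrC.
  have [->|kd] := Ddot _ (gD l); first by rewrite mulr0.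
  by case: gd; exact: Duniq.
have kk1 : kk = 1%N.
  have k_neq0 : k != 0 by rewrite gt_eqF.
  apply: (ui_prim kk (k^-1 *: u i)); last first.
    by rewrite -scaler_nat -kE scalerA divff // scale1r.
  apply/mxOverP => l j; rewrite ord1 mxE; have [a aZ ->] := coordZ j.
  by rewrite mulKf.
by have := Dl d Dd; rewrite dE kE kk1 scale1r.
Qed.

Lemma delzant_delta_ge1 J : delzant S -> cplx J -> (exists i, i \in J) ->
  1 <= delta S (face_of J) (nrm J).
Proof.
move=> [_ vZ _] cJ J0; rewrite -(face_cone_normal SE cJ); apply: delta_ge.
  by rewrite (face_cone_normal SE cJ); exact: (neighbor_of_face polS SE dualS).
move=> y vy ny; have := face_atN_gt polS (vertex_in vy) ny.
rewrite -subr_gt0 => gt0.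
have [v vv qv] := supp_vertex (nrm J) polS; rewrite -qv in gt0 *.
have nZ : lattice (nrm J).
  by apply: lattice_sum => i _; have [] := fnormal_primitive seedS fsP i.
have zZ : dot (nrm J) y - dot (nrm J) v \is a Num.int.
  by rewrite rpredB // lattice_dot //; apply: vZ.
have [m mE] : exists m : nat, dot (nrm J) y - dot (nrm J) v = m%:R.
  by apply/natrP; rewrite natrEint zZ ltW.
by move: gt0; rewrite mE ltr0n ler1n.
Qed.

(** The parameter t is a difference of values of [u i] at lattice points, so an integer. If t were
    above 1, the lattice point [v + w i] would be a vertex lying strictly between two points of
    S. *)
Lemma primitive_edge v w i t E : primitive_delzant S -> vertex S v ->
  dual_basis u b v w -> tight v i -> edge S E -> vertex S (v + t *: w i) -> 0 < t ->
  (forall e, 0 <= e <= t -> E (v + e *: w i)) -> t = 1.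
Proof.
move=> [dz prim] vv dw vi eE vy t0 seg; have [_ vZ _] := dz.
have [dw1 _] := dw; have [ul _] := fnormal_primitive seedS fsP i.
have tE : t = dot (u i) (v + t *: w i) - dot (u i) v.
  by rewrite dotDr dotZr dw1 // eqxx mulr1 addrC addKr.
have tZ : t \is a Num.int.
  by rewrite tE rpredB // lattice_dot //; apply: vZ.
have t1 : 1 <= t.
  have [m mE] : exists m : nat, t = m%:R by apply/natrP; rewrite natrEint tZ ltW.
  by move: t0; rewrite mE ltr0n ler1n.
apply/eqP; rewrite eq_le t1 andbT leNgt; apply/negP => t_gt1.
have E1 : E (v + 1 *: w i) by apply: seg; rewrite ler01.
have vl : lattice (v + w i) by apply: latticeD;
  [exact: vZ|exact: delzant_dual dz vv dw vi].
rewrite scale1r in E1; have vx := prim E _ eE E1 vl.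
have [a aP] := vertex_exposed vx polS.
have w0 : w i != 0.
  by apply/eqP => w0; have := dw1 i i vi vi; rewrite w0 dot0r eqxx => /eqP;
    rewrite eq_sym oner_eq0.
have h1 : dot a (w i) < 0.
  have := aP v (vertex_in vv); rewrite -subr_eq0 opprD addrA subrr sub0r oppr_eq0 => /(_ w0).
  by rewrite dotDr gtrDl.
have h2 : 0 < (t - 1) * dot a (w i).
  have := aP _ (vertex_in vy).
  rewrite -subr_eq0 opprD addrACA subrr add0r -[X in _ - X]scale1r -scalerBl
    scaler_eq0 negb_or w0 subr_eq0 gt_eqF // => /(_ isT).
  rewrite !dotDr dotZr; lra.
by move: h2; rewrite pmulr_rgt0 ?subr_gt0 // ltNge ltW.
Qed.

Lemma primitive_delta J : primitive_delzant S -> cplx J -> (exists i, i \in J) ->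
  delta S (face_of J) (nrm J) = 1.
Proof.
move=> pdz cJ [i iJ]; apply: le_anti; apply/andP; split; last first.
  by apply: delzant_delta_ge1 => //; [case: pdz|exists i].
have [v vv vJ] := cplx_vertex polS SE cJ; have [w dw] := dualS vv.
have [t [E [t0 vy [eE Ev Ey] seg]]] := edge_from polS SE vv dw (vJ i iJ).
have t1 := primitive_edge pdz vv dw (vJ i iJ) eE vy t0 seg.
have fv : face_of J v by split=> //; exact: vertex_in.
have [ny yE] := edge_neighbor SE fv vv dw iJ t0 vy eE Ev Ey.
rewrite -[X in _ <= X]t1 -yE; rewrite -(face_cone_normal SE cJ) in ny *.
exact: neighbor_ge.
Qed.

(** The minimum of any q on the cut is attained at a vertex off the face: at v itself, or at
    [v + w i], a neighbor because edges have parameter 1. No point of the cut can then be separated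
    from the hull. *)
Lemma primitive_flat J : primitive_delzant S -> cplx J -> (exists i, i \in J) ->
  cut S (nrm J) 1 = conv [set v | vertex S v /\ ~ face_of J v].
Proof.
move=> pdz cJ J0; have d1 := primitive_delta pdz cJ J0.
have out z : vertex S z -> ~ face_of J z -> cut S (nrm J) 1 z.
  move=> vz nz; split; first exact: vertex_in.
  rewrite -(face_cone_normal SE cJ) in nz d1.
  by have := delta_le_vertex polS vz nz; rewrite d1 lerBrDl.
have [s [s0 SE' sv]] := polytope_vertices polS.
pose r := [seq z <- s | `[< ~ face_of J z >]].
have rE : [set v | vertex S v /\ ~ face_of J v] = [set` r].
  apply/seteqP; split=> z /=; rewrite mem_filter.
    by move=> [/sv zs nz]; rewrite zs andbT; apply/asboolP.
  by move=> /andP[/asboolP nz /sv].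
rewrite rE; apply/seteqP; split=> x.
  move=> Cx; apply: contrapT => /conv_sep[q qr].
  have qx := cut_face_ge polS SE q cJ J0 ler01 Cx; rewrite mul1r in qx.
  have [v [w [vv dw qv [[nf p0]|[i iJ [fv pE]]]]]] := phi_vertex polS SE dualS q J0.
    have vr : [set` r] v by rewrite -rE.
    have := qr v vr.
    by move: qx; rewrite p0 addr0 -qv leNgt => /negP h /h.
  have [_ vJ] := fv; have vi := vJ i iJ.
  have [t [E [t0 vy [eE Ev Ey] seg]]] := edge_from polS SE vv dw vi.
  have t1 := primitive_edge pdz vv dw vi eE vy t0 seg.
  have [[vy' ny _] _] := edge_neighbor SE fv vv dw iJ t0 vy eE Ev Ey.
  have yr : [set` r] (v + t *: w i) by rewrite -rE.
  by have := qr _ yr; rewrite dotDr dotZr t1 mul1r qv -pE ltNge qx.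
have rS z : z \in r -> cut S (nrm J) 1 z.
  by move=> zr; have : [set` r] z by []; rewrite -rE => -[]; exact: out.
move=> cx; split; last by apply: (conv_ge cx) => z /rS[].
rewrite SE'; apply: conv_seq_sub cx => z /rS[Sz _].
by rewrite -SE'.
Qed.

(** Each [- b i] is a positive integer, so two facets make the sum at least 2 and no facets make it
    0. A single facet is impossible, as [- u i] would be a nonnegative multiple of [u i]. *)
Lemma primitive_offset_sum : primitive_delzant S -> - \sum_i b i != 1.
Proof.
move=> [[_ vZ _] _]; have b1 i : 1 <= - b i.
  have [v vv qv] := supp_vertex (u i) polS.
  have bZ : - b i \is a Num.int.
    rewrite rpredN /foffset -qv lattice_dot //; last exact: vZ.
    by have [] := fnormal_primitive seedS fsP i.
  have bpos : 0 < - b i by rewrite oppr_gt0 foffset_lt0.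
  have [m mE] : exists m : nat, - b i = m%:R by apply/natrP; rewrite natrEint bZ ltW.
  by move: bpos; rewrite mE ltr0n ler1n.
rewrite -sumrN; have [i _|e0] := pickP (predT : pred 'I_(size fs)); last first.
  rewrite big1 => [|i _]; first by rewrite eq_sym oner_neq0.
  by have := e0 i.
have one j : j = i \/ \sum_j - b j != 1.
  have [->|ji] := eqVneq j i; [by left|right].
  rewrite gt_eqF // (bigD1 i) //= (bigD1 j) //= addrA.
  have : 0 <= \sum_(k < size fs | (k != i) && (k != j)) - b k.
    by apply: sumr_ge0 => k _; exact: le_trans ler01 (b1 k).
  by have := b1 i; have := b1 j; lra.
have [//|A1] := boolP (\sum_j - b j != 1).
exfalso; have all_i j : j = i by have [//|] := one j; rewrite (negPf A1).
have [c0 qE _] := coordP polS SE (- u i).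
have ui0 := primitive_neq0 (fnormal_primitive seedS fsP i).
move: qE; rewrite (eq_bigr (fun j => fan_coord polS SE (- u i) j *: u i)); last first.
  by move=> j _; rewrite (all_i j).
rewrite -scaler_suml => /eqP; rewrite -subr_eq0 -opprD oppr_eq0 -{1}[u i]scale1r -scalerDl.
rewrite scaler_eq0 (negPf ui0) orbF gt_eqF //.
by rewrite ltr_pwDl // sumr_ge0.
Qed.

End DelzantSeeds.

(** * Generators of the deformation space *)

Section TruncationGenerators.
Variables (R : realType) (n : nat) (S : set 'rV[R]_n).
Variables (B : set (set 'rV[R]_n)) (PB : set 'rV[R]_n).
Local Notation V := 'rV[R]_n.
Implicit Types (v x y z q : V) (F G : set V).

Hypothesis seedS : seed S.
Hypothesis buildB : building_set S B.

Variable s : seq (set V).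
Hypothesis s_uniq : uniq s.
Hypothesis sB : [set` s] = B.
Hypothesis s_order : forall i j, (i < size s)%N -> (j < size s)%N ->
  nth set0 s i `<` nth set0 s j -> (i < j)%N.
Hypothesis truncS : shallow_truncations S s S PB.

Definition facets_in : seq (set V) := [seq G <- s | `[< facet S G >]].

Local Notation fs := facets_in.

Let sBP F : F \in s <-> B F. Proof. by rewrite -sB. Qed.

Let fs_uniq : uniq fs. Proof. exact: filter_uniq. Qed.

Let fsP G : G \in fs <-> facet S G.
Proof.
rewrite mem_filter; split=> [/andP[/asboolP]//|fG].
apply/andP; split; first exact/asboolP.
by apply/sBP; have [_ + _] := buildB; apply.
Qed.

Let polS : polytope S. Proof. by case: seedS. Qed.
Let SE := seed_halfspaces seedS fsP.
Let dualS := seed_dual seedS fs_uniq fsP.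

Local Notation u := (@fnormal R n S fs).
Local Notation b := (@foffset R n S fs).
Local Notation tight := (tight u b).
Local Notation nrm := (cone_normal u).
Local Notation face_of := (face_of S u b).
Local Notation cplx := (cplx S u b).
Local Notation idx := (@idx R n fs).
Local Notation phi := (phi polS SE).

(** Reversed because each new cut goes to the head of the list in [stage]. Larger faces, hence
    smaller index sets, then come first. *)
Let d := rev (map idx s).

Let BP F : B F -> [/\ F = face_of (idx F), cplx (idx F), exists i,
  i \in idx F & idx F \in d].
Proof.
move=> BF; have [/(_ F BF)[fF FS] _ _] := buildB.
have [FE cF F0] := face_of_idx seedS fsP fF FS.
by split=> //; rewrite mem_rev; apply/map_f/sBP.
Qed.

Let dP J : J \in d -> exists2 F, B F & J = idx F.
Proof. by rewrite mem_rev => /mapP[F /sBP BF ->]; exists F. Qed.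

Let dC J : J \in d -> cplx J.
Proof. by move=> /dP[F /BP[_ ? _ _] ->]. Qed.

Let d0 J : J \in d -> exists i, i \in J.
Proof. by move=> /dP[F /BP[_ _ ? _] ->]. Qed.

Let dface J : J \in d -> B (face_of J).
Proof. by move=> /dP[F BF ->]; have [<-] := BP BF. Qed.

Let d1 i : [set i]%SET \in d.
Proof.
have fi := facet_ofP fsP i; have Bi : B (facet_of i) by have [_ + _] := buildB; apply.
by have [_ _ _] := BP Bi; rewrite (idx_facet seedS fs_uniq fsP).
Qed.

(** The building set axiom in terms of index sets: a common index is a common facet, and the union
    is the intersection of the faces. *)
Let dU J J' : J \in d -> J' \in d -> (exists2 i, i \in J & i \in J') ->
  cplx (J :|: J') -> J :|: J' \in d.
Proof.
move=> Jd J'd [i iJ iJ'] cU.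
have IE : face_of J `&` face_of J' = face_of (J :|: J').
  apply/seteqP; split=> x.
    by move=> [[Sx xJ] [_ xJ']]; split=> // k; rewrite inE => /orP[/xJ|/xJ'].
  by move=> [Sx xU]; split; split=> // k kJ; apply: xU; rewrite inE kJ ?orbT.
have BU : B (face_of (J :|: J')).
  rewrite -IE; have [_ _] := buildB; apply; [exact: dface|exact: dface| |].
    by rewrite IE.
  exists (facet_of i); first exact: (facet_ofP fsP).
  by split=> x [Sx xJ]; apply/(facet_of_tight seedS fsP i Sx); exact: xJ.
by have [_ _ _] := BP BU; rewrite (idx_face_of seedS fs_uniq fsP).
Qed.

Let d_triang : pairwise (fun F J : {set 'I_(size fs)} => ~~ (J \subset F)) d.
Proof.
apply/(pairwiseP finset.set0) => i j; rewrite !inE => ilt jlt ij.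
have sd : size d = size s by rewrite size_rev size_map.
rewrite sd in ilt jlt.
have dn m : (m < size s)%N -> nth finset.set0 d m = idx (nth set0 s (size s - m.+1)).
  move=> ms; rewrite nth_rev ?size_map // (nth_map set0) //.
  by rewrite ltn_subrL /= (leq_ltn_trans _ ms).
rewrite !dn //.
set k := (_ - i.+1)%N; set l := (_ - j.+1)%N.
have ks : (k < size s)%N by rewrite ltn_subrL /= (leq_ltn_trans _ ilt).
have ls : (l < size s)%N by rewrite ltn_subrL /= (leq_ltn_trans _ jlt).
have lk : (l < k)%N by apply: ltn_sub2l => //; exact: leq_ltn_trans ij jlt.
have Bk : B (nth set0 s k) by apply/sBP/mem_nth.
have Bl : B (nth set0 s l) by apply/sBP/mem_nth.
apply/negP => sub; have [kE _ _ _] := BP Bk; have [lE _ _ _] := BP Bl.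
have kl : nth set0 s k `<=` nth set0 s l.
  by rewrite kE lE => x [Sx xk]; split=> // m ml; apply: xk; exact: (fintype.subsetP sub).
have : (k < l)%N.
  apply: s_order => //; split=> // lk'.
  have /eqP : nth set0 s k = nth set0 s l by apply/seteqP.
  rewrite nth_uniq // => /eqP klE.
  by rewrite klE ltnn in lk.
by rewrite ltnNge ltnW.
Qed.

Let stages (l : seq (set V)) d' be P Q : stage S u b d' be P -> (forall F, F \in l ->
  B F) ->
  pairwise (fun F J : {set 'I_(size fs)} => ~~ (J \subset F)) (catrev (map idx l) d') ->
  shallow_truncations S l P Q ->
  exists be', stage S u b (catrev (map idx l) d') be' Q.
Proof.
elim: l d' be P => [|F l IH] d' be P /= st lB tri; first by move=> ->; exists be.
have BF := lB F (mem_head _ _); have [FE cF F0 _] := BP BF.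
rewrite (face_normal_idx fs_uniq fsP) => -[e [sh]]; rewrite FE in sh.
have dF J : J \in d' -> ~~ (J \subset idx F).
  move: tri; rewrite catrevE pairwise_cat /= => /and3P[_ _ /andP[/allP + _]].
  exact.
have [be' st'] : exists be', stage S u b (idx F :: d') be' (cut P (nrm (idx F)) e).
  apply: (stage_step SE st cF F0 dF); move: sh; congr (shallow_cut _ (_ `&` _) _ _).
  by rewrite -FE.
by apply: IH st' _ tri => G Gl; apply: lB; rewrite inE Gl orbT.
Qed.

Let stP : exists be, stage S u b d be PB.
Proof.
have [be] := stages (stage0 u b polS (fun=> 0)) (fun F => (sBP F).1) d_triang truncS.
by rewrite catrevE cats0; exists be.
Qed.

Let polPB : polytope PB. Proof. by have [be []] := stP. Qed.

Let suppS : V -> R^o := supp S.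
Let ph J : V -> R^o := phi J.
Let dl F := delta S F (face_normal S F).

Let ph_PL J : J \in d -> PL (normal_fan PB) (ph J).
Proof. by have [be st] := stP; exact: (phi_PL polS SE dualS st d1 dU). Qed.

Let suppS_PL : PL (normal_fan PB) suppS.
Proof. by have [be st] := stP; exact: (supp_PL polS SE dualS st d1 dU). Qed.

Let dlE F : B F -> dl F = delta S (face_of (idx F)) (nrm (idx F)).
Proof. by move=> /BP[FE _ _ _]; rewrite /dl (face_normal_idx fs_uniq fsP) {1}FE. Qed.

Lemma trunc_delta_gt0 F : B F -> 0 < dl F.
Proof.
by move=> BF; rewrite dlE //; have [_ cF F0 _] := BP BF;
  exact: (delta_face_gt0 polS SE dualS).
Qed.

Lemma supp_Tr F e : B F -> 0 <= e <= dl F ->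
  (supp (Tr e S F) : V -> R^o) = suppS + e *: ph (idx F).
Proof.
move=> BF; rewrite dlE // => eF; have [_ cF F0 _] := BP BF; apply/funext => q.
by rewrite /Tr (face_normal_idx fs_uniq fsP) (supp_cut_face polS SE dualS q cF F0 eF).
Qed.

Let lincomb2_PL (f g : V -> R^o) e : PL (normal_fan PB) f -> PL (normal_fan PB) g ->
  PL (normal_fan PB) (f + e *: g).
Proof.
move=> fP gP; have := @PL_lincomb R n (normal_fan PB) bool [:: true; false]
  (fun t => if t then 1 else e) (fun t => if t then f else g).
rewrite !big_cons big_nil addr0 scale1r; apply=> -[] //.
Qed.

Lemma deformation_Tr F e : B F -> 0 <= e <= dl F -> deformation PB (Tr e S F).
Proof.
move=> BF eF; apply: deformation_PL => //.
  rewrite dlE // in eF; have [_ cF F0 _] := BP BF.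
  by rewrite /Tr (face_normal_idx fs_uniq fsP); exact: (polytope_cut_face polS SE dualS).
have [_ _ _ Fd] := BP BF.
by rewrite supp_Tr //; exact: lincomb2_PL suppS_PL (ph_PL Fd).
Qed.

Lemma deformation_seed : deformation PB S.
Proof. exact: deformation_PL polPB polS suppS_PL. Qed.

Let suppS_ph : suppS = \sum_i b i *: ph [set i]%SET.
Proof. by apply/funext => q; rewrite fct_lincombE; exact: supp_phi. Qed.

Let expand (K : set R) (f : V -> R^o) : K 0 -> (forall a c, K a -> K c -> K (a - c)) ->
  PL (normal_fan PB) f -> (forall J, J \in d -> K (f (nrm J))) ->
  exists la : {set 'I_(size fs)} -> R, (forall J, J \in d -> K (la J)) /\
    f = \sum_(J <- d) la J *: ph J.
Proof.
move=> K0 KB fP fK; have [be st] := stP.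
exact: (PL_expand polS SE dualS st d_triang d1 d0 dC dU K0 KB fP fK).
Qed.

Let free (la : {set 'I_(size fs)} -> R) :
  (forall q, \sum_(J <- d) la J * ph J q = 0) -> forall J, J \in d -> la J = 0.
Proof. exact: (phi_free dualS d_triang d0 dC). Qed.

(** Rewrites a combination over a family as one over the list d, the form to which [free]
    applies. *)
Let regroup (I : finType) (f : I -> {set 'I_(size fs)}) (c : I ->
  R) (g : {set 'I_(size fs)} -> R) :
  (forall i, f i \in d) ->
  \sum_(J <- d) (\sum_(i | f i == J) c i) * g J = \sum_i c i * g (f i).
Proof.
move=> fd; under eq_bigr do rewrite mulr_suml big_mkcond.
rewrite exchange_big; apply: eq_bigr => i _ /=.
rewrite (bigD1_seq (f i)) ?(d_uniq d_triang) //= eqxx big1 ?addr0 //.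
by move=> J; rewrite eq_sym => /negPf ->.
Qed.

Section Span.
Variables (K : set R).
Hypotheses (K1 : K 1) (KB : forall a c, K a -> K c -> K (a - c)).
Hypothesis KM : forall a c, K a -> K c -> K (a * c).

Let K0 : K 0. Proof. by rewrite -(subrr 1); exact: KB. Qed.

(** Each [ph (idx F)] is the difference between the truncation and the seed divided by [e F]; hence
    the inverse of [e F] must lie in K, which over the integers suits e = 1. *)
Lemma span_truncations_seed (e : set V -> R) (la : {set 'I_(size fs)} -> R) :
  (forall F, B F -> [/\ 0 < e F, e F <= dl F & K (e F)^-1]) ->
  (forall J, J \in d -> K (la J)) ->
  span_over K (@supp R n @` ([set Tr (e F) S F | F in B] `|` [set S]))
    (\sum_(J <- d) la J *: ph J).
Proof.
move=> eP laK; set C := (X in span_over K X).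
apply: (span_over_sum K0 KM) => // J /dP[F BF ->].
have [e0 ed eK] := eP F BF.
have -> : ph (idx F) = (e F)^-1 *: ((supp (Tr (e F) S F) : V -> R^o) - suppS).
  by rewrite supp_Tr ?(ltW e0) // addrC addKr scalerA mulVf ?scale1r // gt_eqF.
apply: (span_overZ KM) => //; apply: (span_overB K0 K1 KB KM).
  by apply: (span_over_mem K1); exists (Tr (e F) S F) => //; left; exists F.
by apply: (span_over_mem K1); exists S => //; right.
Qed.

End Span.

Lemma truncations_seed_generate (e : set V -> R) :
  (forall F, B F -> 0 < e F <= dl F) ->
  polytopal_generating_set PB ([set Tr (e F) S F | F in B] `|` [set S]).
Proof.
move=> eP; have e_le F : B F -> 0 <= e F <= dl F.
  by move=> /eP/andP[/ltW -> ->].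
split=> [Q [[F BF <-]|->]|]; [exact/deformation_Tr/e_le|exact: deformation_seed|].
apply/seteqP; split=> [_ [m [c [g [_ gC ->]]]]|f fPL].
  apply: PL_lincomb => i _; have [Q [[F BF <-]|->] <-] := gC i => //.
  rewrite supp_Tr ?e_le //; apply: lincomb2_PL => //.
  by apply: ph_PL; have [_ _ _] := BP BF.
have [//|//|//|la [_ ->]] := expand (K := setT) _ _ fPL.
by apply: span_truncations_seed => // F BF; have /andP[] := eP F BF; split.
Qed.

Let A := - \sum_i b i.

Lemma truncations_basis e : 0 < e -> (forall F, B F -> e <= dl F) -> A != e ->
  polytopal_basis PB [set Tr e S F | F in B].
Proof.
move=> e0 ed Ae; have eP F : B F -> 0 <= e <= dl F by move=> /ed ->; rewrite ltW.
have hE F : B F -> (supp (Tr e S F) : V -> R^o) = suppS + e *: ph (idx F).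
  by move=> BF; rewrite supp_Tr // eP.
split; [by move=> _ [F BF <-]; exact/deformation_Tr/eP|split].
  apply/seteqP; split=> [_ [m [c [g [_ gC ->]]]]|f fPL].
    apply: PL_lincomb => i _; have [_ [F BF <-] <-] := gC i; rewrite hE //.
    by apply: lincomb2_PL => //; apply: ph_PL; have [_ _ _] := BP BF.
  pose C : set (V -> R^o) := (@supp R n) @` [set Tr e S F | F in B].
  have CF F : B F -> span_over setT C (suppS + e *: ph (idx F)).
    by move=> BF; rewrite -hE //; apply: span_over_mem => //; exists (Tr e S F) => //;
      exists F.
  have Cs : span_over setT C suppS.
    have -> : suppS = \sum_i (- b i / (A - e)) *: (suppS + e *: ph (idx (facet_of i))).
      under eq_bigr do rewrite scalerDr.
      rewrite big_split /= -scaler_suml -mulr_suml sumrN -/A.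
      rewrite [X in _ + X](_ : _ = (- e / (A - e)) *: suppS).
        rewrite -scalerDl -mulrDl divff ?scale1r //.
        by rewrite subr_eq0.
      rewrite {1}suppS_ph scaler_sumr; apply: eq_bigr => i _.
      by rewrite (idx_facet seedS fs_uniq fsP) !scalerA; congr (_ *: _); ring.
    apply: span_over_sum => // i _; apply: CF.
    by have [_ + _] := buildB; apply; exact: (facet_ofP fsP).
  have [//|//|//|la [_ ->]] := expand (K := setT) _ _ fPL.
  apply: span_over_sum => // J /dP[F BF ->].
  have -> : ph (idx F) = e^-1 *: ((suppS + e *: ph (idx F)) - suppS).
    by rewrite addrC addKr scalerA mulVf ?scale1r // gt_eqF.
  by apply: span_overZ => //; apply: span_overB => //; exact: CF.
move=> m c g ginj _ gC s0.
have /choice[F FP] : forall k, exists F, B F /\ suppS + e *: ph (idx F) = g k.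
  by move=> k; have [_ [F BF <-] <-] := gC k; exists F; rewrite -hE.
have BFk k : B (F k) by case: (FP k).
have Finj k l : idx (F k) = idx (F l) -> k = l.
  by move=> kl; apply: ginj; have [_ <-] := FP k; have [_ <-] := FP l; rewrite kl.
pose L := \sum_k c k.
(* The coefficient of [ph J] in the given relation, once supp S, which occurs L times, is expanded
   over the facets. *)
pose la J := e * (\sum_(k | idx (F k) == J) c k) + L * \sum_(i | [set i]%SET == J) b i.
have idxd k : idx (F k) \in d by have [_ _ _] := BP (BFk k).
have la_sum (h : {set 'I_(size fs)} -> R) : \sum_(J <- d) la J * h J =
    e * (\sum_k c k * h (idx (F k))) + L * \sum_i b i * h [set i]%SET.
  rewrite -(regroup c h idxd) -(regroup b h d1) !mulr_sumr -big_split /=.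
  by apply: eq_bigr => J _; rewrite /la mulrDl !mulrA.
have la0 J : J \in d -> la J = 0.
  apply: free => q; rewrite la_sum.
  have -> : \sum_i b i * ph [set i]%SET q = suppS q by rewrite suppS_ph fct_lincombE.
  have := congr1 (fun f : V -> R^o => f q) s0; rewrite fct_lincombE /= => sq.
  rewrite -[RHS]sq mulr_suml mulr_sumr -big_split /=; apply: eq_bigr => k _.
  by have [_ <-] := FP k; rewrite mulrDr addrC mulrCA.
(* Adding up all coefficients [la J] gives L (e - A) = 0. *)
have L0 : L = 0.
  have := la_sum (fun=> 1); rewrite big_seq big1 => [|J /la0 ->]; last by rewrite mul0r.
  under eq_bigr do rewrite mulr1.
  under [X in _ + _ * X]eq_bigr do rewrite mulr1.
  rewrite -/L -[\sum_i b i]opprK -/A mulrN mulrC -mulrBr => /esym/eqP.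
  by rewrite mulf_eq0 subr_eq0 [e == A]eq_sym (negPf Ae) orbF => /eqP.
move=> k; have := la0 _ (idxd k); rewrite /la L0 mul0r addr0.
rewrite (bigD1 k) //= big1 ?addr0 => [/eqP|l /andP[/eqP/Finj ->]]; last by rewrite eqxx.
by rewrite mulf_eq0 gt_eqF //= => /eqP.
Qed.

Lemma truncations_small_basis : exists2 e0 : R, 0 < e0 & forall e, 0 < e < e0 ->
  (forall F, B F -> shallow e S F) /\ polytopal_basis PB [set Tr e S F | F in B].
Proof.
have [t0 t0_gt0 tP] : exists2 t0, 0 < t0 & forall t, 0 < t <= t0 ->
  forall F, F \in s -> t < dl F.
  apply: seq_small => F /sBP/trunc_delta_gt0 dF; exists (dl F / 2); first exact: divr_gt0.
  by move=> t /andP[_ tF]; move: dF tF; lra.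
(* Staying below A when A is positive excludes e = A; otherwise e > 0 already does. *)
exists (Num.min t0 (if 0 < A then A else 1)).
  by rewrite lt_min t0_gt0; case: ifP => [->|_]; rewrite ?ltr01.
move=> e /andP[e0]; rewrite lt_min => /andP[et eA].
have ed F : B F -> e < dl F by move=> /sBP; apply: tP; rewrite e0 ltW.
split=> [F /ed eF|]; first by rewrite /shallow /shallow_cut e0.
apply: truncations_basis => // [F /ed/ltW //|].
case: ifP eA => [_ /gt_eqF -> //|/negbT A0 _].
by apply: contraNneq A0 => ->.
Qed.

Lemma deep_truncations_generate :
  polytopal_generating_set PB ([set DTr S F | F in B] `|` [set S]).
Proof.
by apply: (@truncations_seed_generate dl) => F /trunc_delta_gt0 ->; rewrite lexx.
Qed.

Let integers1 : integers (1 : R). Proof. exact: rpred1. Qed.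

Let integersB (a c : R) : integers a -> integers c -> integers (a - c).
Proof. exact: rpredB. Qed.

Let integersM (a c : R) : integers a -> integers c -> integers (a * c).
Proof. exact: rpredM. Qed.

Lemma delzant_delta F : delzant S -> B F -> 1 <= dl F.
Proof.
move=> dz BF; rewrite dlE //; have [_ cF F0 _] := BP BF.
exact: (delzant_delta_ge1 seedS fs_uniq fsP).
Qed.

Lemma unit_truncations_integral : delzant S ->
  integral_polytopal_generating_set PB ([set Tr 1 S F | F in B] `|` [set S]).
Proof.
move=> dz; have d1' F : B F -> 0 < (1 : R) <= dl F by move=> BF;
  rewrite ltr01 delzant_delta.
split; first exact: (truncations_seed_generate (e := fun=> 1)).
have [_ vZ _] := dz; have [be st] := stP.
have hZ : PLZ (normal_fan PB) suppS by exact: (supp_PLZ polS SE dualS st d1 dU vZ).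
have pZ J : J \in d -> PLZ (normal_fan PB) (ph J).
  apply: (phi_PLZ polS SE dualS st d1 dU) => v w i.
  exact: (delzant_dual seedS fsP dz).
apply/seteqP; split=> [_ [m [c [g [cZ gC ->]]]]|f fPL].
  apply: PLZ_lincomb => i _; first exact: cZ.
  have [Q [[F BF <-]|->] <-] := gC i => //.
  rewrite supp_Tr ?ler01 ?delzant_delta //.
  have := @PLZ_lincomb R n (normal_fan PB) bool [:: true; false]
    (fun=> 1) (fun t => if t then suppS else ph (idx F)).
  rewrite !big_cons big_nil addr0 scale1r; apply=> -[] // _; rewrite ?rpred1 //.
  by apply: pZ; have [_ _ _] := BP BF.
have [|||la [laZ ->]] := expand (K := @integers R) _ _ (PLZ_PL fPL).
- exact: rpred0.
- exact: integersB.
(* The value of f at [nrm J] is the product of two lattice vectors, so the triangular system has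
   integral data. *)
- move=> J Jd; have [F BF JF] := dP Jd.
  have [x0 fx0] := face_at_nonempty (nrm J) polPB.
  have NK : normal_fan PB (normal_cone PB (face_at PB (nrm J))).
    by exists (face_at PB (nrm J)) => //; exists (nrm J).
  have [x xl xE] := fPL _ NK; rewrite xE => [|y []] //.
  apply: lattice_dot => //; apply: lattice_sum => i _.
  by have [] := fnormal_primitive seedS fsP i.
apply: (span_truncations_seed integers1 integersB integersM (e := fun=> 1)) => // F BF.
by rewrite ltr01 invr1 delzant_delta.
Qed.

Lemma primitive_DTr F : primitive_delzant S -> B F -> dl F = 1.
Proof.
move=> pdz BF; rewrite dlE //; have [_ cF F0 _] := BP BF.
exact: (primitive_delta seedS fs_uniq fsP).
Qed.

Lemma primitive_flat_basis : primitive_delzant S ->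
  [/\ [set DTr S F | F in B] = [set Tr 1 S F | F in B],
      forall F, B F -> flat S F & polytopal_basis PB [set DTr S F | F in B]].
Proof.
move=> pdz; have DE F : B F -> DTr S F = Tr 1 S F.
  by move=> BF; rewrite /DTr -[delta _ _ _]/(dl F) primitive_DTr.
have E : [set DTr S F | F in B] = [set Tr 1 S F | F in B].
  by apply/seteqP; split=> _ [F BF <-]; exists F => //; rewrite DE.
split=> // [F BF|].
  rewrite /flat DE // /Tr (face_normal_idx fs_uniq fsP); have [FE cF F0 _] := BP BF.
  by rewrite {2}FE; exact: (primitive_flat seedS fs_uniq fsP).
rewrite E; apply: truncations_basis => //.
  by move=> F BF; rewrite primitive_DTr.
exact: (primitive_offset_sum seedS fsP).
Qed.

(* Writing the support function of S as an integral combination of those of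
   the truncations and comparing coefficients forces the sum m of the
   coefficients to satisfy the equation below. *)
Lemma primitive_not_integral : primitive_delzant S ->
  (forall m : R, m \is a Num.int ->
     m * (\sum_(G <- fs) - supp S (facet_normal S G) - 1) !=
     \sum_(G <- fs) - supp S (facet_normal S G)) ->
  ~ integral_polytopal_generating_set PB [set DTr S F | F in B].
Proof.
move=> pdz noint [_ span].
have AE : \sum_(G <- fs) - supp S (facet_normal S G) = A.
  by rewrite (big_nth set0) big_mkord sumrN.
rewrite AE in noint; have [dz _] := pdz; have [DE _ _] := primitive_flat_basis pdz.
have : PLZ (normal_fan PB) suppS.
  have [_ <-] := unit_truncations_integral dz.
  by apply: (span_over_mem integers1); exists S => //; right.
rewrite -span DE => -[m [c [g [cZ gC sE]]]].
have /choice[F FP] : forall k, exists F, B F /\ suppS + ph (idx F) = g k.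
  move=> k; have [_ [F BF <-] <-] := gC k; exists F.
  by rewrite supp_Tr ?scale1r // ler01 delzant_delta.
pose L := \sum_k c k.
have idxd k : idx (F k) \in d by have [BFk _] := FP k; have [_ _ _] := BP BFk.
(* The factor is [L - 1] because the expanded supp S is moved to the side of the combination. The
   sum of all coefficients then gives L (A - 1) = A. *)
pose la J := \sum_(k | idx (F k) == J) c k + (L - 1) * \sum_(i | [set i]%SET == J) b i.
have la_sum (h : {set 'I_(size fs)} -> R) : \sum_(J <- d) la J * h J =
    \sum_k c k * h (idx (F k)) + (L - 1) * \sum_i b i * h [set i]%SET.
  rewrite -(regroup c h idxd) -(regroup b h d1) !mulr_sumr -big_split /=.
  by apply: eq_bigr => J _; rewrite /la mulrDl !mulrA.
have la0 J : J \in d -> la J = 0.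
  apply: free => q; rewrite la_sum.
  have -> : \sum_i b i * ph [set i]%SET q = suppS q by rewrite suppS_ph fct_lincombE.
  have := congr1 (fun f : V -> R^o => f q) sE; rewrite fct_lincombE.
  rewrite (eq_bigr (fun k => c k * suppS q + c k * ph (idx (F k)) q)) => [|k _];
    last first.
    by have [_ <-] := FP k; rewrite -mulrDr.
  rewrite big_split /= -mulr_suml -/L => sq.
  by rewrite mulrBl mul1r {2}sq; ring.
have : \sum_(J <- d) la J * 1 = 0 by rewrite big_seq big1 // => J /la0 ->; rewrite mul0r.
rewrite la_sum; under eq_bigr do rewrite mulr1.
under [X in _ + _ * X]eq_bigr do rewrite mulr1.
rewrite -/L -[\sum_i b i]opprK -/A => LA.
have LZ : L \is a Num.int by apply: rpred_sum => k _; exact: cZ.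
have /eqP := noint L LZ; apply; move: LA; lra.
Qed.

End TruncationGenerators.

(** * Truncation along the facets *)

Lemma int_mul_nat1 (R : realType) (m : R) (k : nat) :
  m \is a Num.int -> m * k%:R = 1 -> k = 1%N.
Proof.
move=> mZ mk; have m0 : m != 0.
  by apply: contraTneq (oner_neq0 R) => m0; rewrite -mk m0 mul0r negbK.
have m1 : 1 <= `|m| by rewrite norm_intr_ge1.
have : `|m| * k%:R = 1 by rewrite -(normr_nat R k) -normrM mk normr1.
case: k mk => [|[|k]] // mk; first by rewrite mulr0 => /eqP; rewrite eq_sym oner_eq0.
have k2 : 2 <= k.+2%:R :> R by rewrite ler_nat.
move=> e; suff : (2 : R) <= 1 by rewrite (ler_nat R 2 1).
by rewrite -[X in _ <= X]e; apply: le_trans k2 _; rewrite ler_peMl ?ler0n.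
Qed.

Section FacetTruncations.
Variables (R : realType) (n : nat) (S : set 'rV[R]_n).
Local Notation V := 'rV[R]_n.
Implicit Types (v x y z q : V) (F G : set V).

Hypothesis seedS : seed S.
Variable fs : seq (set V).
Hypothesis fs_uniq : uniq fs.
Hypothesis fsP : forall G, G \in fs <-> facet S G.

Let polS : polytope S. Proof. by case: seedS. Qed.
Let i0 : interior S 0. Proof. by case: seedS. Qed.
Let SE := seed_halfspaces seedS fsP.
Let dualS := seed_dual seedS fs_uniq fsP.

Local Notation u := (@fnormal R n S fs).
Local Notation b := (@foffset R n S fs).
Local Notation tight := (tight u b).
Local Notation nrm := (cone_normal u).

(** A test for the hexagon. An integral [w i] is primitive because it pairs to 1 with [u i], so the
    edge directions are exactly the dual basis. *)
Lemma delzant_of_dual : (forall v, vertex S v -> lattice v) ->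
  (forall v w i, vertex S v -> dual_basis u b v w -> tight v i -> lattice (w i)) ->
  delzant S.
Proof.
move=> vZ wZ; split=> // [|v vv]; first by case: seedS.
have [w dw] := dualS vv; have [dw1 dw2] := dw.
have ul i : lattice (u i) by have [] := fnormal_primitive seedS fsP i.
have DE d : edge_directions S v d <-> exists2 i, tight v i & d = w i.
  split=> [[pd [E [t [eE Ev t0 Ed]]]]|[i vi ->]].
    have [i [vi [k k0 dE]]] := edge_direction seedS fsP vv dw eE Ev t0 Ed (primitive_neq0 pd).
    exists i => //; have kE : dot (u i) d = k by rewrite dE dotZr dw1 // eqxx mulr1.
    have kZ : k \is a Num.int by rewrite -kE lattice_dot //; case: pd.
    have [kk kkE] : exists kk : nat, k = kk%:R by apply/natrP; rewrite natrEint kZ ltW.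
    have [_ /(_ kk (w i) (wZ v w i vv dw vi))] := pd.
    by rewrite dE kkE scaler_nat => /(_ erefl) ->.
  split; last first.
    have [t [E [t0 vy [eE Ev Ey] _]]] := edge_from polS SE vv dw vi.
    by exists E, t.
  split=> [|k w' w'l wE]; first exact: wZ vv dw vi.
  apply: (@int_mul_nat1 R (dot (u i) w')); first exact: lattice_dot.
  by rewrite mulrC -dotZr scaler_nat -wE dw1 // eqxx.
split.
  apply/seteqP; split=> [_ [m [c [g [cZ gD ->]]]]|x xl].
    apply: lattice_sum => k _; rewrite -[_ *: _]addr0.
    by apply: lattice_lincomb; [exact: cZ|case: (gD k) => -[]|exact: lattice0].
  rewrite (dw2 x) -big_enum; apply: span_over_sum => [||i|i].
  - exact: rpred0.
  - by move=> a c; exact: rpredM.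
  - by move=> _; exact: lattice_dot.
  - rewrite mem_enum => vi; apply: span_over_mem; first exact: rpred1.
    by apply/DE; exists i.
move=> m c g ginj _ gD s0 k; have [i vi gk] := (DE _).1 (gD k).
have := congr1 (dot (u i)) s0; rewrite dot0r dot_sumr (bigD1 k) //= dotZr gk dw1 // eqxx mulr1.
rewrite big1 ?addr0 // => l lk; have [j vj gl] := (DE _).1 (gD l).
rewrite dotZr gl dw1 //; case: eqP => [ij|]; last by rewrite mulr0.
by move: lk; rewrite (ginj l k) ?eqxx // gl gk ij.
Qed.

(** A vertex of the facet is moved slightly along the sum of its edge directions inside the
    facet. *)
Lemma facet_interior_point i :
  exists x, [/\ S x, tight x i & forall j, j != i -> b j < dot (u j) x].
Proof.
have [v vv vi] := cplx_vertex polS SE (cplx1 seedS fsP i).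
have {}vi : tight v i by apply: vi; rewrite inE.
have [w [dw1 dw2]] := dualS vv; have Sv := vertex_in vv.
pose p := \sum_(j | tight v j && (j != i)) w j.
have up j : tight v j -> dot (u j) p = (j != i)%:R.
  move=> vj; rewrite dot_sumr; have [->|ji] := eqVneq j i.
    by apply: big1 => k /andP[vk ki]; rewrite dw1 // eq_sym (negPf ki).
  rewrite (bigD1 j) ?vj //= dw1 // eqxx big1 ?addr0 // => k /andP[/andP[vk _] kj].
  by rewrite dw1 // eq_sym (negPf kj).
have [t0 t0_gt0 t0P] : exists2 t0, 0 < t0 & forall t, 0 < t <= t0 ->
    forall j, j \in enum 'I_(size fs) -> j != i -> b j < dot (u j) v + t * dot (u j) p.
  apply: seq_small => j _; have /SE/(_ j) := Sv.
  rewrite le_eqVlt => /orP[/eqP vj|].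
    exists 1 => // t /andP[t_gt0 _] ji; rewrite -vj up ?/tight ?vj ?eqxx // ji mulr1.
    by rewrite ltrDl.
  rewrite -subr_gt0 => /(linear_small (dot (u j) p))[t0 t0_gt0 tP].
  by exists t0 => // t /tP + _; lra.
have xj j : j != i -> b j < dot (u j) (v + t0 *: p).
  by move=> ji; rewrite dotDr dotZr t0P ?mem_enum // t0_gt0 lexx.
have xi : tight (v + t0 *: p) i.
  by rewrite /tight dotDr dotZr up // eqxx mulr0 addr0; exact: vi.
exists (v + t0 *: p); split=> //; apply/SE => j.
by have [->|/xj/ltW//] := eqVneq j i; rewrite (eqP xi).
Qed.

Lemma facet_sub_eq F G : facet S F -> facet S G -> F `<=` G -> F = G.
Proof.
move=> /(facet_ofE fsP)[i <-] /(facet_ofE fsP)[j <-] ij.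
have [x [Sx xi xj]] := facet_interior_point i.
have : tight x j.
  by apply/(facet_of_tight seedS fsP j Sx)/ij/(facet_of_tight seedS fsP i Sx).
have [->//|/xj] := eqVneq j i.
by rewrite lt_neqAle eq_sym => /andP[/negPf xj0 _]; rewrite /tight xj0.
Qed.

Lemma facets_building_set : building_set S (facet S).
Proof.
split=> [F fF|//|F G fF fG _ [H fH [FH GH]]].
  by split; [case: fF|exact: facet_neq].
by rewrite (facet_sub_eq fF fH FH) (facet_sub_eq fG fH GH) setIid.
Qed.

Lemma face_normal_facet i : face_normal S (facet_of i) = u i.
Proof.
rewrite (face_normal_idx fs_uniq fsP) (idx_facet seedS fs_uniq fsP).
by rewrite /cone_normal big_set1.
Qed.

(** The induction keeps 0 and one relative interior point of each facet not yet cut: the latter keep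
    those facets present, and 0, off every facet, makes [delta] positive. *)
Lemma facets_truncation : exists Q, B_truncation S (facet S) Q.
Proof.
have /choice[x xP] := facet_interior_point.
have S0 : S 0 by have [t _] := interior_scale 0 i0; rewrite scaler0.
suff H l P : uniq l -> polytope P -> P `<=` S -> P 0 -> (forall i, i \in l -> P (x i)) ->
    exists Q, shallow_truncations S [seq facet_of i | i <- l] P Q.
  have [|Q QP] := H (enum 'I_(size fs)) S (enum_uniq _) polS (@subset_refl _ S) S0.
    by move=> i _; have [] := xP i.
  have sE : [seq facet_of i | i <- enum 'I_(size fs)] = fs.
    by rewrite -[RHS](mkseq_nth set0) /mkseq -val_enum_ord -map_comp.
  rewrite sE in QP; exists Q, fs; split=> // [|i j is' js [ij ji]].
    by apply/seteqP; split=> G /= /fsP.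
  by case: ji; rewrite (facet_sub_eq _ _ ij) //; apply/fsP; exact: mem_nth.
elim: l P => [|i l IH] P; first by exists P.
move=> /= /andP[il lu] polP PS P0 lP.
have [Sxi xii _] := xP i; have Pxi : P (x i) by apply: lP; rewrite mem_head.
have sP : supp P (u i) = b i.
  rewrite (supp_eq Pxi) (eqP xii) // => y /PS Sy; exact: supp_le.
have fP : facet_of i `&` P = face_at P (u i).
  apply/seteqP; split=> y.
    by move=> [fy Py]; split=> //; rewrite sP; apply/eqP/(facet_of_tight seedS fsP i (PS y Py)).
  move=> [Py]; rewrite sP => yi; split=> //.
  by apply/(facet_of_tight seedS fsP i (PS y Py))/eqP.
have b0 : b i < 0 by exact: (foffset_lt0 seedS fsP).
have dpos : 0 < delta P (face_at P (u i)) (u i).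
  apply: delta_gt0 => //; exists 0 => // -[_]; rewrite dot0r sP => e.
  by rewrite -e ltxx in b0.
have [t0 t0_gt0 tP] : exists2 t0, 0 < t0 & forall t, 0 < t <= t0 -> forall j, j \in l ->
    b i + t <= dot (u i) (x j).
  apply: seq_small => j jl; have [_ _ /(_ i)] := xP j.
  have ij : i != j by apply: contraNneq il => ->.
  rewrite ij => /(_ isT); rewrite -subr_gt0 => lt.
  by exists (dot (u i) (x j) - b i) => // t /andP[_]; lra.
(* The three bounds make the cut shallow, keep the chosen points of the remaining facets, and keep
   0. *)
pose e := Num.min (delta P (face_at P (u i)) (u i) / 2) (Num.min t0 (- b i)).
have e0 : 0 < e by rewrite !lt_min divr_gt0 // t0_gt0 oppr_gt0.
have ed : e < delta P (face_at P (u i)) (u i).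
  have : e <= delta P (face_at P (u i)) (u i) / 2 by rewrite /e ge_min lexx.
  by move: dpos; lra.
have et : e <= t0 by rewrite /e !ge_min lexx orbT.
have eb : e <= - b i by rewrite /e !ge_min lexx !orbT.
have C0 : cut P (u i) e 0 by split=> //; rewrite sP dot0r; move: eb; lra.
have polC : polytope (cut P (u i) e) by apply: polytope_cut => //; exists 0.
have CS : cut P (u i) e `<=` S by move=> y [/PS].
have lC j : j \in l -> cut P (u i) e (x j).
  move=> jl; split; first by apply: lP; rewrite inE jl orbT.
  by rewrite sP; apply: tP; rewrite ?e0.
have [Q QP] := IH _ lu polC CS C0 lC.
by exists Q, e; rewrite face_normal_facet fP /shallow_cut e0.
Qed.

End FacetTruncations.

(** * The hexagon *)

Section Hexagon.
Variable R : realType.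

(** The vertices are the roots of type A2 in a basis of simple roots, in cyclic order. Integer
    tables let incidences be decided by computation. *)
Definition hex_vertex_x (j : nat) : int := nth 0 [:: 1; 1; 0; -1; -1; 0] j.
Definition hex_vertex_y (j : nat) : int := nth 0 [:: 0; 1; 1; 0; -1; -1] j.
Definition hex_normal_x (j : nat) : int := nth 0 [:: -1; 0; 1; 1; 0; -1] j.
Definition hex_normal_y (j : nat) : int := nth 0 [:: 0; -1; -1; 0; 1; 1] j.
Definition hex_next (j : nat) : nat := nth 0 [:: 1; 2; 3; 4; 5; 0]%N j.

(** Over any ring, since rationality of the facets asks for the same normals with rational
    entries. *)
Definition int_vec (K : nzRingType) (a b : int) : 'rV[K]_2 :=
  \row_(k < 2) (if k == 0 then a else b)%:~R.

(* The edge [j] joins the vertices [j] and [hex_next j]. *)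
Definition hex_vertex (j : nat) : 'rV[R]_2 := int_vec R (hex_vertex_x j) (hex_vertex_y j).
Definition hex_normal (j : nat) : 'rV[R]_2 := int_vec R (hex_normal_x j) (hex_normal_y j).
Definition hexagon : set 'rV[R]_2 := conv [set` [seq hex_vertex j | j <- iota 0 6]].
Definition hex_edge (j : nat) : set 'rV[R]_2 := face_at hexagon (hex_normal j).

Local Notation nx := hex_next.
Local Notation vv := hex_vertex.
Local Notation nn := hex_normal.

Lemma int_vec_lattice a b : lattice (int_vec R a b).
Proof. by apply/mxOverP => i k; rewrite mxE intr_int. Qed.

Lemma dot_int_vec a b x : dot (int_vec R a b) x = a%:~R * x 0 0 + b%:~R * x 0 1.
Proof.
by rewrite dotE big_ord_recl big_ord1 !mxE /=; congr (_ + _ * x 0 _); apply: val_inj.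
Qed.

Lemma dot_int_vec2 a b c d :
  dot (int_vec R a b) (int_vec R c d) = (a * c + b * d)%:~R.
Proof. by rewrite dot_int_vec !mxE /= rmorphD !rmorphM. Qed.

Lemma hex_next_lt j : (j < 6)%N -> (nx j < 6)%N.
Proof. by case: j => [|[|[|[|[|[|]]]]]]. Qed.

Lemma hex_next_surj j : (j < 6)%N -> exists2 k, (k < 6)%N & nx k = j.
Proof.
case: j => [|[|[|[|[|[|//]]]]]] _; [by exists 5%N|by exists 0%N|by exists 1%N|
  by exists 2%N|by exists 3%N|by exists 4%N].
Qed.

Lemma hex_normal_vertex_ge j k : (j < 6)%N -> (k < 6)%N -> -1 <= dot (nn j) (vv k).
Proof.
move=> j6 k6; rewrite dot_int_vec2 -(mulrN1z (1 : R)) ler_int.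
by case: j j6 => [|[|[|[|[|[|//]]]]]] _; case: k k6 => [|[|[|[|[|[|//]]]]]].
Qed.

Lemma hex_normal_vertex_eq j k : (j < 6)%N -> (k < 6)%N ->
  (dot (nn j) (vv k) == -1) = (k == j) || (k == nx j).
Proof.
move=> j6 k6; rewrite dot_int_vec2 -(mulrN1z (1 : R)) eqr_int.
by case: j j6 => [|[|[|[|[|[|//]]]]]] _; case: k k6 => [|[|[|[|[|[|//]]]]]].
Qed.

(** The two edge vectors at the vertex [nx j] are dual to the two normals there. *)
Lemma hex_basis j x : (j < 6)%N ->
  x = dot (nn j) x *: (vv (nx (nx j)) - vv (nx j)) + dot (nn (nx j)) x *: (vv j - vv (nx j)).
Proof.
move=> j6; apply/rowP; rewrite !dot_int_vec => k.
have [->|->] : k = 0 \/ k = 1 by case: k => -[|[|//]] p; [left|right]; apply: val_inj.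
  by rewrite !mxE /=; case: j j6 => [|[|[|[|[|[|//]]]]]] _ /=;
    rewrite /hex_vertex_x /hex_normal_x /hex_normal_y /=; ring.
by rewrite !mxE /=; case: j j6 => [|[|[|[|[|[|//]]]]]] _ /=;
  rewrite /hex_vertex_y /hex_normal_x /hex_normal_y /=; ring.
Qed.

Lemma hex_mem_vertex k : (k < 6)%N -> hexagon (vv k).
Proof. by move=> k6; apply: mem_conv; apply: map_f; rewrite mem_iota. Qed.

Lemma hex_polytope : polytope hexagon.
Proof. by exists [seq hex_vertex j | j <- iota 0 6]. Qed.

Lemma hex_ge j x : (j < 6)%N -> hexagon x -> -1 <= dot (nn j) x.
Proof.
move=> j6 /conv_ge; apply=> _ /mapP[k + ->].
by rewrite mem_iota => k6; exact: hex_normal_vertex_ge.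
Qed.

Lemma hex_dot1 j : (j < 6)%N -> dot (nn j) (vv j) = -1.
Proof. by move=> j6; apply/eqP; rewrite hex_normal_vertex_eq // eqxx. Qed.

Lemma hex_dot2 j : (j < 6)%N -> dot (nn j) (vv (nx j)) = -1.
Proof.
by move=> j6; apply/eqP; rewrite hex_normal_vertex_eq ?hex_next_lt // eqxx orbT.
Qed.

Lemma supp_hex j : (j < 6)%N -> supp hexagon (nn j) = -1.
Proof.
move=> j6; rewrite (supp_eq (hex_mem_vertex j6)) hex_dot1 // => x Hx.
exact: hex_ge.
Qed.

Lemma hex_edgeP j x : (j < 6)%N -> hex_edge j x <-> hexagon x /\ dot (nn j) x = -1.
Proof. by move=> j6; rewrite /hex_edge /face_at supp_hex. Qed.

Lemma hex_dual j q : (j < 6)%N -> q = dot q (vv (nx (nx j)) - vv (nx j)) *: nn j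
    + dot q (vv j - vv (nx j)) *: nn (nx j).
Proof.
move=> j6; apply: dot_inj => x.
have := congr1 (dot q) (hex_basis x j6); rewrite [X in _ = X]dotDr !dotZr => ->.
by rewrite dotDl !dotZl; congr (_ + _); rewrite mulrC.
Qed.

(* A sector containing q is found at a vertex minimizing q. *)
Lemma hex_cone q : exists j c c',
  [/\ (j < 6)%N, 0 <= c, 0 <= c' & q = c *: nn j + c' *: nn (nx j)].
Proof.
have [//|k + kmin] := @seq_argmin R nat (fun k => dot q (vv k)) (iota 0 6).
rewrite mem_iota => /hex_next_surj[j j6 jk].
exists j, (dot q (vv (nx (nx j)) - vv (nx j))), (dot q (vv j - vv (nx j))).
split; [by []| | |exact: hex_dual]; rewrite dotBr subr_ge0 jk kmin // mem_iota //.
by rewrite add0n /= hex_next_lt // -jk hex_next_lt.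
Qed.

(** The cases correspond to the dimension of the exposed face: the hexagon, an edge, a vertex. *)
Lemma hex_cases q : [\/ q = 0,
  exists j c, [/\ (j < 6)%N, 0 < c & q = c *: nn j] |
  exists j c c', [/\ (j < 6)%N, 0 < c, 0 < c' & q = c *: nn j + c' *: nn (nx j)]].
Proof.
have [j [c [c' [j6 c0 c'0 qE]]]] := hex_cone q.
move: c0 c'0; rewrite !le_eqVlt => /predU1P[c0|c0] /predU1P[c'0|c'0].
- by apply: Or31; rewrite qE -c0 -c'0 !scale0r addr0.
- by apply: Or32; exists (nx j), c'; rewrite hex_next_lt // qE -c0 scale0r add0r.
- by apply: Or32; exists j, c; rewrite qE -c'0 scale0r addr0.
- by apply: Or33; exists j, c, c'.
Qed.

Lemma hex_halfspaces x : (forall j, (j < 6)%N -> -1 <= dot (nn j) x) -> hexagon x.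
Proof.
move=> H; apply: contrapT => /conv_sep[q qs].
have [j [c [c' [j6 c0 c'0 qE]]]] := hex_cone q.
have nj6 := hex_next_lt j6.
have := qs (vv (nx j)) (map_f _ _); rewrite mem_iota nj6 => /(_ isT).
rewrite qE !dotDl !dotZl hex_dot2 // hex_dot1 //.
have := ler_wpM2l c0 (H j j6); have := ler_wpM2l c'0 (H _ nj6); lra.
Qed.

Lemma hex_interior : interior hexagon 0.
Proof.
apply/nbhs_ballP; exists (2^-1) => /=; first by rewrite invr_gt0.
move=> x [_ xb]; have x0 := xb 0 0; have x1 := xb 0 1.
rewrite /ball /= !mxE !sub0r !normrN in x0 x1.
move: x0 x1; rewrite !ltr_norml => /andP[a1 a2] /andP[b1 b2].
apply: hex_halfspaces => j; rewrite dot_int_vec.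
by case: j => [|[|[|[|[|[|//]]]]]] _; rewrite /hex_normal_x /hex_normal_y /=; lra.
Qed.

Lemma hex_dot_prev j : (j < 6)%N -> dot (nn (nx j)) (vv j) = 0.
Proof.
move=> j6; rewrite dot_int_vec2.
by case: j j6 => [|[|[|[|[|[|//]]]]]].
Qed.

Lemma hex_normalD j : (j < 6)%N -> nn j + nn (nx (nx j)) = nn (nx j).
Proof.
move=> j6; apply/rowP => k; rewrite !mxE -rmorphD; congr (_%:~R).
by case: j j6 => [|[|[|[|[|[|//]]]]]] _; case: (k == 0).
Qed.

Lemma hex_vertex_next j : (j < 6)%N -> vv j - vv (nx j) != 0.
Proof.
move=> j6; apply/eqP => e; have := congr1 (dot (nn (nx j))) e.
rewrite dotBr hex_dot_prev // hex_dot1 ?hex_next_lt // dot0r sub0r opprK => /eqP.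
by rewrite oner_eq0.
Qed.

Lemma hex_vertex_face j c c' : (j < 6)%N -> 0 < c -> 0 < c' ->
  face_at hexagon (c *: nn j + c' *: nn (nx j)) = [set vv (nx j)].
Proof.
move=> j6 c0 c'0; have nj6 := hex_next_lt j6; have Hv := hex_mem_vertex nj6.
have ge x : hexagon x -> c * -1 <= c * dot (nn j) x /\ c' * -1 <= c' * dot (nn (nx j)) x.
  by move=> Hx; rewrite !ler_pM2l // !hex_ge.
have sE : supp hexagon (c *: nn j + c' *: nn (nx j)) = c * -1 + c' * -1.
  have vE : dot (c *: nn j + c' *: nn (nx j)) (vv (nx j)) = c * -1 + c' * -1.
    by rewrite dotDl !dotZl hex_dot2 // hex_dot1.
  rewrite -vE; apply: (supp_eq Hv) => x /ge[h1 h2]; rewrite vE dotDl !dotZl.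
  exact: lerD.
rewrite /face_at sE; apply/seteqP; split=> [x [Hx]|_ ->]; last first.
  by split=> //; rewrite dotDl !dotZl hex_dot2 // hex_dot1.
rewrite dotDl !dotZl => e; have [h1 h2] := ge x Hx.
have e1 : c * dot (nn j) x = c * -1 by lra.
have e2 : c' * dot (nn (nx j)) x = c' * -1 by lra.
rewrite /= (hex_basis x j6) [RHS](hex_basis _ j6) hex_dot2 // hex_dot1 //.
by rewrite (mulfI (lt0r_neq0 c0) e1) (mulfI (lt0r_neq0 c'0) e2).
Qed.

Lemma hex_vertex_vertex j : (j < 6)%N -> vertex hexagon (vv j).
Proof.
move=> /hex_next_surj[k k6 <-]; exists (1 *: nn k + 1 *: nn (nx k)).
by rewrite hex_vertex_face.
Qed.

Lemma hex_edge_scale j c : 0 < c -> face_at hexagon (c *: nn j) = hex_edge j.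
Proof. by move=> c0; rewrite face_atZ //; exact: hex_polytope. Qed.

Lemma hex_edge_ends j : (j < 6)%N -> hex_edge j (vv j) /\ hex_edge j (vv (nx j)).
Proof.
move=> j6; have nj6 := hex_next_lt j6.
by split; apply/(hex_edgeP _ j6); split; rewrite ?hex_dot1 ?hex_dot2 //;
  exact: hex_mem_vertex.
Qed.

Lemma hex_edge_dim j : (j < 6)%N -> has_dim (hex_edge j) 1.
Proof.
move=> j6; have nj6 := hex_next_lt j6; have [Ev Env] := hex_edge_ends j6.
exists (vv j), <[vv j - vv (nx j)]>%VS; split=> //.
- by rewrite dim_vline hex_vertex_next.
- move=> y /(hex_edgeP _ j6)[_ ny]; rewrite (hex_basis (y - vv j) j6).
  rewrite [dot (nn j) _]dotBr ny hex_dot1 // subrr scale0r add0r.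
  by rewrite memvZ // memv_line.
- by move=> W /(_ _ Env); rewrite -memvN opprB -memvE.
Qed.

Lemma has_dim1 (v : 'rV[R]_2) : has_dim [set v] 0.
Proof.
exists v, 0%VS; split=> [//||y ->|W _]; rewrite ?dimv0 ?subrr ?mem0v //.
exact: sub0v.
Qed.

Lemma hex_dim : has_dim hexagon 2.
Proof. exact: interior_full_dimensional hex_interior. Qed.

Lemma face_at0 (P : set 'rV[R]_2) : polytope P -> face_at P 0 = P.
Proof.
move=> polP; apply/seteqP; split=> [x []//|x Px]; split=> //.
by rewrite (supp_eq Px) // => y _; rewrite !dot0l.
Qed.

Lemma hex_face1 G : face hexagon G -> has_dim G 1 -> exists2 j,
  (j < 6)%N & G = hex_edge j.
Proof.
move=> [q ->]; case: (hex_cases q) => [->|[j [c [j6 c0 ->]]] _|[j [c [c' [j6 c0 c'0 ->]]]]].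
- rewrite (face_at0 hex_polytope) => d1.
  by have := has_dim_uniq hex_dim d1.
- by exists j; rewrite // hex_edge_scale.
- rewrite hex_vertex_face // => d1.
  by have := has_dim_uniq (has_dim1 _) d1.
Qed.

Lemma hex_facetP G : facet hexagon G <-> exists2 j, (j < 6)%N & G = hex_edge j.
Proof.
split=> [[fG [d [d2 dG]]]|[j j6 ->]].
  apply: hex_face1 => //; have [dE] := has_dim_uniq d2 hex_dim.
  by rewrite dE in dG.
split; first by exists (nn j).
by exists 1%N; split; [exact: hex_dim|exact: hex_edge_dim].
Qed.

Lemma hex_edge_inj j k : (j < 6)%N -> (k < 6)%N -> hex_edge j = hex_edge k -> j = k.
Proof.
move=> j6 k6 jk; have [] := hex_edge_ends j6; rewrite jk.
move=> /(hex_edgeP _ k6)[_ /eqP h1] /(hex_edgeP _ k6)[_ /eqP h2].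
move: h1 h2; rewrite !hex_normal_vertex_eq ?hex_next_lt //.
by case: j j6 {jk} => [|[|[|[|[|[|//]]]]]] _; case: k k6 => [|[|[|[|[|[|//]]]]]].
Qed.

Lemma hex_vertexP v : vertex hexagon v -> exists2 j, (j < 6)%N & v = vv (nx j).
Proof.
move=> [q]; case: (hex_cases q) => [->|[j [c [j6 c0 ->]]]|[j [c [c' [j6 c0 c'0 ->]]]]].
- rewrite (face_at0 hex_polytope) => e; have := hex_dim; rewrite -e => d2.
  by have := has_dim_uniq (has_dim1 v) d2.
- rewrite hex_edge_scale // => e; have := hex_edge_dim j6; rewrite -e => d2.
  by have := has_dim_uniq (has_dim1 v) d2.
- rewrite hex_vertex_face // => e; exists j => //.
  by have : [set v] v by []; rewrite e.
Qed.

Let fs := [seq hex_edge j | j <- iota 0 6].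

Lemma hex_facets_uniq : uniq fs.
Proof.
rewrite map_inj_in_uniq ?iota_uniq // => j k; rewrite !mem_iota !add0n => j6 k6.
exact: hex_edge_inj.
Qed.

Lemma hex_facetsP G : G \in fs <-> facet hexagon G.
Proof.
rewrite hex_facetP; split=> [/mapP[j + ->]|[j j6 ->]].
  by rewrite mem_iota => j6; exists j.
by apply: map_f; rewrite mem_iota.
Qed.

Lemma hex_simple : simple hexagon.
Proof.
exists 2%N; first exact: hex_dim.
move=> v /hex_vertexP[j j6 ->]; have nj6 := hex_next_lt j6.
have -> : [set G | facet hexagon G /\ G (vv (nx j))] = [set` [:: hex_edge j;
  hex_edge (nx j)]].
  apply/seteqP; split=> [G /= [/hex_facetP[k k6 ->] /(hex_edgeP _ k6)[_ /eqP]]|G /=].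
    rewrite hex_normal_vertex_eq // => h; rewrite !inE.
    suff /orP[/eqP ->|/eqP ->] : (k == j) || (k == nx j) by rewrite eqxx ?orbT.
    by move: h; case: j j6 {nj6} => [|[|[|[|[|[|//]]]]]] _;
      case: k k6 => [|[|[|[|[|[|//]]]]]].
  have [_ Ej] := hex_edge_ends j6; have [Enj _] := hex_edge_ends nj6.
  by rewrite !inE => /orP[/eqP ->|/eqP ->]; split=> //; apply/hex_facetP;
    [exists j|exists (nx j)].
apply/card_uniq_I => //=; rewrite inE andbT; apply/negP => /eqP /(hex_edge_inj j6 nj6).
by case: j j6 {nj6} => [|[|[|[|[|[|//]]]]]].
Qed.

Lemma hex_seed : seed hexagon.
Proof.
split; [exact: hex_polytope|exact: hex_dim| |exact: hex_simple|exact: hex_interior].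
move=> _ /hex_facetP[j j6 ->].
exists (int_vec rat (hex_normal_x j) (hex_normal_y j)).
rewrite /hex_edge; congr face_at; apply/rowP => k.
by rewrite !mxE rmorph_int.
Qed.

(** [facet_normal] is a choice, so uniqueness is needed: the chosen normal is [c *: nn j], c is a
    natural number by pairing with a lattice point, and primitivity makes it 1. *)
Lemma hex_facet_normal j : (j < 6)%N -> facet_normal hexagon (hex_edge j) = nn j.
Proof.
move=> j6; have fE : facet hexagon (hex_edge j) by apply/hex_facetP; exists j.
have [pw wE] := facet_normalP hex_seed fE; set w := facet_normal _ _ in pw wE *.
have nj6 := hex_next_lt j6.
case: (hex_cases w) => [w0|[k [c [k6 c0 wk]]]|[k [c [c' [k6 c0 c'0 wk]]]]].
- by have := primitive_neq0 pw; rewrite w0 eqxx.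
- move: wE; rewrite wk hex_edge_scale // => /(hex_edge_inj j6 k6) jk; rewrite -jk in wk *.
  have cE : dot w (- vv j) = c by rewrite wk dotZl dotNr hex_dot1 // opprK mulr1.
  have cZ : c \is a Num.int.
    rewrite -cE; apply: lattice_dot; first by case: pw.
    by rewrite -scaleN1r -[_ *: _]addr0; apply: lattice_lincomb; rewrite ?rpredN1 //;
      [exact: int_vec_lattice|exact: lattice0].
  have [cc ccE] : exists cc : nat, c = cc%:R by apply/natrP; rewrite natrEint cZ ltW.
  have [_ /(_ cc (nn j) (int_vec_lattice _ _))] := pw.
  by rewrite wk ccE scaler_nat => /(_ erefl) ->.
- move: wE; rewrite wk hex_vertex_face // => e.
  have d1 := hex_edge_dim j6; rewrite e in d1.
  by have := has_dim_uniq (has_dim1 _) d1.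
Qed.

Lemma hex_primitive_delzant : primitive_delzant hexagon.
Proof.
have vZ v : vertex hexagon v -> lattice v.
  by move=> /hex_vertexP[j _ ->]; exact: int_vec_lattice.
split.
  apply: (delzant_of_dual hex_seed hex_facets_uniq hex_facetsP vZ) => v w i vxv [dw _] vi.
  have [j j6 vE] := hex_vertexP vxv; have nj6 := hex_next_lt j6.
  have nZ k : (k < 6)%N -> hex_edge k v -> dot (nn k) (w i) \is a Num.int.
    move=> k6 Ekv; have fk : facet hexagon (hex_edge k) by apply/hex_facetP; exists k.
    have [l lk] := facet_ofE hex_facetsP fk.
    have lE : fnormal hexagon l = nn k by rewrite /fnormal lk hex_facet_normal.
    have tl : tight (@fnormal R 2 hexagon fs) (@foffset R 2 hexagon fs) v l.
      by apply/(facet_of_tight hex_seed hex_facetsP l (vertex_in vxv)); rewrite lk.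
    by rewrite -lE dw // rpred_nat.
  have [_ Ej] := hex_edge_ends j6; have [Enj _] := hex_edge_ends nj6;
    rewrite -vE in Ej Enj.
  have dZ a c d e : lattice (int_vec R a c - int_vec R d e).
    by rewrite addrC -scaleN1r; apply: lattice_lincomb; rewrite ?rpredN1 //;
      exact: int_vec_lattice.
  rewrite (hex_basis (w i) j6); apply: lattice_lincomb; [exact: nZ|exact: dZ|].
  by rewrite -[_ *: _]addr0; apply: lattice_lincomb;
    [exact: nZ|exact: dZ|exact: lattice0].
move=> E x [fE dE] Ex xl; have [j j6 EE] := hex_face1 fE dE.
rewrite {}EE in Ex; have /(hex_edgeP _ j6)[Hx nx1] := Ex; have nj6 := hex_next_lt j6.
have [p p6 pj] := hex_next_surj j6.
have aZ : dot (nn (nx j)) x \is a Num.int by apply: lattice_dot => //;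
  exact: int_vec_lattice.
have a1 : -1 <= dot (nn (nx j)) x by exact: hex_ge.
(* The normal of edge j is the sum of those of its two adjacent edges. On edge j it is -1 and the
   preceding normal is at least -1, so the following one is at most 0; a lattice point leaves it the
   values -1 and 0, attained at the ends. *)
have a0 : dot (nn (nx j)) x <= 0.
  have := hex_ge p6 Hx; have := congr1 (fun q => dot q x) (hex_normalD p6).
  by rewrite /= dotDl pj nx1; lra.
have [m mE] : exists m : nat, - dot (nn (nx j)) x = m%:R.
  by apply/natrP; rewrite natrEint rpredN aZ oppr_ge0.
have m1 : (m <= 1)%N by rewrite -(ler_nat R) -mE lerNl.
have xE := hex_basis x j6; rewrite nx1 in xE.
case: m m1 mE => [|[|//]] _ mE.
  have n0 : dot (nn (nx j)) x = 0 by move: mE; lra.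
  rewrite n0 in xE; have -> : x = vv j; last exact: hex_vertex_vertex.
  by rewrite xE [RHS](hex_basis _ j6) hex_dot1 // hex_dot_prev.
have n1 : dot (nn (nx j)) x = -1 by move: mE; lra.
rewrite n1 in xE; have -> : x = vv (nx j); last exact: hex_vertex_vertex.
by rewrite xE [RHS](hex_basis _ j6) hex_dot2 // hex_dot1.
Qed.

Lemma hex_offset_sum (s : seq (set 'rV[R]_2)) : uniq s -> [set` s] = facet hexagon ->
  \sum_(G <- facets_in hexagon s) - supp hexagon (facet_normal hexagon G) = 6.
Proof.
move=> us sE; have pF : perm_eq (facets_in hexagon s) fs.
  apply: uniq_perm; [exact: filter_uniq|exact: hex_facets_uniq|move=> G].
  apply/idP/idP => [|/hex_facetsP fG]; rewrite mem_filter.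
    by move=> /andP[/asboolP /hex_facetsP].
  have sG : [set` s] G by rewrite sE.
  by apply/andP; split; [exact/asboolP|exact: sG].
rewrite (perm_big _ pF) big_map big_seq (eq_bigr (fun=> 1)) => [|j]; last first.
  by rewrite mem_iota => j6; rewrite hex_facet_normal // supp_hex // opprK.
by rewrite -big_seq big_const_seq count_predT size_iota iter_addr addr0.
Qed.

End Hexagon.

Theorem theorem5p17 (R : realType) :
  (forall (n : nat) (S : set 'rV[R]_n) (B : set (set 'rV[R]_n))
      (PB : set 'rV[R]_n),
    seed S -> building_set S B -> B_truncation S B PB ->
    [/\ exists2 e0 : R, 0 < e0 & forall e : R, 0 < e < e0 ->
          (forall F, B F -> shallow e S F) /\
          polytopal_basis PB [set Tr e S F | F in B],
        polytopal_generating_set PB ([set DTr S F | F in B] `|` [set S]),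
        delzant S ->
          integral_polytopal_generating_set PB
            ([set Tr 1 S F | F in B] `|` [set S])
      & primitive_delzant S ->
          [/\ [set DTr S F | F in B] = [set Tr 1 S F | F in B],
              forall F, B F -> flat S F
            & polytopal_basis PB [set DTr S F | F in B]]]) /\
  (* the basis of the last item need not be integral *)
  (exists (n : nat) (S : set 'rV[R]_n) (B : set (set 'rV[R]_n))
      (PB : set 'rV[R]_n),
    [/\ seed S, building_set S B, B_truncation S B PB, primitive_delzant S
      & ~ integral_polytopal_generating_set PB [set DTr S F | F in B]]).
Proof.
split=> [n S B PB seedS buildB [s [us sB so st]]|].
  split.
  - exact: (truncations_small_basis seedS buildB us sB so st).
  - exact: (deep_truncations_generate seedS buildB us sB so st).
  - exact: (unit_truncations_integral seedS buildB us sB so st).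
  - exact: (primitive_flat_basis seedS buildB us sB so st).
have sH := hex_seed R; have fU := hex_facets_uniq R; have fP := @hex_facetsP R.
have [Q BQ] := facets_truncation sH fU fP.
have bH := facets_building_set sH fU fP.
exists 2%N, (@hexagon R), (facet (@hexagon R)), Q; split=> //.
  exact: hex_primitive_delzant.
have [s [us sB so st]] := BQ.
apply: (primitive_not_integral sH bH us sB so st (hex_primitive_delzant R)).
move=> m /intrP[z ->]; rewrite (hex_offset_sum us sB).
have -> : (6 : R) - 1 = 5%:~R by rewrite -[6%R]/(6%:R) mulrSr addrK.
rewrite -intrM -[6%R]/(6%:~R) eqr_int; apply/eqP => z6.
by have := congr1 (fun k => (k %% 5)%Z) z6; rewrite modzMl.
Qed.
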